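(* For every fixed $\epsilon>0$ there is a polynomial-time LP-based $\left(\frac{5}{3}+\epsilon\right)$-approximation algorithm for TAP: a polynomial-time algorithm which, given a TAP instance, outputs a feasible solution $S\subseteq L$ with $|S|\le(\frac53+\epsilon)\cdot\mathrm{OPT}$, where the guarantee is established relative to the optimal value of the bundle LP $\mathrm{LP}_\gamma$ for a suitable $\gamma$ depending only on $\epsilon$ (which is at most $\mathrm{OPT}$).
   Context: Weighted Tree Augmentation Problem (WTAP): given an undirected tree $G=(V,E)$, a set of links $L\subseteq V\times V$ disjoint from $E$, and costs $c\in\mathbb{R}^L_{\ge 0}$, find a minimum-cost $F\subseteq L$ such that $(V,E\cup F)$ is 2-edge-connected. TAP is the special case $c_\ell=1$ for all $\ell\in L$. For a link $\ell=uv$ let $P_\ell$ be the $u$–$v$ path in $G$; $\ell$ covers $e$ if $e\in P_\ell$, and $F$ is feasible iff $\bigcup_{\ell\in F}P_\ell=E$. For $X\subseteq E$, $\mathrm{cov}(X)$ is the set of links covering at least one edge of $X$ and $\mathrm{OPT}(X)$ the minimum cost of a link set covering $X$; $\mathrm{OPT}=\mathrm{OPT}(E)$. A $\gamma$-bundle ($\gamma\in\mathbb{Z}_{\ge1}$) is a union of $\gamma$ (not necessarily distinct) paths of $G$. $\mathrm{LP}_\gamma$: minimize $\sum_\ell c_\ell x_\ell$ s.t. $\sum_{\ell\in\mathrm{cov}(\{e\})}x_\ell\ge1$ for all $e\in E$, $x\ge0$, and $\sum_{\ell\in\mathrm{cov}(B)}c_\ell x_\ell\ge\mathrm{OPT}(B)$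 for every $\gamma$-bundle $B$. *)

(* Defs.v *)
From HB Require Import structures.
From mathcomp Require Import all_boot all_order all_algebra.
From mathcomp Require Import boolp reals.

Set Implicit Arguments.
Unset Strict Implicit.
Unset Printing Implicit Defensive.

Import Order.TTheory GRing.Theory Num.Theory.
Local Open Scope ring_scope.

(** * Graphs *)

(* An undirected graph on the vertex type [V] is given by its edge set; the
   edge uv is the set [set u; v]. *)

Section Graphs.
Variable V : finType.
Implicit Types (E : {set {set V}}) (u v : V) (s : seq V).

Definition adj E : rel V := fun u v => [set u; v] \in E.

Definition connected_graph E : bool := [forall u, forall v, connect (adj E) u v].

Definition two_edge_connected E : bool :=
  connected_graph E && [forall e in E, connected_graph (E :\ e)].

Definition is_tree E : Prop :=
  [/\ (0 < #|V|)%N,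
      forall e, e \in E -> #|e| = 2%N,
      connected_graph E &
      forall s, (2 < size s)%N -> ~~ ucycleb (adj E) s].

(* The walk with vertex sequence u :: s is a (simple) path from u to v. *)
Definition is_path E u s v : bool :=
  [&& path (adj E) u s, uniq (u :: s) & last u s == v].

Definition path_edges u s : {set {set V}} :=
  [set:: pairmap (fun x y => [set x; y]) u s].

End Graphs.

(** * The weighted tree augmentation problem and its bundle LP *)

(* A link is a pair of vertices, read as an undirected edge between them. *)

Section WTAP.
Variables (V : finType) (E : {set {set V}}) (L : {set V * V}).
Implicit Types (l : V * V) (e : {set V}) (F : {set V * V}) (X B : {set {set V}}).

Definition link_edges F : {set {set V}} := [set [set l.1; l.2] | l in F].

(* In a tree there is exactly one path [s] as below. *)
Definition link_path l : {set {set V}} :=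
  [set e | `[< exists s, is_path E l.1 s l.2 /\ e \in path_edges l.1 s >]].

Definition covers F X : bool := X \subset \bigcup_(l in F) link_path l.

Definition cov X : {set V * V} := [set l in L | [exists e in X, e \in link_path l]].

Definition feasible F : bool :=
  (F \subset L) && two_edge_connected (E :|: link_edges F).

Definition bundle (gamma : nat) B : Prop :=
  exists (u v : 'I_gamma -> V) (s : 'I_gamma -> seq V),
    (forall i, is_path E (u i) (s i) (v i)) /\
    B = \bigcup_i path_edges (u i) (s i).

Variables (R : realType) (c : V * V -> R).

Definition cost F : R := \sum_(l in F) c l.

(* Meaningful when [L] covers [X], in particular on feasible instances. *)
Definition OPT X : R :=
  cost [arg min_(F < L | (F \subset L) && covers F X) cost F]%O.

Definition LP_feasible (gamma : nat) (x : V * V -> R) : Prop :=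
  [/\ forall e, e \in E -> 1 <= \sum_(l in cov [set e]) x l,
      forall l, l \in L -> 0 <= x l &
      forall B, bundle gamma B -> OPT B <= \sum_(l in cov B) c l * x l].

(* The infimum over a nonempty set bounded below by 0 on feasible instances
   with nonnegative costs. *)
Definition LP_value (gamma : nat) : R :=
  inf (fun r => exists2 x, LP_feasible gamma x & r = \sum_(l in L) c l * x l).

End WTAP.

(** * Polynomial time *)

Local Close Scope ring_scope.

(* Algorithms are programs of Jones' WHILE language: imperative programs with
   finitely many variables ranging over binary trees.  An assignment is charged
   the size of the assigned tree, so running time is polynomially equivalent to
   running time on multi-tape Turing machines. *)

Inductive data : Type := DNil | DCons of data & data.

Fixpoint dsize (d : data) : nat :=
  if d is DCons d1 d2 then (dsize d1 + dsize d2).+1 else 1.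

Definition dhd (d : data) : data := if d is DCons d1 _ then d1 else DNil.
Definition dtl (d : data) : data := if d is DCons _ d2 then d2 else DNil.
Definition dtrue (d : data) : bool := if d is DNil then false else true.

Inductive expr : Type :=
  | EVar of nat
  | ENil
  | ECons of expr & expr
  | EHd of expr
  | ETl of expr.

Definition store : Type := nat -> data.

Fixpoint eval (s : store) (e : expr) : data :=
  match e with
  | EVar i => s i
  | ENil => DNil
  | ECons e1 e2 => DCons (eval s e1) (eval s e2)
  | EHd e1 => dhd (eval s e1)
  | ETl e1 => dtl (eval s e1)
  end.

Definition update (s : store) (i : nat) (d : data) : store :=
  fun j => if j == i then d else s j.

Inductive cmd : Type :=
  | Skip
  | Assign of nat & expr
  | Seq of cmd & cmd
  | If of expr & cmd & cmd
  | While of expr & cmd.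

(* [exec p s s' t]: started in store [s], the program [p] halts in store [s']
   after [t] time units. *)
Inductive exec : cmd -> store -> store -> nat -> Prop :=
  | ExecSkip s : exec Skip s s 1
  | ExecAssign i e s :
      exec (Assign i e) s (update s i (eval s e)) (dsize (eval s e)).+1
  | ExecSeq p1 p2 s s1 s2 t1 t2 :
      exec p1 s s1 t1 -> exec p2 s1 s2 t2 -> exec (Seq p1 p2) s s2 (t1 + t2).+1
  | ExecIfTrue e p1 p2 s s' t :
      dtrue (eval s e) -> exec p1 s s' t -> exec (If e p1 p2) s s' t.+1
  | ExecIfFalse e p1 p2 s s' t :
      ~~ dtrue (eval s e) -> exec p2 s s' t -> exec (If e p1 p2) s s' t.+1
  | ExecWhileTrue e p s s1 s2 t1 t2 :
      dtrue (eval s e) -> exec p s s1 t1 -> exec (While e p) s1 s2 t2 ->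
      exec (While e p) s s2 (t1 + t2).+1
  | ExecWhileFalse e p s :
      ~~ dtrue (eval s e) -> exec (While e p) s s 1.

(* Input and output are passed in variable 0; the others start as [DNil]. *)
Definition runs (p : cmd) (input output : data) (t : nat) : Prop :=
  exists2 s, exec p (update (fun=> DNil) 0 input) s t & s 0 = output.

(** * Instances of TAP *)

(* The tree and the links are presented to the algorithm as lists, in an
   arbitrary order; links with the same endpoints and links from a vertex to
   itself are allowed. *)
Record tap_instance : Type := TapInstance {
  tap_n : nat;
  tap_edges : seq ('I_tap_n * 'I_tap_n);
  tap_links : seq ('I_tap_n * 'I_tap_n) }.

Definition tapV (I : tap_instance) : finType := 'I_(tap_n I).

Definition tapE (I : tap_instance) : {set {set tapV I}} :=
  [set [set e.1; e.2] | e in tap_edges I].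

Definition tapL (I : tap_instance) : {set tapV I * tapV I} :=
  [set l in tap_links I].

Definition tap_valid (I : tap_instance) : Prop :=
  is_tree (tapE I) /\ [disjoint link_edges (tapL I) & tapE I].

(* Vertices are written in unary; a tree on n vertices has n - 1 edges, so this
   is polynomially equivalent to the binary encoding. *)
Definition enc_nat (n : nat) : data := iter n (DCons DNil) DNil.

Definition enc_seq (A : Type) (enc : A -> data) (s : seq A) : data :=
  foldr (fun a d => DCons (enc a) d) DNil s.

Definition enc_pair (n : nat) (p : 'I_n * 'I_n) : data :=
  DCons (enc_nat p.1) (enc_nat p.2).

Definition enc_instance (I : tap_instance) : data :=
  DCons (enc_nat (tap_n I))
    (DCons (enc_seq (@enc_pair _) (tap_edges I))
           (enc_seq (@enc_pair _) (tap_links I))).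

(* [out] is a repetition-free list of the links in [S]. *)
Definition encodes_links (I : tap_instance) (out : data)
    (S : {set tapV I * tapV I}) : Prop :=
  exists s : seq ('I_(tap_n I) * 'I_(tap_n I)),
    [/\ uniq s, S = [set l in s] & out = enc_seq (@enc_pair _) s].

Definition unit_cost (R : realType) (V : finType) : V * V -> R := fun=> 1%R.

Definition TAP_OPT (R : realType) (I : tap_instance) : R :=
  OPT (tapE I) (tapL I) (@unit_cost R (tapV I)) (tapE I).

Definition TAP_LP (R : realType) (I : tap_instance) (gamma : nat) : R :=
  LP_value (tapE I) (tapL I) (@unit_cost R (tapV I)) gamma.

(* Main.v *)
(* Root the tree, and let m be the number of links.  A nonnegative vector x on
   the links is rounded as follows, for a large constant q.  Going upwards, cut
   every edge e of LP coverage at most q for which the part hanging at e has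
   total coverage more than q^2.  There are at most x(L) / (q^2 - q) cut edges,
   and the other edges that top a part of coverage more than q^2 have coverage
   more than q, so that at most 2 x(L) / q links cover these.  The remaining
   edges fall into small parts, which are bundles with boundedly many leaves.
   If a link covering no cut edge touches at most one small part call it an
   in-link, otherwise it touches two and is a cross-link.  Two solutions:
   - An optimal cover of each small part, found by exhaustive search: by the
     bundle constraints this costs about x(in) + 2 x(cross).
   - In each small part, go upwards and for every uncovered edge, a witness,
     take the link that reaches highest above it.  No link covers two nested
     witnesses, so there are at most 2 x(L) of them.  Now match witnesses
     greedily by cross-links, which can replace the two links chosen for them.
     An in-link covers at most two unmatched witnesses, a cross-link at most
     one, whence a cost of about 2 x(in) + 3/2 x(cross).
   The better of the two costs at most about 5/3 x(L).

   No LP solver is needed.  Starting from 0, raise x by a small step on a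
   constraint violated in the course of the rounding if there is one, and lower
   all of x otherwise.  As in the relaxation method of Agmon and Motzkin, the
   distance from x to any LP solution decreases until x passes all the tests
   with a value x(L) that is not much larger than that of the LP solution. *)

Require Import Defs.
From mathcomp Require Import all_boot all_order all_algebra.
From mathcomp Require Import boolp reals.
From mathcomp Require Import zify ring lra.

Set Implicit Arguments.
Unset Strict Implicit.
Unset Printing Implicit Defensive.

(** * Polynomial-time computable functions *)

(** The ratio comes from weighing the two solutions 1 : 2. If they cost [a] and [b], the better one
    costs at most [(a + 2 b) / 3], and in [a + 2 b] an in-link is charged 1 + 4 and a cross-link 2 +
    3, that is 5 in either case. So the analysis adds up, for each link, the parts that it touches,
    the witnesses that it covers and the unmatched ones among them. The partition depends on x, so
    the constraints tested change from round to round. This does no harm: the distance argument only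
    needs every reported constraint to hold for all LP solutions. The solution compared with is
    arbitrary and unknown to the algorithm, hence the bound holds for the LP value. LP values are
    kept as integers in units of [1 / (q * m)]. Constraints are tested with slack [1 / q]: a cover
    has at least one link, so the slack costs only a factor [q / (q - 1)], and it makes a step of
    one unit on up to m links pay off. The bundle constraint of a part is available only if the part
    has few leaves, which in turn needs its edges to be covered; therefore single edges are tested
    first. *)

Definition pbounded (b : nat -> nat) : Prop :=
  {homo b : m n / m <= n} /\ exists a k, forall n, b n <= a * n.+1 ^ k.

Lemma pbounded_cst c : pbounded (fun=> c).
Proof. by split=> //; exists c, 0 => n; rewrite muln1. Qed.

Lemma pbounded_id : pbounded id.
Proof. by split=> //; exists 1, 1 => n; rewrite mul1n expn1. Qed.

Lemma pbounded_add b1 b2 :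
  pbounded b1 -> pbounded b2 -> pbounded (fun n => b1 n + b2 n).
Proof.
move=> [m1 [a1 [k1 h1]]] [m2 [a2 [k2 h2]]]; split=> [m n le_mn|].
  exact: leq_add (m1 _ _ le_mn) (m2 _ _ le_mn).
exists (a1 + a2), (k1 + k2) => n; rewrite mulnDl leq_add //.
  by rewrite (leq_trans (h1 n)) // leq_mul // leq_pexp2l // leq_addr.
by rewrite (leq_trans (h2 n)) // leq_mul // leq_pexp2l // leq_addl.
Qed.

Lemma pboundedS b : pbounded b -> pbounded (fun n => (b n).+1).
Proof.
move=> hb; under eq_fun do rewrite -addn1.
by apply: pbounded_add => //; apply: pbounded_cst.
Qed.

Lemma pbounded_mul b1 b2 :
  pbounded b1 -> pbounded b2 -> pbounded (fun n => b1 n * b2 n).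
Proof.
move=> [m1 [a1 [k1 h1]]] [m2 [a2 [k2 h2]]]; split=> [m n le_mn|].
  exact: leq_mul (m1 _ _ le_mn) (m2 _ _ le_mn).
exists (a1 * a2), (k1 + k2) => n.
by rewrite expnD mulnACA leq_mul.
Qed.

Lemma pbounded_comp b1 b2 :
  pbounded b1 -> pbounded b2 -> pbounded (fun n => b1 (b2 n)).
Proof.
move=> [m1 [a1 [k1 h1]]] [m2 [a2 [k2 h2]]]; split=> [m n le_mn|].
  exact/m1/m2.
exists (a1 * a2.+1 ^ k1), (k2 * k1) => n.
rewrite (leq_trans (h1 _)) // -mulnA leq_mul // expnM -expnMn.
case: k1 h1 => [|k1] _; rewrite ?expn0 // leq_exp2r //.
by rewrite mulSn -addn1 addnC leq_add ?expn_gt0.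
Qed.

Class Enc (A : Type) := enc : A -> data.
#[global] Instance Enc_nat : Enc nat := enc_nat.
#[global] Instance Enc_unit : Enc unit := fun=> DNil.
#[global] Instance Enc_bool : Enc bool :=
  fun b => if b then DCons DNil DNil else DNil.
#[global] Instance Enc_prod A B {EA : Enc A} {EB : Enc B} : Enc (A * B) :=
  fun p => DCons (enc p.1) (enc p.2).
#[global] Instance Enc_seq A {EA : Enc A} : Enc (seq A) := enc_seq enc.

(* Unlike [have :=], this resolves the implicit encodings. *)
Tactic Notation "note" constr(h) := generalize h.

Definition esize A {EA : Enc A} (x : A) : nat := dsize (enc x).

(* The program works in the registers from [k] on: it maps the content of
   register [k], and may overwrite the registers above [k]. *)
Definition computes A B {EA : Enc A} {EB : Enc B} (f : A -> B) (p : nat -> cmd)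
    (b : nat -> nat) : Prop :=
  forall x k s, s k = enc x -> exists s' t,
    [/\ exec (p k) s s' t, s' k = enc (f x),
        forall j, j < k -> s' j = s j & t <= b (esize x)].

(** Output size is bounded along with time, since in a composition the second program is charged for
    the size of the first result. *)
Definition polyt A B {EA : Enc A} {EB : Enc B} (f : A -> B) : Prop :=
  exists p b, [/\ pbounded b, computes f p b &
                  forall x, esize (f x) <= b (esize x)].

Lemma eq_polyt A B {EA : Enc A} {EB : Enc B} (f g : A -> B) :
  f =1 g -> polyt f -> polyt g.
Proof. by move=> /funext ->. Qed.

Lemma dsize_gt0 d : 0 < dsize d.
Proof. by case: d. Qed.

Lemma esize_gt0 A {EA : Enc A} (x : A) : 0 < esize x.
Proof. exact: dsize_gt0. Qed.

Lemma esize_pair A B {EA : Enc A} {EB : Enc B} (p : A * B) :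
  esize p = (esize p.1 + esize p.2).+1.
Proof. by []. Qed.

Lemma esize_cons A {EA : Enc A} (x : A) s : esize (x :: s) = (esize x + esize s).+1.
Proof. by []. Qed.

Lemma size_esize A {EA : Enc A} (s : seq A) : size s <= esize s.
Proof. by elim: s => // a s IH; rewrite esize_cons /=; lia. Qed.

Lemma esize_cat A {EA : Enc A} (s1 s2 : seq A) :
  (esize (s1 ++ s2)).+1 = esize s1 + esize s2.
Proof. by elim: s1 => [|a s1 IH] //=; rewrite !esize_cons; lia. Qed.

Lemma esize_rev A {EA : Enc A} (s : seq A) : esize (rev s) = esize s.
Proof.
elim: s => // a s IH; rewrite rev_cons -cats1.
note (esize_cat (rev s) [:: a]); have e1 : esize ([::] : seq A) = 1 by []; rewrite !esize_cons e1; lia.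
Qed.

Lemma esize_filter A {EA : Enc A} (a : pred A) s : esize (filter a s) <= esize s.
Proof.
elim: s => //= x s IH; rewrite esize_cons; case: (a x).
  by rewrite esize_cons; lia.
by lia.
Qed.

Lemma esize_map A B {EA : Enc A} {EB : Enc B} (f : A -> B) s M :
  (forall x, esize x <= esize s -> esize (f x) <= M) ->
  esize (map f s) <= esize s * M.+1 + 1.
Proof.
move=> fM; have: esize s <= esize s by []; move: fM.
generalize (esize s) at 1 3 => N fM; elim: s => [|x s IH] leN; first by rewrite addn1.
rewrite /= !esize_cons in leN *.
have h : esize (map f s) <= esize s * M.+1 + 1 by apply: IH; lia.
by have := fM x; lia.
Qed.

Lemma esize_nat (n : nat) : esize n = n.*2.+1.
Proof.
by elim: n => // n IH; have -> : esize n.+1 = (esize n).+2 by []; lia.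
Qed.

Lemma polyt_expr A B {EA : Enc A} {EB : Enc B} (f : A -> B) (e : nat -> expr) c :
  (forall k s x, s k = enc x -> eval s (e k) = enc (f x)) ->
  (forall x, esize (f x) <= esize x + c) -> polyt f.
Proof.
move=> ev sz; exists (fun k => Assign k (e k)), (fun n => n + c.+1).
split.
- exact: pbounded_add pbounded_id (pbounded_cst _).
- move=> x k s sk; exists (update s k (eval s (e k))), (dsize (eval s (e k))).+1.
  split; first exact: ExecAssign.
  + by rewrite /update eqxx (ev _ _ x).
  + by move=> j ltjk; rewrite /update ltn_eqF.
  + by rewrite (ev _ _ x) // addnS ltnS; apply: sz.
- by move=> x; rewrite (leq_trans (sz x)) // addnS.
Qed.

Section Combinators.
Context {G A B C : Type} {EG : Enc G} {EA : Enc A} {EB : Enc B} {EC : Enc C}.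

Lemma polyt_id : polyt (fun c : G => c).
Proof.
apply: (@polyt_expr _ _ _ _ _ (fun k => EVar k) 0) => //= x.
by rewrite addn0.
Qed.

Lemma polyt_comp (f : G -> A) (g : A -> B) :
  polyt g -> polyt f -> polyt (fun c => g (f c)).
Proof.
move=> [pg [bg [hbg cg sg]]] [pf [bf [hbf cf sf]]].
exists (fun k => Seq (pf k) (pg k)), (fun n => bf n + bg (bf n) + 1).
have hb : pbounded (fun n => bf n + bg (bf n) + 1).
  apply: pbounded_add; last exact: pbounded_cst.
  by apply: pbounded_add => //; apply: pbounded_comp.
split=> //.
- move=> x k s sk.
  have [s1 [t1 [e1 v1 k1 l1]]] := cf x k s sk.
  have [s2 [t2 [e2 v2 k2 l2]]] := cg (f x) k s1 v1.
  exists s2, (t1 + t2).+1; split=> //.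
  + exact: ExecSeq e1 e2.
  + by move=> j ltjk; rewrite k2 ?k1.
  + rewrite addn1 ltnS leq_add // (leq_trans l2) //.
    by case: hbg => mono _; apply: mono; apply: sf.
- move=> x; rewrite (leq_trans (sg _)) //.
  rewrite -addnA addnCA (leq_trans _ (leq_addr _ _)) //.
  by case: hbg => mono _; apply: mono; apply: sf.
Qed.

Lemma polyt_pair (f : G -> A) (g : G -> B) :
  polyt f -> polyt g -> polyt (fun c => (f c, g c)).
Proof.
move=> [pf [bf [hbf cf sf]]] [pg [bg [hbg cg sg]]].
exists (fun k => Seq (Assign k.+1 (EVar k)) (Seq (pf k.+1)
  (Seq (Assign k.+2 (EVar k)) (Seq (pg k.+2)
    (Assign k (ECons (EVar k.+1) (EVar k.+2))))))).
exists (fun n => n + n + 10 + (bf n + bf n) + (bg n + bg n)).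
have hb : pbounded (fun n => n + n + 10 + (bf n + bf n) + (bg n + bg n)).
  by do ?[apply: pbounded_add => //]; try exact: pbounded_cst; exact: pbounded_id.
split=> //.
- move=> x k s sk.
  set s1 := update s k.+1 (eval s (EVar k)).
  have s1k : s1 k.+1 = enc x by rewrite /s1 /update eqxx.
  have [s2 [t2 [e2 v2 k2 l2]]] := cf x k.+1 s1 s1k.
  set s3 := update s2 k.+2 (eval s2 (EVar k)).
  have s3k : s3 k.+2 = enc x.
    by rewrite /s3 /update eqxx /= k2 // /s1 /update ltn_eqF.
  have [s4 [t4 [e4 v4 k4 l4]]] := cg x k.+2 s3 s3k.
  have v41 : s4 k.+1 = enc (f x) by rewrite k4 // /s3 /update ltn_eqF.
  eexists; eexists; split.
  + apply: ExecSeq; first exact: ExecAssign.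
    apply: ExecSeq; first exact: e2.
    apply: ExecSeq; first exact: ExecAssign.
    apply: ExecSeq; first exact: e4.
    exact: ExecAssign.
  + by rewrite /update eqxx /= v41 v4.
  + move=> j ltjk; rewrite /update ltn_eqF // k4; last by lia.
    rewrite /s3 /update ltn_eqF; last by lia.
    rewrite k2; last by lia.
    by rewrite /s1 /update ltn_eqF //; lia.
  + rewrite /= v41 v4 k2 // /s1 /update ltn_eqF // sk.
    have := sf x; have := sg x; rewrite /esize in l2 l4 *.
    move: l2 l4; lia.
- move=> x; have := sf x; have := sg x; rewrite /esize /=; lia.
Qed.

Lemma polyt_if (c : G -> bool) (f g : G -> A) :
  polyt c -> polyt f -> polyt g -> polyt (fun x => if c x then f x else g x).
Proof.
move=> [pc [bc [hbc cc sc]]] [pf [bf [hbf cf sf]]] [pg [bg [hbg cg sg]]].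
exists (fun k => Seq (Assign k.+1 (EVar k)) (Seq (pc k.+1)
  (If (EVar k.+1) (pf k) (pg k)))).
exists (fun n => n + 10 + bc n + (bf n + bg n)).
have hb : pbounded (fun n => n + 10 + bc n + (bf n + bg n)).
  by do ?[apply: pbounded_add => //]; try exact: pbounded_cst; exact: pbounded_id.
split=> //.
- move=> x k s sk.
  set s1 := update s k.+1 (eval s (EVar k)).
  have s1k : s1 k.+1 = enc x by rewrite /s1 /update eqxx.
  have [s2 [t2 [e2 v2 k2 l2]]] := cc x k.+1 s1 s1k.
  have s2k : s2 k = enc x by rewrite k2 // /s1 /update ltn_eqF.
  have k2' j : j < k -> s2 j = s j.
    by move=> ltjk; rewrite k2 ?ltnS 1?ltnW // /s1 /update ltn_eqF // ltnS ltnW.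
  case Ecx: (c x).
    have [s3 [t3 [e3 v3 k3 l3]]] := cf x k s2 s2k.
    eexists; eexists; split.
    + apply: ExecSeq; first exact: ExecAssign.
      apply: ExecSeq; first exact: e2.
      apply: ExecIfTrue; last exact: e3.
      by rewrite /= v2 Ecx.
    + exact: v3.
    + by move=> j ltjk; rewrite k3 ?k2'.
    + rewrite /= sk; rewrite /esize in l2 l3 *; move: l2 l3; lia.
  have [s3 [t3 [e3 v3 k3 l3]]] := cg x k s2 s2k.
  eexists; eexists; split.
  + apply: ExecSeq; first exact: ExecAssign.
    apply: ExecSeq; first exact: e2.
    apply: ExecIfFalse; last exact: e3.
    by rewrite /= v2 Ecx.
  + exact: v3.
  + by move=> j ltjk; rewrite k3 ?k2'.
  + rewrite /= sk; rewrite /esize in l2 l3 *; move: l2 l3; lia.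
- move=> x; have := sf x; have := sg x; case: (c x); lia.
Qed.

End Combinators.

Section MoreCombinators.
Context {G A B S : Type} {EG : Enc G} {EA : Enc A} {EB : Enc B} {ES : Enc S}.

Lemma polyt_fst (f : G -> A * B) : polyt f -> polyt (fun c => (f c).1).
Proof.
move=> hf; apply: (polyt_comp (g := fst)) hf.
apply: (@polyt_expr _ _ _ _ _ (fun k => EHd (EVar k)) 0) => [k s [a b] /= -> //|].
by move=> [a b]; rewrite /esize /=; lia.
Qed.

Lemma polyt_snd (f : G -> A * B) : polyt f -> polyt (fun c => (f c).2).
Proof.
move=> hf; apply: (polyt_comp (g := snd)) hf.
apply: (@polyt_expr _ _ _ _ _ (fun k => ETl (EVar k)) 0) => [k s [a b] /= -> //|].
by move=> [a b]; rewrite /esize /=; lia.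
Qed.



Lemma polyt_cst (b : B) : polyt (fun c : G => b).
Proof.
pose fix e d := if d is DCons d1 d2 then ECons (e d1) (e d2) else ENil.
have ev s d : eval s (e d) = d by elim: d => //= d1 -> d2 ->.
apply: (@polyt_expr _ _ _ _ _ (fun=> e (enc b)) (esize b)) => [k s c _|c].
  exact: ev.
exact: leq_addl.
Qed.

Lemma polyt_cons (f : G -> A) (g : G -> seq A) :
  polyt f -> polyt g -> polyt (fun c => f c :: g c).
Proof.
move=> hf hg; apply: (polyt_comp (f := fun c => (f c, g c)) (g := fun p => p.1 :: p.2)).
  apply: (@polyt_expr _ _ _ _ _ (fun k => EVar k) 0) => [k s [a b] /= -> //|].
  by move=> [a b]; rewrite addn0.
exact: polyt_pair.
Qed.

Lemma polyt_behead (f : G -> seq A) : polyt f -> polyt (fun c => behead (f c)).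
Proof.
apply: (polyt_comp (g := behead)).
apply: (@polyt_expr _ _ _ _ _ (fun k => ETl (EVar k)) 0) => [k s [|a b] /= -> //|].
by move=> [|a b]; rewrite ?esize_cons /=; lia.
Qed.

(* Loops are the only source of superpolynomial growth, so the size of the
   intermediate states has to be bounded separately. *)
Lemma polyt_foldl (l : G -> seq A) (s0 : G -> S) (st : G -> S -> A -> S) b :
  polyt l -> polyt s0 -> polyt (fun p : G * (S * A) => st p.1 p.2.1 p.2.2) ->
  pbounded b ->
  (forall c l1 l2, l c = l1 ++ l2 -> esize (foldl (st c) (s0 c) l1) <= b (esize c)) ->
  polyt (fun c => foldl (st c) (s0 c) (l c)).
Proof.
move=> [pl [bl [hbl cl sl]]] [p0 [b0 [hb0 c0 sz0]]] [ps [bs [hbs cs ss]]] hb sz.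
(* Register [k] keeps the parameter, [k.+1] the unread rest of the list, [k.+2] the accumulator, and
   [k.+3] the argument of the loop body. *)
exists (fun k => Seq (Assign k.+1 (EVar k)) (Seq (pl k.+1)
  (Seq (Assign k.+2 (EVar k)) (Seq (p0 k.+2)
  (Seq (While (EVar k.+1)
    (Seq (Assign k.+3 (ECons (EVar k) (ECons (EVar k.+2) (EHd (EVar k.+1)))))
    (Seq (ps k.+3)
    (Seq (Assign k.+2 (EVar k.+3)) (Assign k.+1 (ETl (EVar k.+1)))))))
    (Assign k (EVar k.+2))))))).
pose bi n := n + b n + bl n + 10 + bs (n + b n + bl n + 2) + b n + bl n.
exists (fun n => n + n + 10 + bl n + b0 n + (bl n * bi n + 1) + b n).
have hbi : pbounded bi.
  rewrite /bi; do ?[apply: pbounded_add => //]; try exact: pbounded_cst;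
    try exact: pbounded_id.
  apply: pbounded_comp => //.
  by do ?[apply: pbounded_add => //]; try exact: pbounded_cst; exact: pbounded_id.
split.
- do ?[apply: pbounded_add => //]; try exact: pbounded_cst; try exact: pbounded_id.
  by apply: pbounded_mul.
- move=> x k s sk.
  set s1 := update s k.+1 (eval s (EVar k)).
  have s1k : s1 k.+1 = enc x by rewrite /s1 /update eqxx.
  have [s2 [t2 [e2 v2 k2 l2]]] := cl x k.+1 s1 s1k.
  set s3 := update s2 k.+2 (eval s2 (EVar k)).
  have s3k : s3 k.+2 = enc x.
    by rewrite /s3 /update eqxx /= k2 // /s1 /update ltn_eqF.
  have [s4 [t4 [e4 v4 k4 l4]]] := c0 x k.+2 s3 s3k.
  have v41 : s4 k.+1 = enc (l x) by rewrite k4 // /s3 /update ltn_eqF.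
  have v40 : s4 k = enc x.
    by rewrite k4 // /s3 /update ltn_eqF // k2 // /s1 /update ltn_eqF.
  have k4' j : j < k -> s4 j = s j.
    move=> ltjk; rewrite k4; last by lia.
    rewrite /s3 /update ltn_eqF; last by lia.
    rewrite k2; last by lia.
    by rewrite /s1 /update ltn_eqF //; lia.
  have loop : forall l2 l1 s, l x = l1 ++ l2 -> s k = enc x -> s k.+1 = enc l2 ->
      s k.+2 = enc (foldl (st x) (s0 x) l1) ->
      exists s' t, [/\ exec (While (EVar k.+1)
    (Seq (Assign k.+3 (ECons (EVar k) (ECons (EVar k.+2) (EHd (EVar k.+1)))))
    (Seq (ps k.+3)
    (Seq (Assign k.+2 (EVar k.+3)) (Assign k.+1 (ETl (EVar k.+1))))))) s s' t,
      s' k.+2 = enc (foldl (st x) (s0 x) (l x)),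
      forall j, j < k -> s' j = s j & t <= size l2 * bi (esize x) + 1].
    elim=> [|a l2' IH] l1 u El uk u1 u2.
      exists u, 1; split=> //; first by apply: ExecWhileFalse; rewrite /= u1.
      by rewrite u2 El cats0.
    set y := (x, (foldl (st x) (s0 x) l1, a)).
    set u3 := update u k.+3
      (eval u (ECons (EVar k) (ECons (EVar k.+2) (EHd (EVar k.+1))))).
    have u3k : u3 k.+3 = enc y by rewrite /u3 /update eqxx /= uk u1 u2.
    have [u4 [t5 [e5 v5 k5 l5]]] := cs y k.+3 u3 u3k.
    set u5 := update u4 k.+2 (eval u4 (EVar k.+3)).
    set u6 := update u5 k.+1 (eval u5 (ETl (EVar k.+1))).
    have k3 j : j < k.+3 -> u4 j = u j.
      by move=> ltj; rewrite k5 // /u3 /update ltn_eqF.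
    have k6 j : j < k.+1 -> u6 j = u j.
      move=> ltj; rewrite /u6 /update ltn_eqF // /u5 /update ltn_eqF; last by lia.
      by rewrite k3 //; lia.
    have u61 : u6 k.+1 = enc l2'.
      rewrite /u6 /update eqxx /= /u5 /update ltn_eqF // k3; last by lia.
      by rewrite u1.
    have u62 : u6 k.+2 = enc (foldl (st x) (s0 x) (rcons l1 a)).
      rewrite /u6 /update gtn_eqF // /u5 /update eqxx /= v5 /=.
      by rewrite foldl_rcons.
    have El' : l x = rcons l1 a ++ l2' by rewrite cat_rcons.
    have u60 : u6 k = enc x by rewrite k6.
    have [u7 [t6 [e6 v6 k7 l6]]] := IH _ u6 El' u60 u61 u62.
    eexists; eexists; split.
    + apply: ExecWhileTrue; last exact: e6; first by rewrite /= u1.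
      apply: ExecSeq; first exact: ExecAssign.
      apply: ExecSeq; first exact: e5.
      apply: ExecSeq; first exact: ExecAssign.
      exact: ExecAssign.
    + exact: v6.
    + by move=> j ltjk; rewrite k7 // k6 //; lia.
    + have sza : esize a + esize l2' <= bl (esize x).
        apply: leq_trans (sl x); rewrite El.
        elim: (l1) => [|h l1' IH1] /=; rewrite esize_cons; lia.
      have szs := sz _ _ _ El.
      have szs' := sz _ _ _ El'.
      have szy : esize y <= esize x + b (esize x) + bl (esize x) + 2.
        rewrite /y !esize_pair /=; lia.
      have l5' : t5 <= bs (esize x + b (esize x) + bl (esize x) + 2).
        by apply: leq_trans l5 _; case: hbs => mono _; apply: mono.
      rewrite /= v5 uk u1 u2 /= /u5 /update ltn_eqF // k3; last by lia.
      rewrite u1 /= mulSn.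
      rewrite foldl_rcons in szs'.
      move: l6 l5' sza szs szs'; rewrite -/(bi (esize x)).
      set P := size l2' * _; rewrite /bi /esize -/(enc l2').
      set z := dsize (enc (st _ _ _)); set z1 := dsize (enc l2').
      have := dsize_gt0 (enc a).
      lia.
  have [s5 [t5 [e5 v5 k5 l5]]] := loop (l x) [::] s4 erefl v40 v41 v4.
  eexists; eexists; split.
  + apply: ExecSeq; first exact: ExecAssign.
    apply: ExecSeq; first exact: e2.
    apply: ExecSeq; first exact: ExecAssign.
    apply: ExecSeq; first exact: e4.
    apply: ExecSeq; first exact: e5.
    exact: ExecAssign.
  + by rewrite /update eqxx /= v5.
  + by move=> j ltjk; rewrite /update ltn_eqF // k5 ?k4'.
  + have szl : size (l x) * bi (esize x) <= bl (esize x) * bi (esize x).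
      rewrite leq_mul2r; apply/orP; right; apply: leq_trans (sl x).
      exact: size_esize.
    have szf := sz x (l x) [::] (esym (cats0 _)).
    rewrite /= v5 k2 // /s1 /update ltn_eqF // sk.
    move: l2 l4 l5 szl szf; rewrite /esize.
    set F := dsize (enc (foldl _ _ _)).
    set P1 := (size _ * _); set P2 := (_ * bi _).
    lia.
- move=> x; have := sz x (l x) [::] (esym (cats0 _)); lia.
Qed.

End MoreCombinators.


(** * Loops with a size invariant, and functions on lists *)

Lemma polyt_bound A B {EA : Enc A} {EB : Enc B} (f : A -> B) :
  polyt f -> exists2 b, pbounded b & forall x, esize (f x) <= b (esize x).
Proof. by case=> p [b [hb _ sz]]; exists b. Qed.

Lemma pboundedD b1 b2 b3 : pbounded b1 -> pbounded b2 -> pbounded b3 ->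
  pbounded (fun n => b1 (n + b2 n + b3 n)).
Proof.
move=> h1 h2 h3; apply: (pbounded_comp (b2 := fun n => n + b2 n + b3 n)) h1 _.
by do ?[apply: pbounded_add] => //; exact: pbounded_id.
Qed.


(** The invariant may refer to the sizes of the list and of the initial state, as these are
    polynomial in the input. *)
Lemma polyt_fold {G : Type} {EG : Enc G} {A : Type} {EA : Enc A} {S : Type} {ES : Enc S}
    b (l : G -> seq A) (s0 : G -> S) (st : G -> S -> A -> S) :
  polyt l -> polyt s0 -> polyt (fun p : G * (S * A) => st p.1 p.2.1 p.2.2) ->
  pbounded b ->
  (forall c l1 l2, l c = l1 ++ l2 -> esize (foldl (st c) (s0 c) l1)
     <= b (esize c + esize (l c) + esize (s0 c))) ->
  polyt (fun c => foldl (st c) (s0 c) (l c)).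
Proof.
move=> hl h0 hst hb sz.
have [bl hbl szl] := polyt_bound hl; have [b0 hb0 sz0] := polyt_bound h0.
apply: (polyt_foldl hl h0 hst (pboundedD hb hbl hb0)) => c l1 l2 El.
apply: leq_trans (sz c l1 l2 El) _; case: hb => mono _; apply: mono.
by have := szl c; have := sz0 c; lia.
Qed.

Lemma polyt_nilp {G : Type} {EG : Enc G} {A : Type} {EA : Enc A}
    (f : G -> seq A) : polyt f -> polyt (fun c => nilp (f c)).
Proof.
move=> hf.
have h : polyt (fun c => foldl (fun _ _ => false) true (f c)).
  apply: (polyt_fold (b := fun=> 3)) => //; try exact: polyt_cst.
    exact: pbounded_cst.
  by move=> c l1 l2 _; case: foldl.
apply: eq_polyt h => c; case: (f c) => //= a l.
by elim: l.
Qed.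

Lemma polyt_head {G : Type} {EG : Enc G} {A : Type} {EA : Enc A}
    (x : A) (f : G -> seq A) :
  polyt f -> polyt (fun c => head x (f c)).
Proof.
move=> hf.
pose st (s : A * bool) a := if s.2 then s else (a, true).
have stT l a : foldl st (a, true) l = (a, true) by elim: l.
have h : polyt (fun c => (foldl st (x, false) (f c)).1).
  apply: polyt_fst; apply: (polyt_fold (b := fun n => n + esize x + 4)) => //.
  - exact: polyt_cst.
  - apply: polyt_if.
    + exact/polyt_snd/polyt_fst/polyt_snd/polyt_id.
    + exact/polyt_fst/polyt_snd/polyt_id.
    + by apply: polyt_pair; [exact/polyt_snd/polyt_snd/polyt_id|exact: polyt_cst].
  - by do ?[apply: pbounded_add]; try exact: pbounded_cst; exact: pbounded_id.
  - move=> c [|a l1] l2 ->; first by rewrite /= esize_pair /=; have e1 : esize false = 1 by []; rewrite e1; lia.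
    rewrite /= stT !esize_cons esize_pair /=; have e3 : esize true = 3 by []; rewrite e3; lia.
by apply: eq_polyt h => c; case: (f c) => //= a l; rewrite stT.
Qed.

Lemma polyt_rev {G : Type} {EG : Enc G} {A : Type} {EA : Enc A}
    (l : G -> seq A) : polyt l -> polyt (fun c => rev (l c)).
Proof.
move=> hl.
have foldlE l1 (s : seq A) : foldl (fun s a => a :: s) s l1 = catrev l1 s.
  by elim: l1 s => //= a l1 IH s; rewrite IH.
have h : polyt (fun c => foldl (fun s a => a :: s) [::] (l c)).
  apply: (polyt_fold (b := fun n => n)) => //.
  - exact: polyt_cst.
  - by apply: polyt_cons; [exact/polyt_snd/polyt_snd/polyt_id|exact/polyt_fst/polyt_snd/polyt_id].
  - exact: pbounded_id.
  - move=> c l1 l2 ->; rewrite foldlE -/(rev l1) esize_rev.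
    by note (esize_cat l1 l2); note (esize_gt0 l2); lia.
by apply: eq_polyt h => c; rewrite foldlE.
Qed.

Lemma polyt_cat {G : Type} {EG : Enc G} {A : Type} {EA : Enc A}
    (l1 l2 : G -> seq A) :
  polyt l1 -> polyt l2 -> polyt (fun c => l1 c ++ l2 c).
Proof.
move=> h1 h2.
have foldlE l (s : seq A) : foldl (fun s a => a :: s) s l = catrev l s.
  by elim: l s => //= a l IH s; rewrite IH.
have h : polyt (fun c => foldl (fun s a => a :: s) (l2 c) (rev (l1 c))).
  apply: (polyt_fold (b := fun n => n)) => //.
  - exact: polyt_rev.
  - by apply: polyt_cons; [exact/polyt_snd/polyt_snd/polyt_id|exact/polyt_fst/polyt_snd/polyt_id].
  - exact: pbounded_id.
  - move=> c l l' E; rewrite foldlE catrevE.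
    note (esize_cat (rev l) (l2 c)); note (esize_cat l l'); note (esize_gt0 l').
    by rewrite E esize_rev; lia.
by apply: eq_polyt h => c; rewrite foldlE catrevE revK.
Qed.

Lemma polyt_map {G : Type} {EG : Enc G} {A : Type} {EA : Enc A} {B : Type} {EB : Enc B}
    (f : G -> A -> B) (l : G -> seq A) :
  polyt (fun p : G * A => f p.1 p.2) -> polyt l ->
  polyt (fun c => map (f c) (l c)).
Proof.
move=> hf hl.
have [bf hbf szf] := polyt_bound hf.
have foldlE c l1 s : foldl (fun s a => f c a :: s) s l1 = catrev (map (f c) l1) s.
  by elim: l1 s => //= a l1 IH s; rewrite IH.
have h : polyt (fun c => rev (foldl (fun s a => f c a :: s) [::] (l c))).
  apply: polyt_rev.
  apply: (polyt_fold (b := fun n => n * (bf n.+1).+1 + 1)) => //.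
  - exact: polyt_cst.
  - apply: polyt_cons; last exact/polyt_fst/polyt_snd/polyt_id.
    apply: (polyt_comp (f := fun p : G * (seq B * A) => (p.1, p.2.2))
                       (g := fun p => f p.1 p.2)) => //.
    by apply: polyt_pair; [exact/polyt_fst/polyt_id|exact/polyt_snd/polyt_snd/polyt_id].
  - apply: pbounded_add; last exact: pbounded_cst.
    apply: pbounded_mul; first exact: pbounded_id.
    apply: pboundedS; apply: (pbounded_comp (b2 := fun n => n.+1)) => //.
    exact/pboundedS/pbounded_id.
  - move=> c l1 l2 E; rewrite foldlE -/(rev _) esize_rev.
    have lel : esize l1 <= esize (l c).
      by rewrite E; note (esize_cat l1 l2); note (esize_gt0 l2); lia.
    set N := esize c + _ + _.
    apply: leq_trans (esize_map (M := bf N.+1) _) _ => [x lex|].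
      apply: leq_trans (szf (c, x)) _; case: hbf => mono _; apply: mono.
      by rewrite esize_pair /= /N; lia.
    rewrite leq_add2r leq_mul2r; apply/orP; right; rewrite /N; lia.
by apply: eq_polyt h => c; rewrite foldlE -/(rev _) revK.
Qed.

Lemma polyt_filter {G : Type} {EG : Enc G} {A : Type} {EA : Enc A}
    (f : G -> A -> bool) (l : G -> seq A) :
  polyt (fun p : G * A => f p.1 p.2) -> polyt l ->
  polyt (fun c => filter (f c) (l c)).
Proof.
move=> hf hl.
have foldlE c l1 s : foldl (fun s a => if f c a then a :: s else s) s l1
    = catrev (filter (f c) l1) s.
  by elim: l1 s => //= a l1 IH s; rewrite IH; case: (f c a).
have h : polyt (fun c => rev (foldl (fun s a => if f c a then a :: s else s) [::] (l c))).
  apply: polyt_rev; apply: (polyt_fold (b := fun n => n)) => //.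
  - exact: polyt_cst.
  - apply: polyt_if; last exact/polyt_fst/polyt_snd/polyt_id.
      apply: (polyt_comp (f := fun p : G * (seq A * A) => (p.1, p.2.2))
                         (g := fun p => f p.1 p.2)) => //.
      by apply: polyt_pair; [exact/polyt_fst/polyt_id|exact/polyt_snd/polyt_snd/polyt_id].
    by apply: polyt_cons; [exact/polyt_snd/polyt_snd/polyt_id|exact/polyt_fst/polyt_snd/polyt_id].
  - exact: pbounded_id.
  - move=> c l1 l2 E; rewrite foldlE -/(rev _) esize_rev.
    rewrite (leq_trans (esize_filter _ _)) // E.
    by note (esize_cat l1 l2); note (esize_gt0 l2); lia.
by apply: eq_polyt h => c; rewrite foldlE -/(rev _) revK.
Qed.

Lemma polyt_has {G : Type} {EG : Enc G} {A : Type} {EA : Enc A}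
    (f : G -> A -> bool) (l : G -> seq A) :
  polyt (fun p : G * A => f p.1 p.2) -> polyt l ->
  polyt (fun c => has (f c) (l c)).
Proof.
move=> hf hl.
have h : polyt (fun c => if nilp (filter (f c) (l c)) then false else true).
  by apply: polyt_if; [exact/polyt_nilp/polyt_filter|exact: polyt_cst|exact: polyt_cst].
by apply: eq_polyt h => c; elim: (l c) => //= a s IH; case: (f c a).
Qed.

Lemma polyt_negb {G : Type} {EG : Enc G}
    (f : G -> bool) : polyt f -> polyt (fun c => ~~ f c).
Proof.
move=> hf; have : polyt (fun c => if f c then false else true).
  by apply: polyt_if => //; exact: polyt_cst.
by apply: eq_polyt => c; case: (f c).
Qed.

Lemma polyt_andb {G : Type} {EG : Enc G}
    (f g : G -> bool) : polyt f -> polyt g -> polyt (fun c => f c && g c).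
Proof.
by move=> hf hg; apply: (polyt_if (c := f) (f := g) (g := fun=> false)) => //; exact: polyt_cst.
Qed.

Lemma polyt_orb {G : Type} {EG : Enc G}
    (f g : G -> bool) : polyt f -> polyt g -> polyt (fun c => f c || g c).
Proof.
by move=> hf hg; apply: (polyt_if (c := f) (f := fun=> true) (g := g)) => //; exact: polyt_cst.
Qed.


Lemma polyt_app2 {G A B C : Type} {EG : Enc G} {EA : Enc A} {EB : Enc B} {EC : Enc C}
    (h : A -> B -> C) (f : G -> A) (g : G -> B) :
  polyt (fun p : A * B => h p.1 p.2) -> polyt f -> polyt g ->
  polyt (fun c => h (f c) (g c)).
Proof.
move=> hh hf hg; exact: (polyt_comp hh (polyt_pair hf hg)).
Qed.

(** * Arithmetic on unary numbers *)

Lemma polyt_S {G : Type} {EG : Enc G} (f : G -> nat) :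
  polyt f -> polyt (fun c => (f c).+1).
Proof.
apply: (polyt_comp (g := succn)).
apply: (@polyt_expr _ _ _ _ _ (fun k => ECons ENil (EVar k)) 2) => [k s n /= -> //|n].
by rewrite /= !esize_nat; lia.
Qed.

Lemma polyt_pred {G : Type} {EG : Enc G} (f : G -> nat) :
  polyt f -> polyt (fun c => (f c).-1).
Proof.
apply: (polyt_comp (g := predn)).
apply: (@polyt_expr _ _ _ _ _ (fun k => ETl (EVar k)) 0) => [k s [|n] /= -> //|n].
by rewrite /= !esize_nat; lia.
Qed.

(** A unary number and a list of units have the same encoding, so the program for [f] serves
    unchanged. This turns counted loops into folds. *)
Lemma polyt_nseq {G : Type} {EG : Enc G} (f : G -> nat) :
  polyt f -> polyt (fun c => nseq (f c) tt).
Proof.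
have encE n : enc (nseq n tt) = enc n.
  by elim: n => //= n IH; rewrite -[LHS]/(DCons DNil (enc (nseq n tt))) IH.
case=> p [b [hb cf sf]]; exists p, b; split=> //.
  by move=> x k s /cf [s' [t [? v ? ?]]]; exists s', t; rewrite encE.
by move=> x; rewrite /esize encE; apply: sf.
Qed.

Lemma polyt_iter {G S : Type} {EG : Enc G} {ES : Enc S} b (n : G -> nat)
    (s0 : G -> S) (st : G -> S -> S) :
  polyt n -> polyt s0 -> polyt (fun p : G * S => st p.1 p.2) -> pbounded b ->
  (forall c i, i <= n c -> esize (iter i (st c) (s0 c))
     <= b (esize c + esize (n c) + esize (s0 c))) ->
  polyt (fun c => iter (n c) (st c) (s0 c)).
Proof.
move=> hn h0 hst hb sz.
have foldlE c i s : foldl (fun s (_ : unit) => st c s) s (nseq i tt) = iter i (st c) s.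
  by elim: i s => //= i IH s; rewrite IH -iterSr.
have h : polyt (fun c => foldl (fun s (_ : unit) => st c s) (s0 c) (nseq (n c) tt)).
  apply: (polyt_fold (b := b)) => //.
  - exact: polyt_nseq.
  - apply: polyt_app2 hst _ _; first exact/polyt_fst/polyt_id.
    exact/polyt_fst/polyt_snd/polyt_id.
  - move=> c l1 l2 E.
    have -> : l1 = nseq (size l1) tt.
      by elim: (l1) => //= -[] l {1}->.
    rewrite foldlE; apply: leq_trans (sz c _ _) _.
      by have /(congr1 size) := E; rewrite size_cat size_nseq => ->; apply: leq_addr.
    case: hb => mono _; apply: mono; rewrite leq_add2r leq_add2l.
    have -> : esize (nseq (n c) tt) = esize (n c); last by [].
    by rewrite esize_nat; elim: (n c) => //= m; rewrite esize_cons => ->.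
by apply: eq_polyt h => c; rewrite foldlE.
Qed.

Lemma polyt_addn {G : Type} {EG : Enc G} (f g : G -> nat) :
  polyt f -> polyt g -> polyt (fun c => f c + g c).
Proof.
move=> hf hg.
have h : polyt (fun c => iter (f c) succn (g c)).
  apply: (polyt_iter (b := id)) => //; first exact/polyt_S/polyt_snd/polyt_id.
    exact: pbounded_id.
  move=> c i; have -> : iter i succn (g c) = i + g c by elim: i => //= i ->.
  by rewrite /= !esize_nat; lia.
by apply: eq_polyt h => c; elim: (f c) => //= n ->.
Qed.

Lemma polyt_subn {G : Type} {EG : Enc G} (f g : G -> nat) :
  polyt f -> polyt g -> polyt (fun c => f c - g c).
Proof.
move=> hf hg.
have E m n : iter n predn m = m - n by elim: n => [|n /= ->] /=; lia.
have h : polyt (fun c => iter (g c) predn (f c)).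
  apply: (polyt_iter (b := id)) => //; first exact/polyt_pred/polyt_snd/polyt_id.
    exact: pbounded_id.
  by move=> c i; rewrite E /= !esize_nat; lia.
by apply: eq_polyt h => c; rewrite E.
Qed.

Lemma polyt_muln {G : Type} {EG : Enc G} (f g : G -> nat) :
  polyt f -> polyt g -> polyt (fun c => f c * g c).
Proof.
move=> hf hg.
have E m n : iter n (addn m) 0 = n * m by elim: n => [|n /= ->] /=; lia.
have h : polyt (fun c => iter (f c) (addn (g c)) 0).
  have [b hb sz] := polyt_bound hg.
  apply: (polyt_iter (b := fun n => n * b n + 1)) => //.
  - exact: polyt_cst.
  - by apply: polyt_addn; [apply: (polyt_comp hg); exact/polyt_fst/polyt_id
                          |exact/polyt_snd/polyt_id].
  - by apply: pbounded_add; [apply: pbounded_mul => //; exact: pbounded_id|exact: pbounded_cst].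
  - move=> c i lei; rewrite E (esize_nat (f c)) (esize_nat 0) (esize_nat (i * _)).
    have := sz c; rewrite esize_nat; set x := esize c + _ + _ => szc.
    have le1 : b (esize c) <= b x by case: hb => mono _; apply: mono; rewrite /x; lia.
    have lefx : f c <= x by rewrite /x; lia.
    move: szc le1 lefx; clearbody x => szc le1 lefx.
    have : i * g c <= f c * g c by rewrite leq_mul2r lei orbT.
    have : f c * (2 * g c) <= x * b x by apply: leq_mul => //; lia.
    lia.
by apply: eq_polyt h => c; rewrite E.
Qed.

Lemma polyt_leq {G : Type} {EG : Enc G} (f g : G -> nat) :
  polyt f -> polyt g -> polyt (fun c => f c <= g c).
Proof.
move=> hf hg.
have h : polyt (fun c => nilp (nseq (f c - g c) tt)).
  exact/polyt_nilp/polyt_nseq/polyt_subn.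
by apply: eq_polyt h => c; rewrite /nilp size_nseq.
Qed.

Lemma polyt_eqn {G : Type} {EG : Enc G} (f g : G -> nat) :
  polyt f -> polyt g -> polyt (fun c => f c == g c).
Proof.
move=> hf hg.
have h : polyt (fun c => (f c <= g c) && (g c <= f c)).
  by apply: polyt_andb; apply: polyt_leq.
by apply: eq_polyt h => c; rewrite eqn_leq.
Qed.

Lemma polyt_eqb {G : Type} {EG : Enc G} (f g : G -> bool) :
  polyt f -> polyt g -> polyt (fun c => f c == g c).
Proof.
move=> hf hg.
have h : polyt (fun c => if f c then g c else ~~ g c).
  by apply: polyt_if => //; apply: polyt_negb.
by apply: eq_polyt h => c; case: (f c); case: (g c).
Qed.

Lemma polyt_size {G A : Type} {EG : Enc G} {EA : Enc A} (l : G -> seq A) :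
  polyt l -> polyt (fun c => size (l c)).
Proof.
move=> hl.
have E (s : seq A) n : foldl (fun n _ => n.+1) n s = n + size s.
  by elim: s n => [|a s IH] n /=; rewrite ?IH; lia.
have h : polyt (fun c => foldl (fun n _ => n.+1) 0 (l c)).
  apply: (polyt_fold (b := fun n => n + n)) => //; first exact: polyt_cst.
  - exact/polyt_S/polyt_fst/polyt_snd/polyt_id.
  - by apply: pbounded_add; exact: pbounded_id.
  - move=> c l1 l2 ->; rewrite E !esize_nat.
    by note (esize_cat l1 l2); note (size_esize l1); note (esize_gt0 l2);
       note (esize_gt0 c); lia.
by apply: eq_polyt h => c; rewrite E.
Qed.

Lemma polyt_sumn {G : Type} {EG : Enc G} (l : G -> seq nat) :
  polyt l -> polyt (fun c => sumn (l c)).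
Proof.
move=> hl.
have E s n : foldl addn n s = n + sumn s.
  by elim: s n => [|a s IH] n /=; rewrite ?IH; lia.
have h : polyt (fun c => foldl addn 0 (l c)).
  apply: (polyt_fold (b := fun n => n + n)) => //; first exact: polyt_cst.
  - by apply: polyt_addn; [exact/polyt_fst/polyt_snd/polyt_id|exact/polyt_snd/polyt_snd/polyt_id].
  - by apply: pbounded_add; exact: pbounded_id.
  - move=> c l1 l2 ->; rewrite E !esize_nat.
    have : (sumn l1).*2 < esize (l1 ++ l2).
      by elim: l1 => [|a l1 IH] /=; [apply: esize_gt0|rewrite esize_cons esize_nat; lia].
    lia.
by apply: eq_polyt h => c; rewrite E.
Qed.

Lemma esize_seq_nat N (s : seq nat) :
  all (leq^~ N) s -> esize s <= size s * N.*2.+2 + 1.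
Proof.
by elim: s => //= a s IH /andP[leN /IH]; rewrite esize_cons esize_nat; lia.
Qed.

Lemma polyt_iota {G : Type} {EG : Enc G} (f : G -> nat) :
  polyt f -> polyt (fun c => iota 0 (f c)).
Proof.
move=> hf.
have E n : iter n (fun s => size s :: s) [::] = rev (iota 0 n).
  elim: n => //= n ->; rewrite size_rev size_iota -[in RHS]addn1 -cat1s.
  by rewrite -/(iota 0 n.+1) -addn1 iotaD rev_cat.
have h : polyt (fun c => rev (iter (f c) (fun s => size s :: s) [::])).
  apply: polyt_rev; apply: (polyt_iter (b := fun n => n.+2 * n.+2 + 1)) => //.
  - exact: polyt_cst.
  - by apply: polyt_cons; [apply/polyt_size/polyt_snd/polyt_id|exact/polyt_snd/polyt_id].
  - apply: pbounded_add; last exact: pbounded_cst.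
    by apply: pbounded_mul; exact/pboundedS/pboundedS/pbounded_id.
  - move=> c i lei; rewrite E esize_rev.
    have : all (leq^~ i) (iota 0 i) by apply/allP => j; rewrite mem_iota /=; lia.
    move=> /esize_seq_nat; rewrite size_iota esize_nat => h.
    apply: leq_trans h _; rewrite leq_add2r leq_mul //; lia.
by apply: eq_polyt h => c; rewrite E revK.
Qed.

Lemma polyt_all {G A : Type} {EG : Enc G} {EA : Enc A}
    (f : G -> A -> bool) (l : G -> seq A) :
  polyt (fun p : G * A => f p.1 p.2) -> polyt l ->
  polyt (fun c => all (f c) (l c)).
Proof.
move=> hf hl.
have h : polyt (fun c => ~~ has (fun x => ~~ f c x) (l c)).
  by apply/polyt_negb/polyt_has => //; apply: polyt_negb.
by apply: eq_polyt h => c; elim: (l c) => //= a s; rewrite negb_or negbK => ->.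
Qed.

Lemma polyt_flatten {G A : Type} {EG : Enc G} {EA : Enc A} (l : G -> seq (seq A)) :
  polyt l -> polyt (fun c => flatten (l c)).
Proof.
move=> hl.
have E (s : seq (seq A)) (u : seq A) : foldl cat u s = u ++ flatten s.
  by elim: s u => [|a s IH] u /=; rewrite ?cats0 // IH catA.
have h : polyt (fun c => foldl cat [::] (l c)).
  apply: (polyt_fold (b := id)) => //.
  - exact: polyt_cst.
  - by apply: polyt_cat; [exact/polyt_fst/polyt_snd/polyt_id|exact/polyt_snd/polyt_snd/polyt_id].
  - exact: pbounded_id.
  - move=> c l1 l2 ->; rewrite E /=.
    have : esize (flatten l1) <= esize l1.
      elim: l1 => //= a s IH; rewrite esize_cons.
      by note (esize_cat a (flatten s)); lia.
    note (esize_cat l1 l2); note (esize_gt0 l2); lia.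
by apply: eq_polyt h => c; rewrite E.
Qed.

Lemma polyt_mem_nat {G : Type} {EG : Enc G} (x : G -> nat) (l : G -> seq nat) :
  polyt x -> polyt l -> polyt (fun c => x c \in l c).
Proof.
move=> hx hl.
have h : polyt (fun c => has (fun y => y == x c) (l c)).
  apply: polyt_has => //; apply: polyt_eqn; first exact/polyt_snd/polyt_id.
  exact/(polyt_comp hx)/polyt_fst/polyt_id.
apply: eq_polyt h => c; rewrite -[RHS]has_pred1.
by apply: eq_has => y.
Qed.

Lemma polyt_eqseq {G : Type} {EG : Enc G} (s t : G -> seq nat) :
  polyt s -> polyt t -> polyt (fun c => s c == t c).
Proof.
move=> hs ht.
pose st (u : seq nat * bool) (x : nat) := (behead u.1, u.2 && (~~ nilp u.1 && (head 0 u.1 == x))).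
have E (s1 t1 : seq nat) b : foldl st (t1, b) s1 =
    (drop (size s1) t1, b && (take (size s1) t1 == s1)).
  elim: s1 t1 b => [|x s1 IH] [|y t1] b //=; rewrite ?andbT // IH //=.
    by rewrite andbF.
  by rewrite eqseq_cons andbA.
have h : polyt (fun c => (foldl st (t c, true) (s c)).2 &&
                         nilp (foldl st (t c, true) (s c)).1).
  have hf : polyt (fun c => foldl st (t c, true) (s c)).
    apply: (polyt_fold (b := fun n => n + 4)) => //.
    - by apply: polyt_pair => //; exact: polyt_cst.
    - have hu : polyt (fun p : G * ((seq nat * bool) * nat) => p.2.1).
        exact/polyt_fst/polyt_snd/polyt_id.
      apply: polyt_pair; first exact/polyt_behead/polyt_fst.
      apply: polyt_andb; first exact/polyt_snd.
      apply: polyt_andb; first exact/polyt_negb/polyt_nilp/polyt_fst.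
      by apply: polyt_eqn; [exact/polyt_head/polyt_fst|exact/polyt_snd/polyt_snd/polyt_id].
    - by apply: pbounded_add; [exact: pbounded_id|exact: pbounded_cst].
    - move=> c l1 l2 _; rewrite E !esize_pair /=.
      have hb (b : bool) : esize b <= 3 by case: b.
      have := hb (take (size l1) (t c) == l1).
      note (esize_cat (take (size l1) (t c)) (drop (size l1) (t c))).
      rewrite cat_take_drop; note (esize_gt0 (take (size l1) (t c))).
      lia.
  by apply: polyt_andb; [exact: polyt_snd|exact/polyt_nilp/polyt_fst].
apply: eq_polyt h => c; rewrite E /= /nilp size_drop.
elim: (s c) (t c) => [|x s1 IH] [|y t1] //=.
by rewrite !eqseq_cons subSS -andbA IH eq_sym.
Qed.

Lemma polyt_undup {G : Type} {T : eqType} {EG : Enc G} {ET : Enc T} (l : G -> seq T) :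
  polyt (fun p : T * T => p.1 == p.2) -> polyt l -> polyt (fun c => undup (l c)).
Proof.
move=> heq hl.
pose st (u : seq T) x := if has (fun y => y == x) u then u else x :: u.
have E s : foldl st [::] (rev s) = undup s.
  elim: s => //= x s IH; rewrite rev_cons foldl_rcons IH /st.
  rewrite (_ : has _ _ = (x \in s)) // -(mem_undup s) -[RHS]has_pred1.
  exact: eq_has.
have h : polyt (fun c => foldl st [::] (rev (l c))).
  apply: (polyt_fold (b := id)) => //.
  - exact: polyt_rev.
  - exact: polyt_cst.
  - have hu : polyt (fun p : G * (seq T * T) => p.2.1).
      exact/polyt_fst/polyt_snd/polyt_id.
    apply: polyt_if => //; last first.
      by apply: polyt_cons => //; exact/polyt_snd/polyt_snd/polyt_id.
    apply: polyt_has => //.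
    apply: (polyt_app2 heq); first exact/polyt_snd/polyt_id.
    exact/polyt_snd/polyt_snd/polyt_fst/polyt_id.
  - exact: pbounded_id.
  - move=> c l1 l2 E1 /=.
    have : forall u, (esize (foldl st u l1)).+1 <= esize l1 + esize u.
      elim: (l1) => [|x s IH] u /=; first by rewrite addSn.
      apply: leq_trans (IH _) _; rewrite esize_cons /st.
      by case: has; rewrite ?esize_cons; lia.
    move/(_ [::]); rewrite -[esize (rev _)]esize_rev revK.
    have : esize l1 <= esize (l c).
      by rewrite -(esize_rev (l c)) E1; note (esize_cat l1 l2); note (esize_gt0 l2); lia.
    by have e1 : esize ([::] : seq T) = 1 by []; rewrite e1; lia.
by apply: eq_polyt h => c; rewrite E.
Qed.

(** When the growth in one pass depends on the parameter and the list element but not on the state,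
    it cannot compound. *)
Lemma polyt_fold_add {G A S : Type} {EG : Enc G} {EA : Enc A} {ES : Enc S} d
    (l : G -> seq A) (s0 : G -> S) (st : G -> S -> A -> S) :
  polyt l -> polyt s0 -> polyt (fun p : G * (S * A) => st p.1 p.2.1 p.2.2) ->
  pbounded d ->
  (forall c s a, esize (st c s a) <= esize s + d (esize c + esize a)) ->
  polyt (fun c => foldl (st c) (s0 c) (l c)).
Proof.
move=> hl h0 hst hd sz; apply: (polyt_fold (b := fun n => n + n * d n)) => //.
  apply: pbounded_add; first exact: pbounded_id.
  by apply: pbounded_mul => //; exact: pbounded_id.
move=> c l1 l2 E; set N := esize c + _ + _.
have leN : esize c + esize l1 <= N.
  by rewrite /N E; note (esize_cat l1 l2); note (esize_gt0 l2); lia.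
have : esize (s0 c) + size l1 * d N <= N + N * d N.
  apply: leq_add; first by rewrite /N; lia.
  by rewrite leq_mul2r; note (size_esize l1); lia.
apply: leq_trans; case: hd => mono _.
clear E; clearbody N; elim/last_ind: l1 leN => [|l1 a IH] leN; first by rewrite addn0.
rewrite foldl_rcons size_rcons.
have e1 : (esize (l1 ++ [:: a])).+1 = esize l1 + esize [:: a] by exact: esize_cat.
rewrite cats1 esize_cons in e1.
have e2 : esize ([::] : seq A) = 1 by [].
have /IH h : esize c + esize l1 <= N by lia.
have h2 : d (esize c + esize a) <= d N by apply: mono; note (esize_gt0 l1); lia.
by rewrite mulSn; have := sz c (foldl (st c) (s0 c) l1) a; lia.
Qed.

(* Extended below, as functions are shown to be computable. *)
Ltac polyt_user := fail.

Ltac polyt_step := first [ assumption | polyt_user |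
  match goal with
  | |- polyt (fun c => c) => exact: polyt_id
  | |- polyt (fun _ => fst _) => apply: polyt_fst
  | |- polyt (fun _ => snd _) => apply: polyt_snd
  | |- polyt fst => exact: (polyt_fst polyt_id)
  | |- polyt snd => exact: (polyt_snd polyt_id)
  | |- polyt (fun _ => pair _ _) => apply: polyt_pair
  | |- polyt (fun _ => cons _ _) => apply: polyt_cons
  | |- polyt (fun _ => if _ then _ else _) => apply: polyt_if
  | |- polyt (fun _ => andb _ _) => apply: polyt_andb
  | |- polyt (fun _ => orb _ _) => apply: polyt_orb
  | |- polyt (fun _ => negb _) => apply: polyt_negb
  | |- polyt (fun _ => S _) => apply: polyt_S
  | |- polyt (fun _ => predn _) => apply: polyt_pred
  | |- polyt (fun _ => addn _ _) => apply: polyt_addn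
  | |- polyt (fun _ => muln _ _) => apply: polyt_muln
  | |- polyt (fun _ => leq _ _) => apply: polyt_leq
  | |- polyt (fun _ => nilp _) => apply: polyt_nilp
  | |- polyt (fun _ => head _ _) => apply: polyt_head
  | |- polyt (fun _ => size _) => apply: polyt_size
  | |- polyt (fun _ => sumn _) => apply: polyt_sumn
  | |- polyt (fun _ => iota 0 _) => apply: polyt_iota
  | |- polyt (fun _ => cat _ _) => apply: polyt_cat
  | |- polyt (fun _ => flatten _) => apply: polyt_flatten
  | |- polyt (fun _ => map _ _) => apply: polyt_map
  | |- polyt (fun _ => filter _ _) => apply: polyt_filter
  | |- polyt (fun _ => has _ _) => apply: polyt_has
  | |- polyt (fun _ => all _ _) => apply: polyt_all
  | |- polyt (fun _ => @eq_op _ _ _) =>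
      first [apply: polyt_eqb | apply: polyt_eqn | apply: polyt_eqseq]
  | |- polyt (fun _ => in_mem _ _) => apply: polyt_mem_nat
  | |- polyt (fun _ => ?b) => exact: polyt_cst
  end ].
Ltac polyt_tac := repeat polyt_step.


(** * The algorithm *)

(* A tree edge is represented by the list of the vertices below it, a weighted
   link by the pair of the link and its weight. *)
Notation link := (nat * nat)%type.
Notation edge := (seq nat).

(** The tree path of a link uses an edge exactly when the edge separates the two ends. *)
Definition cv (l : link) (s : edge) : bool := (l.1 \in s) != (l.2 \in s).

Definition sle (s t : edge) : bool := all (fun x => x \in t) s.

Definition mass (wl : seq (link * nat)) (A : seq edge) : nat :=
  sumn [seq p.2 | p <- wl & has (cv p.1) A].

Section Rounding.
Variables (q : nat) (fam : seq edge).
Implicit Types (wl : seq (link * nat)) (D A B : seq edge) (e : edge).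
Implicit Types (ls F : seq link) (l : link).

(** The subtree hanging at [e], pruned at the next cut edges. The exception [f != e] lets a cut edge
    head its own part. *)
Definition part D e : seq edge :=
  [seq g <- fam | sle g e && ~~ has (fun f => (f != e) && (sle g f && sle f e)) D].

(* A weight [X] stands for the LP value [X / (q * m)], where [m] is the number of
   links: a part is big if its LP coverage exceeds [q ^ 2], and only edges of LP
   coverage at most [q] are cut. *)
Definition big wl D e : bool := q ^ 3 * size wl < mass wl (part D e).

Definition cut_edge wl D e : bool :=
  big wl D e && (mass wl [:: e] <= q ^ 2 * size wl).

(** [fam] is sorted by size, so the fold meets an edge after all edges below it. *)
Definition cuts wl : seq edge :=
  foldl (fun D e => if cut_edge wl D e then e :: D else D) [::] fam.

Definition heavy wl D : seq edge := [seq e <- fam | big wl D e && (e \notin D)].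

Definition tops wl D : seq edge :=
  [seq e <- fam | ~~ big wl D e &&
    ~~ has (fun g => ~~ big wl D g && ((g != e) && (e \in part D g))) fam].

Fixpoint lists j ls : seq (seq link) :=
  if j is i.+1 then [::] :: flatten [seq [seq l :: F | F <- lists i ls] | l <- ls]
  else [:: [::]].

Definition covered F B : bool := all (fun g => has (fun l => cv l g) F) B.

(** The size test allows the LP value of [B] plus [1 / q]. In a small part, whose LP value is at
    most [q ^ 2], no list longer than those enumerated could pass it. *)
Definition fits wl B : seq (seq link) :=
  [seq F <- lists (q ^ 2).+1 [seq p.1 | p <- wl] |
    covered F B && (size F * (q * size wl) <= mass wl B + size wl)].

Definition reach A e l : nat := size [seq g <- A | sle e g && cv l g].

Definition climb_link A ls e : link :=
  let cs := [seq l <- ls | cv l e] in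
  foldl (fun b l => if reach A e b < reach A e l then l else b) (head (0, 0) cs) cs.

(* Greedy cover of [A] by links used only upwards from a witness edge. *)
Definition climb A ls : seq (edge * link) :=
  foldl (fun W g => if has (fun w => sle w.1 g && cv w.2 g) W then W
                    else (g, climb_link A ls g) :: W) [::] A.

Definition witnesses wl D : seq (edge * (edge * link)) :=
  flatten [seq [seq (e, w) | w <- climb (part D e) [seq p.1 | p <- wl]] | e <- tops wl D].

(** The requirement reaches up to the top of the part. It holds for links over no cut edge that
    cover the witness as well as a witness of another part. *)
Definition replaces D l (a : edge * (edge * link)) : bool :=
  all (fun g => ~~ sle a.2.1 g || cv l g) (part D a.1).

Definition matchable D (t : (edge * (edge * link)) * (edge * (edge * link)) * link) :=
  (t.1.1.1 != t.1.2.1) && (replaces D t.2 t.1.1 && replaces D t.2 t.1.2).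

Definition candidates wl D :=
  [seq t <- flatten [seq flatten [seq [seq (a, b, l) | l <- [seq p.1 | p <- wl]]
     | b <- witnesses wl D] | a <- witnesses wl D] | matchable D t].

(* The matched witnesses and the links that match them. *)
Definition matching wl D : seq edge * seq link :=
  foldl (fun M t => if (t.1.1.2.1 \in M.1) || (t.1.2.2.1 \in M.1) then M
                    else (t.1.1.2.1 :: t.1.2.2.1 :: M.1, t.2 :: M.2))
    ([::], [::]) (candidates wl D).

Definition base wl D : seq link :=
  [seq w.2 | w <- climb [seq e <- fam | e \in D] [seq p.1 | p <- wl] ++
                  climb (heavy wl D) [seq p.1 | p <- wl]].

Definition bundle_cover wl D : seq link :=
  flatten [seq head [::] (fits wl (part D e)) | e <- tops wl D].

Definition matching_cover wl D : seq link :=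
  (matching wl D).2 ++
  [seq a.2.2 | a <- witnesses wl D & a.2.1 \notin (matching wl D).1].

Definition rounded wl D : seq link :=
  if size (bundle_cover wl D) <= size (matching_cover wl D)
  then bundle_cover wl D ++ base wl D else matching_cover wl D ++ base wl D.

Definition solution wl : seq link :=
  [seq l <- [seq p.1 | p <- wl] | l \in rounded wl (cuts wl)].

(** Single edges come first: the head is a part only if every edge passes, and then the part has
    boundedly many leaves. *)
Definition violated wl : seq (seq edge) :=
  [seq B <- [seq [:: e] | e <- fam] ++ [seq part (cuts wl) e | e <- tops wl (cuts wl)]
    | nilp (fits wl B)].

Definition increase B wl : seq (link * nat) :=
  [seq (p.1, if has (cv p.1) B then p.2.+1 else p.2) | p <- wl].

Definition decrease wl : seq (link * nat) := [seq (p.1, p.2.-1) | p <- wl].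

Definition step (st : seq (link * nat) * seq link) : seq (link * nat) * seq link :=
  if nilp (violated st.1) then
    (decrease st.1,
     if size (solution st.1) < size st.2 then solution st.1 else st.2)
  else (increase (head [::] (violated st.1)) st.1, st.2).

End Rounding.

Definition same_edge (f e : nat * nat) : bool :=
  ((f.1 == e.1) && (f.2 == e.2)) || ((f.1 == e.2) && (f.2 == e.1)).

Definition expand n (es : seq (nat * nat)) (e : nat * nat) (r : seq nat) : seq nat :=
  [seq v <- iota 0 n | (v \in r) || has (fun f => ~~ same_edge f e &&
     (((f.1 \in r) && (f.2 == v)) || ((f.2 \in r) && (f.1 == v)))) es].

Definition below n es e : edge :=
  [seq v <- iota 0 n | v \notin iter n (expand n es e) [:: 0]].

(** A bucket sort by size, which puts lower edges before higher ones; [undup] allows for repetitions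
    in the edge list. *)
Definition cut_family n es : seq edge :=
  undup (flatten [seq [seq s <- [seq below n es e | e <- es] | size s == j]
                 | j <- iota 0 n.+1]).

(** The initial potential is at most [q ^ 2 * m ^ 4] and a step lowers it by [m]; one more round
    makes it negative. *)
Definition rounds q m : nat := q ^ 2 * (m * (m * m)) + 1.

Definition tap_alg q (I : nat * (seq (nat * nat) * seq (nat * nat))) : seq link :=
  let ls := undup I.2.2 in
  (iter (rounds q (size ls)) (step q (cut_family I.1 I.2.1)) ([seq (l, 0) | l <- ls], ls)).2.

(** * Running time of the algorithm *)


Lemma polyt_app3 {G A B C H : Type} {EG : Enc G} {EA : Enc A} {EB : Enc B} {EC : Enc C}
    {EH : Enc H} (h : A -> B -> C -> H) (f1 : G -> A) (f2 : G -> B) (f3 : G -> C) :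
  polyt (fun p : A * (B * C) => h p.1 p.2.1 p.2.2) -> polyt f1 -> polyt f2 -> polyt f3 ->
  polyt (fun c => h (f1 c) (f2 c) (f3 c)).
Proof.
move=> hh h1 h2 h3.
exact: (polyt_comp hh (polyt_pair h1 (polyt_pair h2 h3))).
Qed.

Lemma polyt_app4 {G A B C H K : Type} {EG : Enc G} {EA : Enc A} {EB : Enc B} {EC : Enc C}
    {EH : Enc H} {EK : Enc K} (h : A -> B -> C -> H -> K)
    (f1 : G -> A) (f2 : G -> B) (f3 : G -> C) (f4 : G -> H) :
  polyt (fun p : A * (B * (C * H)) => h p.1 p.2.1 p.2.2.1 p.2.2.2) ->
  polyt f1 -> polyt f2 -> polyt f3 -> polyt f4 ->
  polyt (fun c => h (f1 c) (f2 c) (f3 c) (f4 c)).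
Proof.
move=> hh h1 h2 h3 h4.
exact: (polyt_comp hh (polyt_pair h1 (polyt_pair h2 (polyt_pair h3 h4)))).
Qed.

Lemma polyt_mem {T : eqType} {ET : Enc T} :
  polyt (fun p : T * T => p.1 == p.2) -> polyt (fun p : T * seq T => p.1 \in p.2).
Proof.
move=> heq.
have h : polyt (fun p : T * seq T => has (fun y => y == p.1) p.2).
  apply: polyt_has; last exact: (polyt_snd polyt_id).
  apply: (polyt_app2 heq); first exact: (polyt_snd polyt_id).
  exact: (polyt_fst (polyt_fst polyt_id)).
apply: eq_polyt h => c; rewrite -[RHS]has_pred1.
by apply: eq_has => y.
Qed.

Lemma polyt_eq_edge : polyt (fun p : edge * edge => p.1 == p.2).
Proof. polyt_tac. Qed.

Lemma polyt_eq_link : polyt (fun p : link * link => p.1 == p.2).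
Proof.
have h : polyt (fun p : link * link => (p.1.1 == p.2.1) && (p.1.2 == p.2.2)) by polyt_tac.
by apply: eq_polyt h => -[[a b] [c d]].
Qed.

Lemma polyt_mem_edge : polyt (fun p : edge * seq edge => p.1 \in p.2).
Proof. exact/polyt_mem/polyt_eq_edge. Qed.

Lemma polyt_mem_link : polyt (fun p : link * seq link => p.1 \in p.2).
Proof. exact/polyt_mem/polyt_eq_link. Qed.

Lemma polyt_cv : polyt (fun p : link * edge => cv p.1 p.2).
Proof. rewrite /cv; polyt_tac. Qed.

Lemma polyt_sle : polyt (fun p : edge * edge => sle p.1 p.2).
Proof. rewrite /sle; polyt_tac. Qed.

Ltac polyt_user ::= match goal with
  | |- polyt (fun _ => cv _ _) => apply: (polyt_app2 polyt_cv)
  | |- polyt (fun _ => sle _ _) => apply: (polyt_app2 polyt_sle)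
  | |- polyt (fun _ => in_mem _ _) => apply: (polyt_app2 (h := fun (x : edge) (s : seq edge) => x \in s) polyt_mem_edge)
  | |- polyt (fun _ => in_mem _ _) => apply: (polyt_app2 (h := fun (x : link) (s : seq link) => x \in s) polyt_mem_link)
  end.

Lemma polyt_mass : polyt (fun p : seq (link * nat) * seq edge => mass p.1 p.2).
Proof. rewrite /mass; polyt_tac. Qed.

Lemma polyt_part : polyt (fun p : seq edge * (seq edge * edge) => part p.1 p.2.1 p.2.2).
Proof. rewrite /part; polyt_tac. Qed.

Ltac polyt_user ::= match goal with
  | |- polyt (fun _ => cv _ _) => apply: (polyt_app2 polyt_cv)
  | |- polyt (fun _ => sle _ _) => apply: (polyt_app2 polyt_sle)
  | |- polyt (fun _ => in_mem _ _) => apply: (polyt_app2 (h := fun (x : edge) (s : seq edge) => x \in s) polyt_mem_edge)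
  | |- polyt (fun _ => in_mem _ _) => apply: (polyt_app2 (h := fun (x : link) (s : seq link) => x \in s) polyt_mem_link)
  | |- polyt (fun _ => mass _ _) => apply: (polyt_app2 polyt_mass)
  | |- polyt (fun _ => part _ _ _) => apply: (polyt_app3 polyt_part)
  end.

Section Fixed.
Variable q : nat.

Lemma polyt_big : polyt (fun p : seq edge * (seq (link * nat) * (seq edge * edge)) =>
  big q p.1 p.2.1 p.2.2.1 p.2.2.2).
Proof. rewrite /big; polyt_tac. Qed.


Lemma polyt_cuts : polyt (fun p : seq edge * seq (link * nat) => cuts q p.1 p.2).
Proof.
rewrite /cuts; apply: (polyt_fold_add (d := succn)).
- polyt_tac.
- polyt_tac.
- rewrite /cut_edge; polyt_tac; apply: (polyt_app4 polyt_big); polyt_tac.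
- exact/pboundedS/pbounded_id.
- by move=> c s a; case: cut_edge; rewrite ?esize_cons; lia.
Qed.

Lemma polyt_reach : polyt (fun p : seq edge * (edge * link) => reach p.1 p.2.1 p.2.2).
Proof. rewrite /reach; polyt_tac. Qed.

Lemma polyt_climb_link : polyt (fun p : seq edge * (seq link * edge) => climb_link p.1 p.2.1 p.2.2).
Proof.
rewrite /climb_link; apply: (polyt_fold_add (d := id)).
- polyt_tac.
- polyt_tac.
- by polyt_tac; apply: (polyt_app3 polyt_reach); polyt_tac.
- exact: pbounded_id.
- by move=> c s a; case: ifP => _ /=; lia.
Qed.

Lemma polyt_climb : polyt (fun p : seq edge * seq link => climb p.1 p.2).
Proof.
have [b hb sz] := polyt_bound polyt_climb_link.
rewrite /climb; apply: (polyt_fold_add (d := fun n => n + b n.+1 + 2)).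
- polyt_tac.
- polyt_tac.
- by polyt_tac; apply: (polyt_app3 polyt_climb_link); polyt_tac.
- apply: pbounded_add; last exact: pbounded_cst.
  apply: pbounded_add; first exact: pbounded_id.
  by apply: (pbounded_comp (b2 := succn)) hb _; exact/pboundedS/pbounded_id.
- move=> [A ls] s a; case: ifP => _; first by lia.
  rewrite esize_cons !esize_pair /=.
  have := sz (A, (ls, a)); rewrite !esize_pair /=.
  have -> : (esize A + (esize ls + esize a).+1).+1 = ((esize A + esize ls).+1 + esize a).+1 by lia.
  lia.
Qed.

End Fixed.

Ltac polyt_user ::= match goal with
  | |- polyt (fun _ => cv _ _) => apply: (polyt_app2 polyt_cv)
  | |- polyt (fun _ => sle _ _) => apply: (polyt_app2 polyt_sle)
  | |- polyt (fun _ => in_mem _ _) => apply: (polyt_app2 (h := fun (x : edge) (s : seq edge) => x \in s) polyt_mem_edge)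
  | |- polyt (fun _ => in_mem _ _) => apply: (polyt_app2 (h := fun (x : link) (s : seq link) => x \in s) polyt_mem_link)
  | |- polyt (fun _ => mass _ _) => apply: (polyt_app2 polyt_mass)
  | |- polyt (fun _ => part _ _ _) => apply: (polyt_app3 polyt_part)
  | |- polyt (fun _ => climb _ _) => apply: (polyt_app2 polyt_climb)
  | |- polyt (fun _ => big ?q _ _ _ _) => apply: (polyt_app4 (polyt_big q))
  | |- polyt (fun _ => cuts ?q _ _) => apply: (polyt_app2 (polyt_cuts q))
  end.

Section Fixed.
Variable q : nat.

Notation state := (seq edge * (seq (link * nat) * seq edge))%type.

Lemma polyt_heavy : polyt (fun p : state => heavy q p.1 p.2.1 p.2.2).
Proof. rewrite /heavy; polyt_tac. Qed.

Lemma polyt_tops : polyt (fun p : state => tops q p.1 p.2.1 p.2.2).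
Proof. rewrite /tops; polyt_tac. Qed.

Lemma polyt_lists j : polyt (fun p : seq link => lists j p).
Proof.
elim: j => [|j IH] /=; first by polyt_tac.
polyt_tac; apply: (polyt_comp IH); polyt_tac.
Qed.

Lemma polyt_fits : polyt (fun p : seq (link * nat) * seq edge => fits q p.1 p.2).
Proof.
rewrite /fits /covered; polyt_tac; apply: (polyt_comp (polyt_lists _)); polyt_tac.
Qed.

Lemma polyt_witnesses : polyt (fun p : state => witnesses q p.1 p.2.1 p.2.2).
Proof. rewrite /witnesses; polyt_tac; apply: (polyt_app3 polyt_tops); polyt_tac. Qed.

Lemma polyt_candidates : polyt (fun p : state => candidates q p.1 p.2.1 p.2.2).
Proof.
rewrite /candidates /matchable /replaces; polyt_tac;
  by apply: (polyt_app3 polyt_witnesses); polyt_tac.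
Qed.

Lemma polyt_matching : polyt (fun p : state => matching q p.1 p.2.1 p.2.2).
Proof.
rewrite /matching; apply: (polyt_fold_add (d := fun n => n + 10)).
- exact: polyt_candidates.
- polyt_tac.
- polyt_tac.
- by apply: pbounded_add; [exact: pbounded_id|exact: pbounded_cst].
- move=> c s [[[e1 [w1 l1]] [e2 [w2 l2]]] l]; case: ifP => _; first by lia.
  by rewrite !esize_pair /= !esize_cons !esize_pair /=; lia.
Qed.

Lemma polyt_base : polyt (fun p : state => base q p.1 p.2.1 p.2.2).
Proof. rewrite /base; polyt_tac; apply: (polyt_app3 polyt_heavy); polyt_tac. Qed.

Lemma polyt_bundle_cover : polyt (fun p : state => bundle_cover q p.1 p.2.1 p.2.2).
Proof.
rewrite /bundle_cover; polyt_tac; first by apply: (polyt_app2 polyt_fits); polyt_tac.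
by apply: (polyt_app3 polyt_tops); polyt_tac.
Qed.

Lemma polyt_matching_cover : polyt (fun p : state => matching_cover q p.1 p.2.1 p.2.2).
Proof.
rewrite /matching_cover; polyt_tac; try by apply: (polyt_app3 polyt_matching); polyt_tac.
by apply: (polyt_app3 polyt_witnesses); polyt_tac.
Qed.

Lemma polyt_rounded : polyt (fun p : state => rounded q p.1 p.2.1 p.2.2).
Proof.
rewrite /rounded; polyt_tac;
  by [apply: (polyt_app3 polyt_bundle_cover); polyt_tac
     |apply: (polyt_app3 polyt_matching_cover); polyt_tac
     |apply: (polyt_app3 polyt_base); polyt_tac].
Qed.

Lemma polyt_solution : polyt (fun p : seq edge * seq (link * nat) => solution q p.1 p.2).
Proof. rewrite /solution; polyt_tac; apply: (polyt_app3 polyt_rounded); polyt_tac. Qed.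

Lemma polyt_violated : polyt (fun p : seq edge * seq (link * nat) => violated q p.1 p.2).
Proof.
rewrite /violated; polyt_tac.
  by apply: (polyt_app2 polyt_fits); polyt_tac.
by apply: (polyt_app3 polyt_tops); polyt_tac.
Qed.

Lemma polyt_step : polyt (fun p : seq edge * (seq (link * nat) * seq link) => step q p.1 p.2).
Proof.
have hv := polyt_violated; have hs := polyt_solution.
rewrite /step /decrease /increase; polyt_tac;
  by [apply: (polyt_app2 polyt_violated); polyt_tac
     |apply: (polyt_app2 polyt_solution); polyt_tac].
Qed.

End Fixed.

Lemma map_fst_step q fam st :
  [seq p.1 | p <- (step q fam st).1] = [seq p.1 | p <- st.1].
Proof.
rewrite /step; case: ifP => _ /=; rewrite /decrease /increase -map_comp //; exact: eq_map.
Qed.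


Lemma step_links q fam wl b i :
  [seq p.1 | p <- (iter i (step q fam) (wl, b)).1] = [seq p.1 | p <- wl].
Proof. by elim: i => //= i IH; rewrite map_fst_step. Qed.

Lemma esize_weighted (wl : seq (link * nat)) i :
  all (fun p => p.2 <= i) wl ->
  esize wl <= esize [seq p.1 | p <- wl] + size wl * i.*2.+2.
Proof.
elim: wl => //= -[l x] wl IH /andP[/= lex /IH h].
by rewrite !esize_cons !esize_pair /= (esize_nat x); lia.
Qed.

(** A weight grows by at most one per round, so unary weights stay polynomial, and the stored
    solution is a sublist of [ls]. *)
Lemma esize_iter_step q fam ls i :
  esize (iter i (step q fam) ([seq (l, 0) | l <- ls], ls))
    <= (esize ls + size ls * i.*2.+2 + esize ls).+1.
Proof.
set s0 := (_, _).
have fst0 : [seq p.1 | p <- s0.1] = ls by rewrite /= -map_comp map_id_in.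
have fsti : [seq p.1 | p <- (iter i (step q fam) s0).1] = ls by rewrite step_links.
have hw : all (fun p => p.2 <= i) (iter i (step q fam) s0).1.
  elim: i {fsti} => [|i /allP IH] /=; first by rewrite all_map; apply/allP.
  rewrite /step; case: ifP => _ /=; rewrite all_map; apply/allP => p /IH /=; first by lia.
  by case: has; lia.
have hb : esize (iter i (step q fam) s0).2 <= esize ls.
  elim: i {fsti hw} => //= i IH; rewrite /step; case: ifP => _ //=.
  by case: ifP => _ //; rewrite /solution step_links fst0; apply: esize_filter.
have := esize_weighted hw; rewrite fsti.
have -> : size (iter i (step q fam) s0).1 = size ls.
  by rewrite -[in RHS]fsti size_map.
by rewrite esize_pair; lia.
Qed.

Notation graph := (nat * seq (nat * nat))%type.

Lemma polyt_expand : polyt (fun p : (graph * (nat * nat)) * seq nat =>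
  expand p.1.1.1 p.1.1.2 p.1.2 p.2).
Proof. rewrite /expand /same_edge; polyt_tac. Qed.

Lemma polyt_below : polyt (fun p : graph * (nat * nat) => below p.1.1 p.1.2 p.2).
Proof.
rewrite /below; polyt_tac; apply: (polyt_iter (b := fun n => n * n.+2 + 5)).
- polyt_tac.
- polyt_tac.
- by apply: (polyt_comp polyt_expand (f := fun p : (graph * (nat * nat) * nat) * seq nat => (p.1.1, p.2))); polyt_tac.
- apply: pbounded_add; last exact: pbounded_cst.
  by apply: pbounded_mul; [exact: pbounded_id|exact/pboundedS/pboundedS/pbounded_id].
- move=> [[[n es] e] v] i _; set N := _ + _ + _.
  have leN : n.*2 <= N by rewrite /N !esize_pair (esize_nat n); lia.
  case: i => [|i]; first by rewrite /N; have -> : esize (iter 0 (expand n es e) [:: 0]) = 3 by []; lia.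
  rewrite iterS /expand; apply: leq_trans (esize_filter _ _) _ => /=.
  have : all (leq^~ n) (iota 0 n) by apply/allP => j; rewrite mem_iota; lia.
  move=> /esize_seq_nat; rewrite size_iota => h; apply: leq_trans h _.
  have : n * n.*2.+2 <= N * N.+2 by apply: leq_mul; lia.
  lia.
Qed.

Lemma polyt_cut_family : polyt (fun p : graph => cut_family p.1 p.2).
Proof.
rewrite /cut_family; apply: polyt_undup; first exact: polyt_eq_edge.
polyt_tac; apply: (polyt_comp polyt_below (f := fun c : graph * nat * (nat * nat) => (c.1.1, c.2))).
polyt_tac.
Qed.

Lemma polyt_tap_alg q : polyt (tap_alg q).
Proof.
have hu : polyt (fun I : nat * (seq (nat * nat) * seq (nat * nat)) => undup I.2.2).
  by apply: polyt_undup; [exact: polyt_eq_link|polyt_tac].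
rewrite /tap_alg /=; apply: polyt_snd.
apply: (polyt_iter (b := fun n => n * n.+2 + (n + n + 1))).
- by rewrite /rounds; polyt_tac.
- polyt_tac.
- apply: (polyt_app2 (polyt_step q)); last by polyt_tac.
  apply: (polyt_comp polyt_cut_family (f := fun p => (p.1.1, p.1.2.1))).
  polyt_tac.
- apply: pbounded_add; last first.
    by do ?[apply: pbounded_add]; try exact: pbounded_cst; exact: pbounded_id.
  by apply: pbounded_mul; [exact: pbounded_id|exact/pboundedS/pboundedS/pbounded_id].
- move=> c i lei; apply: leq_trans (esize_iter_step _ _ _ _) _.
  pose ls : seq link := undup c.2.2; rewrite -/ls.
  set N := (X in _ <= X * _ + _).
  have h1 : (esize [seq (l, 0) | l <- ls] + esize ls).+1 <= N by exact: leq_addl.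
  have h2 : size ls <= N by note (size_esize ls); lia.
  have h3 : i.*2 <= N.
    have : i.*2 <= esize (rounds q (size ls)) by rewrite esize_nat; rewrite -/ls in lei; lia.
    by rewrite /N; lia.
  have : size ls * i.*2.+2 <= N * N.+2 by apply: leq_mul.
  lia.
Qed.

(** * Laminar families *)

Lemma sleP (s t : edge) : reflect {subset s <= t} (sle s t).
Proof. exact: allP. Qed.

Lemma sle_refl s : sle s s. Proof. exact/sleP. Qed.

Lemma sle_trans s t u : sle s t -> sle t u -> sle s u.
Proof. by move=> /sleP st /sleP tu; apply/sleP => x /st /tu. Qed.

(** Edges are lists of vertices, so [lam_size] is what turns inclusion both ways into equality.
    Together with [lam_sorted] it makes the list order compatible with going upwards. *)
Record laminar (fam : seq edge) : Prop := Laminar {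
  lam_uniq : uniq fam;
  lam_sorted : pairwise (fun s t : edge => size s <= size t) fam;
  lam_nonempty : forall s, s \in fam -> exists x, x \in s;
  lam_size : forall s t, s \in fam -> t \in fam -> sle s t -> s != t -> size s < size t;
  lam_cross : forall s t x, s \in fam -> t \in fam -> x \in s -> x \in t ->
    sle s t \/ sle t s }.

Lemma massE wl A : mass wl A = \sum_(p <- wl | has (cv p.1) A) p.2.
Proof. by rewrite /mass sumnE big_map big_filter. Qed.

Section Laminar.
Variables (fam : seq edge) (lam : laminar fam).

Lemma sle_anti (s t : edge) : s \in fam -> t \in fam -> sle s t -> sle t s -> s = t.
Proof.
move=> sF tF st ts; apply/eqP/idPn => nst.
have := lam_size lam sF tF st nst; rewrite eq_sym in nst.
by have := lam_size lam tF sF ts nst; lia.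
Qed.

Lemma sle_comparable s t f : s \in fam -> t \in fam -> f \in fam ->
  sle f s -> sle f t -> sle s t \/ sle t s.
Proof.
move=> sF tF fF /sleP fs /sleP ft; have [x xf] := lam_nonempty lam fF.
by apply: (lam_cross lam sF tF (x := x)); [apply: fs|apply: ft].
Qed.

(** The end inside [s] is inside [t], and the end outside [u] is outside [t]. *)
Lemma cv_convex l s t u : sle s t -> sle t u -> cv l s -> cv l u -> cv l t.
Proof.
move=> /sleP st /sleP tu; rewrite /cv.
have /implyP := st l.1; have /implyP := st l.2.
have /implyP := tu l.1; have /implyP := tu l.2.
by case: (l.1 \in s); case: (l.2 \in s); case: (l.1 \in t); case: (l.2 \in t);
   case: (l.1 \in u); case: (l.2 \in u).
Qed.

Lemma sorted_prefix (A B : seq edge) (f g : edge) : fam = A ++ g :: B -> f \in A ->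
  f != g /\ ~~ sle g f.
Proof.
move=> E fA.
have fF : f \in fam by rewrite E mem_cat fA.
have gF : g \in fam by rewrite E mem_cat mem_head orbT.
have nfg : f != g.
  have := lam_uniq lam; rewrite E cat_uniq /= negb_or => /and3P[_ /andP[gA _] _].
  by apply: contra gA => /eqP <-.
split=> //; apply/negP => gf.
have := lam_sorted lam; rewrite E pairwise_cat => /andP[/allrelP/(_ f g fA) + _].
rewrite mem_head => /(_ isT) /=.
have := lam_size lam gF fF gf; rewrite eq_sym => /(_ nfg); rewrite ltnNge => /negP h /h [].
Qed.

Lemma mem_partP D e g : reflect
  [/\ g \in fam, sle g e & forall d, d \in D -> d != e -> sle g d -> ~~ sle d e]
  (g \in part fam D e).
Proof.
rewrite mem_filter; apply: (iffP idP).
  move=> /andP[/andP[ge /hasPn h] gF]; split=> // d /h + de gd.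
  by rewrite de gd.
move=> [gF ge h]; rewrite gF ge andbT /=; apply/hasPn => d dD.
by apply/negP => /and3P[de gd]; apply/negP; apply: h.
Qed.

Lemma part_cons D e d : d = e \/ ~~ sle d e -> part fam (d :: D) e = part fam D e.
Proof.
move=> h; apply: eq_in_filter => g _; congr (_ && ~~ _) => /=.
by case: h => [-> | /negbTE ->]; rewrite ?eqxx ?andbF.
Qed.

(** The decision at an edge is taken with the cuts found so far, yet it agrees with the test for the
    final set: later cuts are never below an earlier edge and do not change its part. *)
Lemma cuts_prefix q wl A B (D := foldl (fun D e =>
    if cut_edge q fam wl D e then e :: D else D) [::] A) : fam = A ++ B ->
  [/\ uniq D, {subset D <= A} & {in A, forall e, (e \in D) = cut_edge q fam wl D e}].
Proof.
rewrite {}/D; elim/last_ind: A B => [|A g IH] B // E.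
rewrite cat_rcons in E; have [uD sD hD] := IH _ E; rewrite foldl_rcons.
set D := foldl _ _ A in uD sD hD *.
have gD : g \notin D.
  by apply/negP => /sD /(sorted_prefix E)[]; rewrite eqxx.
have partE e : e \in A -> part fam (g :: D) e = part fam D e.
  by move=> /(sorted_prefix E)[_ ge]; apply: part_cons; right.
have partg : part fam (g :: D) g = part fam D g by apply: part_cons; left.
case: ifP => cg; split.
- by rewrite /= gD.
- move=> x; rewrite inE mem_rcons inE => /orP[-> // | /sD ->]; exact: orbT.
- move=> e; rewrite mem_rcons inE => /orP[/eqP -> | eA].
    by rewrite mem_head /cut_edge /big partg -/(big q fam wl D g) -/(cut_edge q fam wl D g) cg.
  have /negbTE neg : e != g by case: (sorted_prefix E eA).
  by rewrite inE neg hD // /cut_edge /big partE.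
- exact: uD.
- by move=> x /sD; rewrite mem_rcons inE orbC => ->.
- move=> e; rewrite mem_rcons inE => /orP[/eqP -> | eA]; last exact: hD.
  by rewrite cg (negbTE gD).
Qed.

Lemma cutsP q wl (D := cuts q fam wl) :
  [/\ uniq D, {subset D <= fam} & {in fam, forall e, (e \in D) = cut_edge q fam wl D e}].
Proof. exact: (@cuts_prefix q wl fam [::] (esym (cats0 _))). Qed.

(** * The division of the tree by a set of cut edges *)

Section Parts.
Variable D : seq edge.
Hypothesis sDF : {subset D <= fam}.

Lemma part_fam e : {subset part fam D e <= fam}.
Proof. by move=> g; rewrite mem_filter => /andP[]. Qed.

Lemma part_self e : e \in fam -> e \in part fam D e.
Proof.
move=> eF; apply/mem_partP; split=> // [|d dD de ed]; first exact: sle_refl.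
by apply: contra de => /(sle_anti (sDF dD) eF)/(_ ed) ->.
Qed.

Lemma part_subset e g : e \in fam -> e \in part fam D g ->
  {subset part fam D e <= part fam D g}.
Proof.
move=> eF /mem_partP[_ eg hg] f /mem_partP[fF fe he]; apply/mem_partP.
split=> // [|d dD dg fd]; first exact: sle_trans eg.
apply/negP => sdg.
have [de|ed] := sle_comparable (sDF dD) eF fF fd fe; last first.
  by have := hg _ dD dg ed; rewrite sdg.
have [Ed|nde] := eqVneq d e; last by have := he _ dD nde fd; rewrite de.
by have := hg _ dD dg; rewrite Ed sle_refl eg => /(_ isT).
Qed.

(** Some cut edge [d] between [f] and [t] keeps [f] out of the part. It is comparable with [f'], and
    lies strictly below it, as it would otherwise keep out [f'] too. *)
Lemma part_separated f t f' : f \in fam -> f' \in part fam D t -> sle f f' ->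
  f \notin part fam D t ->
  exists d, [/\ d \in D, d != f', sle f d & sle d f'].
Proof.
move=> fF /mem_partP[f'F f't h] ff' fnt.
have [d [dD dt fd sdt]] : exists d, [/\ d \in D, d != t, sle f d & sle d t].
  have ft := sle_trans ff' f't.
  move: fnt; rewrite mem_filter fF ft andbT /= negbK => /hasP[d dD /and3P[dt fd sdt]].
  by exists d.
have nf'd : ~~ sle f' d by apply/negP => f'd; have := h _ dD dt f'd; rewrite sdt.
exists d; split=> //; first by apply: contra nf'd => /eqP ->; apply: sle_refl.
by case: (sle_comparable f'F (sDF dD) fF ff' fd) => // /(negP nf'd).
Qed.

Section Tops.
Variables (q : nat) (wl : seq (link * nat)).
Local Notation small e := (~~ big q fam wl D e).

Lemma mem_tops t : t \in tops q fam wl D -> t \in fam /\ small t.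
Proof. by rewrite mem_filter => /andP[/andP[]]. Qed.

Lemma top_exists e : e \in fam -> small e ->
  exists2 t, t \in tops q fam wl D & e \in part fam D t.
Proof.
(* Passing to a larger small edge whose part contains [e] terminates, because [M] bounds all
   sizes. *)
pose M := \max_(s <- fam) size s.
have [n] := ubnP (M - size e); elim: n e => // n IH e leM eF se.
have [et|] := boolP (e \in tops q fam wl D); first by exists e => //; apply: part_self.
rewrite mem_filter eF se andbT /= negbK => /hasP[g gF /and3P[sg ge eg]].
have sle_eg : sle e g by case/mem_partP: eg.
have lteg : size e < size g by apply: (lam_size lam) => //; rewrite eq_sym.
have legM : size g <= M by rewrite /M (big_rem _ gF) leq_maxl.
have [t tt gt] : exists2 t, t \in tops q fam wl D & g \in part fam D t.
  by apply: IH => //; lia.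
by exists t => //; apply: part_subset gt _ eg.
Qed.

(** Two tops above [f] are nested. No cut edge lies between [f] and the upper one, so the lower one
    is in the part of the upper one and is no top. *)
Lemma top_unique t t' f : t \in tops q fam wl D -> t' \in tops q fam wl D ->
  f \in part fam D t -> f \in part fam D t' -> t = t'.
Proof.
wlog tt' : t t' / sle t t'.
  move=> W ht ht' ft ft'; have [tF _] := mem_tops ht; have [t'F _] := mem_tops ht'.
  have /mem_partP[fF fst _] := ft; have /mem_partP[_ fst' _] := ft'.
  have [tt'|t't] := sle_comparable tF t'F fF fst fst'; first exact: W.
  by apply/esym/W.
move=> ht ht' /mem_partP[fF ft hft] /mem_partP[_ ft' hft'].
apply/eqP/idPn => ntt'.
have [tF st] := mem_tops ht; have [t'F st'] := mem_tops ht'.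
move: ht; rewrite mem_filter => /andP[/andP[_ /hasPn/(_ _ t'F) +] _] => /=.
rewrite st' eq_sym ntt' /= => /negP; apply; apply/mem_partP; split=> // d dD dt' td.
exact: hft' (sle_trans ft td).
Qed.

(** [base] takes care of the first two cases, either of the two competing solutions of the third. *)
Lemma fam_cases e : e \in fam ->
  [\/ e \in D, e \in heavy q fam wl D |
      exists2 t, t \in tops q fam wl D & e \in part fam D t].
Proof.
move=> eF; have [be|se] := boolP (big q fam wl D e).
  have [eD|neD] := boolP (e \in D); first by constructor 1.
  by constructor 2; rewrite mem_filter be neD.
by constructor 3; apply: top_exists.
Qed.

End Tops.
End Parts.

Lemma sub_in_count (T : eqType) (a b : pred T) s :
  {in s, subpred a b} -> count a s <= count b s.
Proof.
move=> ab; have /eq_in_count -> : {in s, a =1 predI a b}.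
  by move=> x xs /=; have := ab x xs; case: (a x) => // ->.
by apply: sub_count => x /andP[].
Qed.

Lemma count_lt (T : eqType) (a b : pred T) s x :
  {in s, subpred a b} -> x \in s -> b x -> ~~ a x -> count a s < count b s.
Proof.
elim: s => //= y s IH ab; rewrite inE => /orP[/eqP <- bx ax|xs bx ax].
  rewrite bx (negbTE ax) add0n add1n ltnS.
  by apply: sub_in_count => z zs; apply: ab; rewrite inE zs orbT.
have h : count a s < count b s.
  by apply: IH => // z zs; apply: ab; rewrite inE zs orbT.
have := ab y (mem_head _ _); case: (a y) => [/(_ isT) ->|_]; first by rewrite ltn_add2l.
by rewrite (leq_trans h) // leq_addl.
Qed.

(** Edges with [u] below and [v] not below form a chain by laminarity, and [k] separators on a chain
    leave at most [k + 1] places between them. *)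
Lemma chain_size u v (D A : seq edge) : {subset D <= fam} -> {subset A <= fam} -> uniq A ->
  {in A, forall f, (u \in f) && (v \notin f)} ->
  {in A &, forall f f', f != f' -> sle f f' ->
     exists d, [/\ d \in D, d != f', sle f d & sle d f']} ->
  size A <= (count (fun d : edge => (u \in d) && (v \notin d)) D).+1.
Proof.
move=> sDF sAF uA chA sep.
pose Du := [seq d <- D | (u \in d) && (v \notin d)].
(* The number of separators strictly below [f] increases strictly along [A], so it embeds [A] into
   the numbers up to [size Du]. *)
pose phi f := count (fun d => sle d f && (d != f)) Du.
have sDuF : {subset Du <= fam} by move=> d; rewrite mem_filter => /andP[_ /sDF].
have phi_lt f f' : f \in A -> f' \in A -> f != f' -> sle f f' -> phi f < phi f'.
  move=> fA f'A nff' ff'; have [d [dD df' fd sdf']] := sep _ _ fA f'A nff' ff'.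
  have [fF f'F] := (sAF _ fA, sAF _ f'A).
  apply: (count_lt (x := d)).
  - move=> x xD /andP[xf nxf]; rewrite (sle_trans xf ff') /=.
    apply: contra nff' => /eqP Ex; rewrite -{}Ex in ff' *.
    by apply/eqP/(sle_anti fF) => //; apply: sDuF.
  - rewrite mem_filter dD andbT; apply/andP; split.
      by move/sleP: fd; apply; case/andP: (chA _ fA).
    by case/andP: (chA _ f'A) => _; apply: contra; move/sleP: sdf'; apply.
  - by rewrite sdf' df'.
  - by apply/negP => /andP[/(sle_anti (sDF _ dD) fF)/(_ fd) ->]; rewrite eqxx.
have phi_inj : {in A &, injective phi}.
  move=> f f' fA f'A E; apply/eqP/idPn => nff'.
  have /andP[uf _] := chA _ fA; have /andP[uf' _] := chA _ f'A.
  case: (lam_cross lam (sAF _ fA) (sAF _ f'A) uf uf') => h.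
    by have := phi_lt _ _ fA f'A nff' h; rewrite E ltnn.
  by rewrite eq_sym in nff'; have := phi_lt _ _ f'A fA nff' h; rewrite E ltnn.
rewrite -size_filter -/Du -(size_map phi A) -(size_iota 0 (size Du).+1).
apply: uniq_leq_size; first by rewrite map_inj_in_uniq.
by move=> _ /mapP[f _ ->]; rewrite mem_iota /= add0n ltnS count_size.
Qed.

End Laminar.

(** * Greedy covers *)

Lemma laminar_subseq (fam A : seq edge) : laminar fam -> subseq A fam -> laminar A.
Proof.
move=> [u s n z c] sA; have sub := mem_subseq sA; split.
- exact: subseq_uniq sA u.
- exact: subseq_pairwise sA s.
- by move=> x /sub; apply: n.
- by move=> x y /sub xF /sub; apply: z.
- by move=> x y v /sub xF /sub; apply: c.
Qed.

Lemma foldl_maxP (T : eqType) (m : T -> nat) x s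
    (r := foldl (fun b l => if m b < m l then l else b) x s) :
  r \in x :: s /\ forall y, y \in x :: s -> m y <= m r.
Proof.
rewrite {}/r; elim: s x => [|z s IH] x /=.
  by split=> [|y]; rewrite inE // => /eqP ->.
have [+ h] := IH (if m x < m z then z else x); set r := foldl _ _ _ in h *.
split.
  move: a; rewrite !inE; case: ifP => _ /orP[/eqP ->|->]; rewrite ?eqxx ?orbT //.
move=> y; have := h (if m x < m z then z else x) (mem_head _ _).
rewrite !inE => hr /or3P[/eqP ->|/eqP ->|ys].
- by move: hr; case: ltnP => // h1 h2; lia.
- by move: hr; case: ltnP => // h1 h2; lia.
- by apply: h; rewrite inE ys orbT.
Qed.

Section Climb.
Variables (A : seq edge) (ls : seq link).
Hypotheses (lam : laminar A) (cover : forall g, g \in A -> has (fun l => cv l g) ls).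

Lemma climb_linkP e : e \in A ->
  [/\ climb_link A ls e \in ls, cv (climb_link A ls e) e &
      forall l, l \in ls -> cv l e -> reach A e l <= reach A e (climb_link A ls e)].
Proof.
move=> /cover/hasP[l0 l0s c0]; rewrite /climb_link; set cs := [seq l <- ls | cv l e].
have [] := foldl_maxP (reach A e) (head (0, 0) cs) cs.
set r := foldl _ _ _ => rcs rmax.
have l0cs : l0 \in cs by rewrite mem_filter c0.
have {}rcs : r \in cs.
  move: rcs; rewrite inE => /orP[/eqP ->|//].
  by move: l0cs; case: cs {rmax r} => // a s _; rewrite mem_head.
move: (rcs); rewrite mem_filter => /andP[cr rls]; split=> // l lls cl.
by apply: rmax; rewrite inE mem_filter cl lls orbT.
Qed.

(** By convexity the edges above [e] that a link through [e] covers form an initial segment of the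
    way up, so counting them, as [reach] does, compares heights. *)
Lemma climb_link_highest e g l : e \in A -> g \in A -> sle e g -> l \in ls ->
  cv l e -> cv l g -> cv (climb_link A ls e) g.
Proof.
move=> eA gA eg lls le lg; apply: contraT => ng.
have [_ ce /(_ _ lls le)] := climb_linkP eA; rewrite leqNgt => /negP [].
rewrite /reach !size_filter; apply: (count_lt (x := g)) => //.
- move=> f fA /andP[ef cf]; rewrite ef /=.
  have [fg|gf] := sle_comparable lam fA gA eA ef eg.
    exact: cv_convex ef fg le lg.
  by case/negP: ng; exact: cv_convex eg gf ce cf.
- by rewrite eg.
- by apply/negP => /andP[_ cg]; case/negP: ng.
Qed.

(** For the last property: if a link covered a witness and an edge [g] above it, the link chosen at
    the witness would cover [g] as well, and [g] would not have become a witness. *)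
Lemma climb_prefix A1 A2 (W := foldl (fun W g =>
    if has (fun w => sle w.1 g && cv w.2 g) W then W else (g, climb_link A ls g) :: W) [::] A1) :
  A = A1 ++ A2 ->
  [/\ forall w, w \in W -> w.1 \in A1 /\ w.2 = climb_link A ls w.1,
      uniq [seq w.1 | w <- W],
      forall g, g \in A1 -> exists w, [/\ w \in W, sle w.1 g & cv w.2 g] &
      forall w w' l, w \in W -> w' \in W -> w.1 != w'.1 -> sle w.1 w'.1 ->
        l \in ls -> cv l w.1 -> ~~ cv l w'.1].
Proof.
rewrite {}/W; elim/last_ind: A1 A2 => [|A1 g IH] A2 // E.
rewrite cat_rcons in E; have [h1 h2 h3 h4] := IH _ E; rewrite foldl_rcons.
set W := foldl _ _ A1 in h1 h2 h3 h4 *.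
have gA : g \in A by rewrite E mem_cat mem_head orbT.
case: ifP => hg; split.
- by move=> w /h1[wA ->]; rewrite mem_rcons inE wA orbT.
- exact: h2.
- move=> f; rewrite mem_rcons inE => /orP[/eqP ->|/h3 //].
  by have /hasP[w wW /andP[a b]] := hg; exists w.
- exact: h4.
- move=> w; rewrite inE mem_rcons inE => /orP[/eqP -> /=|/h1[wA ->]].
    by rewrite eqxx.
  by rewrite wA orbT.
- rewrite /= h2 andbT; apply/negP => /mapP[w /h1[wA _] Eg].
  by have [] := sorted_prefix lam E wA; rewrite Eg eqxx.
- move=> f; rewrite mem_rcons inE => /orP[/eqP ->|/h3[w [wW a b]]].
    exists (g, climb_link A ls g); split; rewrite ?mem_head ?sle_refl //=.
    by have [] := climb_linkP gA.
  by exists w; rewrite inE wW orbT.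
- move=> w w' l; rewrite !inE => /orP[/eqP -> /=|wW] /orP[/eqP -> /=|w'W].
  + by rewrite eqxx.
  + move=> _ gw' _ _; have [w'A _] := h1 _ w'W.
    by have [_ /negP] := sorted_prefix lam E w'A.
  + move=> _ wg lls clw; apply/negP => clg.
    have [wA Ew] := h1 _ wW.
    have wAA : w.1 \in A by rewrite E mem_cat wA.
    have := climb_link_highest wAA gA wg lls clw clg.
    by move/negbT/hasPn/(_ _ wW): hg; rewrite wg Ew /= => /negbTE ->.
  + exact: h4.
Qed.

Lemma climbP (W := climb A ls) :
  [/\ forall w, w \in W -> [/\ w.1 \in A, w.2 \in ls & cv w.2 w.1],
      uniq [seq w.1 | w <- W],
      forall g, g \in A -> exists w, [/\ w \in W, sle w.1 g & cv w.2 g] &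
      forall w w' l, w \in W -> w' \in W -> w.1 != w'.1 -> sle w.1 w'.1 ->
        l \in ls -> cv l w.1 -> ~~ cv l w'.1].
Proof.
have [h1 h2 h3 h4] := @climb_prefix A [::] (esym (cats0 _)); split=> //.
by move=> w /h1[wA ->]; split=> //; have [] := climb_linkP wA.
Qed.

End Climb.

(** * Counting what a link covers *)

Definition side (u v : nat) (f : edge) : bool := (u \in f) && (v \notin f).

Lemma cv_side l f : cv l f = side l.1 l.2 f || side l.2 l.1 f.
Proof. by rewrite /cv /side; case: (l.1 \in f); case: (l.2 \in f). Qed.

Lemma count_cv l (s : seq edge) :
  count (cv l) s = count (side l.1 l.2) s + count (side l.2 l.1) s.
Proof.
rewrite -count_predUI [X in _ + X](_ : _ = 0) ?addn0.
  by apply: eq_count => f; rewrite cv_side.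
rewrite (@eq_count _ _ pred0) ?count_pred0 // => f /=; rewrite /side.
by case: (l.1 \in f); case: (l.2 \in f).
Qed.

Section Links.
Variables (fam : seq edge) (lam : laminar fam) (l : link).

(** The tree path of a link consists of two chains, one rising from each end; [chain_size] loses one
    on each of them. *)
Lemma cover_size (D A : seq edge) : {subset D <= fam} -> {subset A <= fam} -> uniq A ->
  {in A, forall f, cv l f} ->
  {in A &, forall f f', f != f' -> sle f f' ->
     exists d, [/\ d \in D, d != f', sle f d & sle d f']} ->
  size A <= (count (cv l) D).+2.
Proof.
move=> sDF sAF uA cA sep.
have one u v : size [seq f <- A | side u v f] <= (count (side u v) D).+1.
  apply: (chain_size lam sDF).
  - by move=> f; rewrite mem_filter => /andP[_ /sAF].
  - exact: filter_uniq.
  - by move=> f; rewrite mem_filter => /andP[].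
  - by move=> f f'; rewrite !mem_filter => /andP[_ fA] /andP[_ f'A]; apply: sep.
have -> : size A = count (cv l) A by rewrite -size_filter; congr size; apply/esym/all_filterP/allP.
rewrite !count_cv; have := one l.1 l.2; have := one l.2 l.1; rewrite !size_filter.
by move: (count _ D) (count _ D) (count _ A) (count _ A) => a b c d; lia.
Qed.

(** Covering [f] but not the higher edge [d] forces both ends of the link below [d], and with them
    its whole path. *)
Lemma cv_below d f w : d \in fam -> w \in fam ->
  ~~ cv l d -> cv l f -> sle f d -> cv l w -> sle w d.
Proof.
move=> dF wF nd cf /sleP fd cw.
have [d1 d2] : l.1 \in d /\ l.2 \in d.
  move: nd cf; rewrite /cv; have /implyP := fd l.1; have /implyP := fd l.2.
  by case: (l.1 \in f); case: (l.2 \in f); case: (l.1 \in d); case: (l.2 \in d).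
have [//|/sleP dw] : sle w d \/ sle d w.
  have [x xw xd] : exists2 x, x \in w & x \in d.
    by move: cw; rewrite cv_side => /orP[]/andP[xw _]; [exists l.1|exists l.2].
  exact: (lam_cross lam wF dF xw xd).
by move: cw; rewrite /cv !dw.
Qed.

(** Incomparable edges have disjoint vertex sets, so one end of the link lies in each, and an edge
    above both has both ends below it. *)
Lemma cv_disjoint f f' : f \in fam -> f' \in fam -> cv l f -> cv l f' ->
  ~~ sle f f' -> ~~ sle f' f -> forall t, sle f t -> sle f' t -> ~~ cv l t.
Proof.
move=> fF f'F cf cf' nff' nf'f t /sleP ft /sleP f't.
have dis x : x \in f -> x \in f' -> False.
  move=> xf xf'; case: (lam_cross lam fF f'F xf xf') => h.
    by rewrite h in nff'.
  by rewrite h in nf'f.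
rewrite !cv_side in cf cf'; rewrite /cv.
case/orP: cf => /andP[a b]; case/orP: cf' => /andP[c d].
- by case: (dis _ a c).
- by rewrite (ft _ a) (f't _ c).
- by rewrite (ft _ a) (f't _ c).
- by case: (dis _ a c).
Qed.

End Links.

(** * Analysis of the rounding of one weight vector *)

Section Round.
Variables (q : nat) (fam : seq edge) (wl : seq (link * nat)).
Hypothesis lam : laminar fam.
Let ls : seq link := [seq p.1 | p <- wl].
Hypothesis cover : forall g, g \in fam -> has (fun l => cv l g) ls.
Let D := cuts q fam wl.
Let T := tops q fam wl D.
Let W := witnesses q fam wl D.
Let wit (a : edge * (edge * link)) : edge := a.2.1.

Lemma cuts_uniq : uniq D. Proof. by case: (cutsP lam q wl). Qed.

Lemma cuts_fam : {subset D <= fam}. Proof. by case: (cutsP lam q wl). Qed.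

Lemma tops_fam : {subset T <= fam}. Proof. by move=> t /mem_tops[]. Qed.

Lemma tops_uniq : uniq T. Proof. exact/filter_uniq/(lam_uniq lam). Qed.

Lemma laminar_filter (a : pred edge) : laminar [seq g <- fam | a g].
Proof. exact/(laminar_subseq lam)/filter_subseq. Qed.

Lemma cover_filter (a : pred edge) g :
  g \in [seq g <- fam | a g] -> has (fun l => cv l g) ls.
Proof. by rewrite mem_filter => /andP[_ /cover]. Qed.

Lemma climb_part t (C := climb (part fam D t) ls) :
  [/\ forall w, w \in C -> [/\ w.1 \in part fam D t, w.2 \in ls & cv w.2 w.1],
      uniq [seq w.1 | w <- C],
      forall g, g \in part fam D t -> exists w, [/\ w \in C, sle w.1 g & cv w.2 g] &
      forall w w' l, w \in C -> w' \in C -> w.1 != w'.1 -> sle w.1 w'.1 ->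
        l \in ls -> cv l w.1 -> ~~ cv l w'.1].
Proof. exact: (climbP (laminar_filter _) (@cover_filter _)). Qed.

Lemma witnessP (a : edge * (edge * link)) :
  reflect (a.1 \in T /\ a.2 \in climb (part fam D a.1) ls) (a \in W).
Proof.
apply: (iffP flatten_mapP).
  by move=> [t tT /mapP[w wC ->]].
by case: a => t w [tT wC]; exists t => //; apply/mapP; exists w.
Qed.

Lemma witness_part a : a \in W -> wit a \in part fam D a.1.
Proof. by move=> /witnessP[_ wC]; have [h _ _ _] := climb_part a.1; case: (h _ wC). Qed.

Lemma witness_fam a : a \in W -> wit a \in fam.
Proof. by move=> /witness_part; rewrite mem_filter => /andP[]. Qed.

Lemma witness_top a : a \in W -> a.1 \in T. Proof. by case/witnessP. Qed.

Lemma same_top a b : a \in W -> b \in W -> wit a = wit b -> a.1 = b.1.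
Proof.
move=> aW bW E; have bP := witness_part bW; rewrite -E in bP.
exact: (top_unique lam (witness_top aW) (witness_top bW) (witness_part aW) bP).
Qed.

Lemma witness_uniq : uniq [seq wit a | a <- W].
Proof.
rewrite /W /witnesses -/T -/ls map_flatten -map_comp.
have : {subset T <= T} by [].
have := tops_uniq; move: {1 2 4}T => T'; elim: T' => //= t T' IH /andP[tT' uT'] sub.
have sub' : {subset T' <= T} by move=> x xT'; apply: sub; rewrite inE xT' orbT.
have {}IH := IH uT' sub'; rewrite cat_uniq IH andbT; apply/andP; split.
  rewrite -map_comp (@eq_map _ _ _ (fun w : edge * link => w.1)) //.
  by have [_ u _ _] := climb_part t.
apply/hasPn => f /flatten_mapP[t' t'T' /mapP[_ /mapP[w wC ->] ->]].
apply/negP => /mapP[_ /mapP[w' w'C ->]] E.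
have aW : (t', w) \in W by apply/witnessP; split=> //; apply: sub'.
have bW : (t, w') \in W by apply/witnessP; split=> //; apply: sub; rewrite mem_head.
by have := same_top aW bW E => /= Et; rewrite -Et t'T' in tT'.
Qed.

Lemma witness_inj : {in W &, injective wit}.
Proof.
move=> a b aW bW E; have := witness_uniq.
move=> /(uniqP [::]) inj.
have wi c : c \in W -> index c W < size W by rewrite index_mem.
have := inj (index a W) (index b W).
rewrite !inE size_map !wi // !(nth_map a) ?wi // !nth_index //.
by move=> /(_ isT isT E) /(congr1 (nth a W)); rewrite !nth_index.
Qed.

Lemma matching_prefix C (M := foldl (fun M t =>
     if (t.1.1.2.1 \in M.1) || (t.1.2.2.1 \in M.1) then M
     else (t.1.1.2.1 :: t.1.2.2.1 :: M.1, t.2 :: M.2)) ([::], [::]) C) :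
  {subset C <= candidates q fam wl D} ->
  [/\ size M.1 = (size M.2).*2, uniq M.1,
      {subset M.2 <= ls},
      forall e, e \in M.1 -> exists a l,
        [/\ a \in W, wit a = e, l \in M.2 & replaces fam D l a] &
      forall t, t \in C -> (wit t.1.1 \in M.1) || (wit t.1.2 \in M.1)].
Proof.
rewrite {}/M; elim/last_ind: C => [|C t IH] sC //.
have [|h1 h2 h3 h4 h5] := IH; first by move=> x xC; apply: sC; rewrite mem_rcons inE xC orbT.
rewrite foldl_rcons; set M := foldl _ _ C in h1 h2 h3 h4 h5 *.
have := sC t; rewrite mem_rcons mem_head => /(_ isT).
rewrite mem_filter => /andP[/andP[ntop /andP[ra rb]]].
move=> /flatten_mapP[a aW /flatten_mapP[b bW /mapP[l lls Et]]].
rewrite {}Et /= in ntop ra rb *.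
case: ifP => [used|/negbT]; first split=> //.
  by move=> t'; rewrite mem_rcons inE => /orP[/eqP ->|/h5].
rewrite negb_or => /andP[aM bM]; split=> /=.
- by rewrite h1.
- rewrite inE negb_or aM bM h2 !andbT.
  by apply: contra ntop => /eqP E; apply/eqP/same_top.
- by move=> x; rewrite inE => /orP[/eqP ->|/h3].
- move=> e; rewrite !inE => /or3P[/eqP ->|/eqP ->|/h4[c [l' [cW cE l'M r]]]].
  + by exists a, l; rewrite mem_head.
  + by exists b, l; rewrite mem_head.
  + by exists c, l'; rewrite inE l'M orbT.
- move=> t'; rewrite mem_rcons inE => /orP[/eqP -> /=|/h5].
    by rewrite mem_head.
  by rewrite !inE => /orP[->|->]; rewrite !orbT.
Qed.

Let M := matching q fam wl D.

Lemma matchingP :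
  [/\ size M.1 = (size M.2).*2, uniq M.1,
      {subset M.2 <= ls},
      forall e, e \in M.1 -> exists a l,
        [/\ a \in W, wit a = e, l \in M.2 & replaces fam D l a] &
      forall t, t \in candidates q fam wl D -> (wit t.1.1 \in M.1) || (wit t.1.2 \in M.1)].
Proof. exact: matching_prefix. Qed.

Let unmatched a := wit a \notin M.1.

(** A link of the matching stands for two witnesses. Doubling counts every witness once, and the
    unmatched ones once more. *)
Lemma size_matching_cover :
  (size (matching_cover q fam wl D)).*2 = size W + count unmatched W.
Proof.
have [h1 h2 _ h4 _] := matchingP.
rewrite /matching_cover -/M -/W size_cat size_map size_filter -/unmatched doubleD -h1.
have -> : size M.1 = count (fun a => wit a \in M.1) W.
  rewrite -size_filter -(size_map wit); apply/perm_size/uniq_perm => //.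
    exact: subseq_uniq (map_subseq wit (filter_subseq _ W)) witness_uniq.
  move=> e; apply/idP/mapP => [eM|[a + ->]]; last by rewrite mem_filter => /andP[].
  have [a [l [aW E _ _]]] := h4 e eM; exists a; last by rewrite E.
  by rewrite mem_filter E eM.
have := count_predC (fun a => wit a \in M.1) W.
rewrite (@eq_count _ (predC _) unmatched) //.
by move: (count _ W) (count unmatched W) (size W) => x y z; lia.
Qed.

Section OneLink.
Variable l : link.
Hypothesis lls : l \in ls.

Let touched t := has (cv l) (part fam D t).

Lemma touched_rep t (r := head [::] [seq f <- part fam D t | cv l f]) :
  touched t -> r \in part fam D t /\ cv l r.
Proof.
rewrite /touched {}/r => /hasP[f fP cf].
have : f \in [seq f <- part fam D t | cv l f] by rewrite mem_filter cf.
case E: [seq f <- part fam D t | cv l f] => [//|r s] _ /=.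
have : r \in [seq f <- part fam D t | cv l f] by rewrite E mem_head.
by rewrite mem_filter => /andP[].
Qed.

(** From each touched part one covered edge is picked. Two nested picks belong to different parts,
    so a cut edge separates them. *)
Lemma count_touched : count touched T <= (count (cv l) D).+2.
Proof.
pose rep t := head [::] [seq f <- part fam D t | cv l f].
rewrite -size_filter -(size_map rep).
have mem t : t \in [seq t <- T | touched t] ->
    [/\ t \in T, rep t \in part fam D t & cv l (rep t)].
  by rewrite mem_filter => /andP[/touched_rep[]].
apply: (cover_size lam cuts_fam).
- by move=> _ /mapP[t /mem[_ + _] ->]; apply: part_fam.
- rewrite map_inj_in_uniq; first exact/filter_uniq/tops_uniq.
  move=> t t' /mem[tT rt _] /mem[t'T rt' _] E.
  by apply: (top_unique lam tT t'T rt); rewrite E.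
- by move=> _ /mapP[t /mem[_ _ +] ->].
- move=> _ _ /mapP[t /mem[tT rt ct] ->] /mapP[t' /mem[t'T rt' ct'] ->] nE le.
  apply: (part_separated lam cuts_fam _ rt' le); first exact: part_fam rt.
  by apply/negP => rt2; have E := top_unique lam tT t'T rt rt2; rewrite E eqxx in nE.
Qed.

(** Nested witnesses on the path of [l] cannot share a part, by the greedy choice in [climb], so cut
    edges separate them. *)
Lemma count_witness : count (fun a => cv l (wit a)) W <= (count (cv l) D).+2.
Proof.
rewrite -size_filter -(size_map wit).
have mem a : a \in [seq a <- W | cv l (wit a)] -> a \in W /\ cv l (wit a).
  by rewrite mem_filter => /andP[].
apply: (cover_size lam cuts_fam).
- by move=> _ /mapP[a /mem[aW _] ->]; apply: witness_fam.
- exact: subseq_uniq (map_subseq wit (filter_subseq _ W)) witness_uniq.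
- by move=> _ /mapP[a /mem[_ ca] ->].
- move=> _ _ /mapP[a /mem[aW ca] ->] /mapP[b /mem[bW cb] ->] nE le.
  apply: (part_separated lam cuts_fam _ (witness_part bW) le); first exact: witness_fam.
  apply/negP => ab.
  have Et := top_unique lam (witness_top aW) (witness_top bW) (witness_part aW) ab.
  have [_ aC] := witnessP _ aW; have [_ bC] := witnessP _ bW.
  have [_ _ _ h] := climb_part b.1; rewrite Et in aC.
  by have := h _ _ _ aC bC nE le lls ca; rewrite cb.
Qed.

(* Were the two witnesses in different parts, [l] would have been used to match
   them. *)
Lemma unmatched_pair a b : count (cv l) D = 0 -> a \in W -> b \in W -> a != b ->
  unmatched a -> unmatched b -> cv l (wit a) -> cv l (wit b) ->
  forall t, t \in T -> touched t -> t = a.1.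
Proof.
move=> D0 aW bW nab ua ub ca cb.
have nD d : d \in D -> ~~ cv l d.
  by move=> dD; move: D0 => /eqP; rewrite -leqn0 leqNgt -has_count => /hasPn/(_ _ dD).
(* A cut edge [d] separates [f] from [t]. Since [l] covers no cut edge, its path stays below [d] and
   misses the part of [t]. *)
have sep f t w : f \in fam -> cv l f -> sle f t -> f \notin part fam D t ->
    w \in part fam D t -> cv l w -> False.
  move=> fF cf ft fnt wt cw.
  move: fnt; rewrite mem_filter fF ft andbT /= negbK => /hasP[d dD /and3P[dt fd sdt]].
  have /mem_partP[wF _ h] := wt.
  have wd := cv_below lam (cuts_fam dD) wF (nD _ dD) cf fd cw.
  by have := h _ dD dt wd; rewrite sdt.
have [Et|nt] := eqVneq a.1 b.1; last first.
  have rep c d : c \in W -> d \in W -> c.1 != d.1 -> cv l (wit c) -> cv l (wit d) ->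
      replaces fam D l c.
    move=> cW dW ncd cc cd; apply/allP => g gP; rewrite -implybE; apply/implyP => cg.
    apply: contraT => ng; have /mem_partP[gF gt _] := gP.
    have wg := cv_below lam gF (witness_fam dW) ng cc cg cd.
    case: (@sep (wit d) c.1 (wit c)) => //; first exact: witness_fam.
    - exact: sle_trans wg gt.
    - apply: contra ncd => dc; apply/eqP.
      exact: (top_unique lam (witness_top cW) (witness_top dW) dc (witness_part dW)).
    - exact: witness_part.
  have [_ _ _ _ h] := matchingP.
  have /h /= : (a, b, l) \in candidates q fam wl D.
    rewrite mem_filter /matchable /= nt (rep a b) // (rep b a) 1?eq_sym //=.
    apply/flatten_mapP; exists a => //; apply/flatten_mapP; exists b => //.
    by apply/mapP; exists l.
  by rewrite (negbTE ua) (negbTE ub).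
move=> t tT /hasP[f fP cf]; apply/eqP; apply: contraT => nta.
have [aP bP] := (witness_part aW, witness_part bW).
have /mem_partP[aF at_ _] := aP; have /mem_partP[bF bt_ _] := bP; rewrite -Et in bt_.
have nE : wit a != wit b by apply: contra nab => /eqP /(witness_inj aW bW) ->.
have [_ aC] := witnessP _ aW; have [_ bC] := witnessP _ bW; rewrite -Et in bC.
have [_ _ _ W4] := climb_part a.1.
(* In a common part the two witnesses are incomparable, so the path of [l] turns below the top
   [a.1]. It stays below that top, and without a cut edge on it stays in that part. *)
have nab' : ~~ sle (wit a) (wit b).
  by apply/negP => le; have := W4 _ _ _ aC bC nE le lls ca; rewrite cb.
have nba' : ~~ sle (wit b) (wit a).
  rewrite eq_sym in nE.
  by apply/negP => le; have := W4 _ _ _ bC aC nE le lls cb; rewrite ca.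
have na := cv_disjoint lam aF bF ca cb nab' nba' at_ bt_.
have fF := part_fam fP.
have fa := cv_below lam (tops_fam (witness_top aW)) fF na ca at_ cf.
case: (@sep f a.1 (wit a)) => //.
apply: contra nta => fa'; apply/eqP.
exact: (top_unique lam tT (witness_top aW) fP fa').
Qed.

(** Over no cut edge the three counts are at most 2, 2, 1, or 1, 2, 2 if two unmatched witnesses are
    covered. Over [k > 0] cut edges each is at most [k + 2], and [3 * (k + 2) <= 5 + 4 * k]. *)
Lemma link_count :
  count touched T + count (fun a => cv l (wit a)) W +
  count (fun a => unmatched a && cv l (wit a)) W <= 5 + 4 * count (cv l) D.
Proof.
have b := count_touched; have w := count_witness.
have w' : count (fun a => unmatched a && cv l (wit a)) W <= count (fun a => cv l (wit a)) W.
  by apply: sub_count => a /andP[].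
have [D0|Dp] := posnP (count (cv l) D); last first.
  move: b w w' Dp; move: (count _ W) (count _ W) (count _ T) (count _ D) => x y z d; lia.
rewrite D0 in b w *.
have [le1|] := leqP (count (fun a => unmatched a && cv l (wit a)) W) 1.
  move: b w w' le1; move: (count _ W) (count _ W) (count _ T) => x y z; lia.
move=> lt1; suff b1 : count touched T <= 1.
  move: w w' b1; move: (count _ W) (count _ W) (count _ T) => x y z; lia.
move: lt1; rewrite -size_filter.
have uW : uniq W by apply: (@map_uniq _ _ wit); apply: witness_uniq.
have := filter_uniq (fun a => unmatched a && cv l (wit a)) uW.
have mem a : a \in [seq a <- W | unmatched a && cv l (wit a)] ->
   [/\ unmatched a, cv l (wit a) & a \in W].
  by rewrite mem_filter => /andP[/andP[? ?] ?].
case: [seq a <- W | _] mem => [|a [|b0 s]] // mem.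
rewrite /= inE negb_or => /andP[/andP[nab _] _] _.
have [ua ca aW] := mem a (mem_head _ _).
have [|ub cb bW] := mem b0; first by rewrite !inE eqxx orbT.
have h := unmatched_pair D0 aW bW nab ua ub ca cb.
rewrite -size_filter.
have := filter_uniq touched tops_uniq.
have mem2 t : t \in [seq t <- T | touched t] -> t = a.1.
  by rewrite mem_filter => /andP[tt tT]; apply: h.
case: [seq t <- T | touched t] mem2 => [|t [|t' s']] // mem2.
rewrite /= inE negb_or => /andP[/andP[/eqP[]]].
by rewrite (mem2 t (mem_head _ _)) (mem2 t') // !inE eqxx orbT.
Qed.

(** If [l] touches the part at [d] without covering [d], its path lies below [d]. Two such cut edges
    would be nested, and the lower one would separate the upper one from everything that [l]
    covers. *)
Lemma count_cut_parts :
  count (fun d => has (cv l) (part fam D d)) D <= (count (cv l) D).+1.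
Proof.
pose a d := has (cv l) (part fam D d).
have -> : count (fun d => has (cv l) (part fam D d)) D =
    count (predI (cv l) a) D + count (predI (predC (cv l)) a) D.
  by rewrite -!count_filter -/a count_predC size_filter.
have h1 : count (predI (cv l) a) D <= count (cv l) D by apply: sub_count => d /andP[].
suff h2 : count (predI (predC (cv l)) a) D <= 1.
  by move: h1 h2; move: (count _ D) (count _ D) (count _ D) => x y z; lia.
rewrite -size_filter.
have := filter_uniq (predI (predC (cv l)) a) cuts_uniq.
have mem d : d \in [seq d <- D | predI (predC (cv l)) a d] ->
    [/\ d \in D, ~~ cv l d & exists2 f, f \in part fam D d & cv l f].
  by rewrite mem_filter => /andP[/andP[nd /hasP[f fP cf]] dD]; split=> //; exists f.
case: [seq d <- D | _] mem => [|d1 [|d2 s']] // mem.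
rewrite /= inE negb_or => /andP[/andP[nd _] _].
have [d1D n1 [f1 f1P c1]] := mem d1 (mem_head _ _).
have [|d2D n2 [f2 f2P c2]] := mem d2; first by rewrite !inE eqxx orbT.
have /mem_partP[f1F f1d1 h1'] := f1P; have /mem_partP[f2F f2d2 h2'] := f2P.
have f2d1 := cv_below lam (cuts_fam d1D) f2F n1 c1 f1d1 c2.
have f1d2 := cv_below lam (cuts_fam d2D) f1F n2 c2 f2d2 c1.
have [le|le] := sle_comparable lam (cuts_fam d1D) (cuts_fam d2D) f1F f1d1 f1d2.
  by have := h2' _ d1D nd f2d1; rewrite le.
by have := h1' _ d2D; rewrite eq_sym le => /(_ nd f1d2).
Qed.

End OneLink.

Let m := size wl.
Let total := \sum_(p <- wl) p.2.

Lemma sum_mass (S : Type) (B : S -> seq edge) s :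
  \sum_(a <- s) mass wl (B a) =
  \sum_(p <- wl) p.2 * count (fun a => has (cv p.1) (B a)) s.
Proof.
under eq_bigr do rewrite massE big_mkcond.
rewrite exchange_big; apply: eq_bigr => p _ /=.
by rewrite -sum1_count big_distrr /= [RHS]big_mkcond; apply: eq_bigr => a _; case: has; rewrite ?muln1.
Qed.

Lemma sum_mass1 (S : Type) (f : S -> edge) s :
  \sum_(a <- s) mass wl [:: f a] = \sum_(p <- wl) p.2 * count (fun a => cv p.1 (f a)) s.
Proof.
rewrite (sum_mass (fun a => [:: f a])); apply: eq_bigr => p _; congr (_ * _).
by apply: eq_count => a /=; rewrite orbF.
Qed.

(** Every cut edge heads a part of large mass. By [count_cut_parts] these masses count a link once,
    plus once per cut edge that it covers, and cut edges have small mass. *)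
Lemma size_cuts : size D * (q ^ 3 * m) <= total + size D * (q ^ 2 * m).
Proof.
have h1 : size D * (q ^ 3 * m) <= \sum_(d <- D) mass wl (part fam D d).
  rewrite -sum1_size big_distrl /= big_seq [leqRHS]big_seq; apply: leq_sum => d dD.
  have [_ _ h] := cutsP lam q wl; rewrite mul1n.
  by have := h d (cuts_fam dD); rewrite dD => /esym/andP[/ltnW].
apply: leq_trans h1 _.
have h2 : \sum_(d <- D) mass wl [:: d] <= size D * (q ^ 2 * m).
  rewrite -sum1_size big_distrl /= big_seq [leqRHS]big_seq; apply: leq_sum => d dD.
  have [_ _ h] := cutsP lam q wl; rewrite mul1n.
  by have := h d (cuts_fam dD); rewrite dD => /esym/andP[].
apply: leq_trans (leq_add (leqnn _) h2); rewrite sum_mass (sum_mass1 id) -big_split /=.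
rewrite big_seq [leqRHS]big_seq; apply: leq_sum => p pw.
rewrite -[X in _ <= X + _]muln1 -mulnDr leq_mul2l; apply/orP; right.
by rewrite add1n; apply: count_cut_parts; apply: map_f.
Qed.

Let Wh := climb (heavy q fam wl D) ls.

Lemma heavyP : 
  [/\ forall w, w \in Wh -> [/\ w.1 \in heavy q fam wl D, w.2 \in ls & cv w.2 w.1],
      uniq [seq w.1 | w <- Wh],
      forall g, g \in heavy q fam wl D -> exists w, [/\ w \in Wh, sle w.1 g & cv w.2 g] &
      forall w w' l, w \in Wh -> w' \in Wh -> w.1 != w'.1 -> sle w.1 w'.1 ->
        l \in ls -> cv l w.1 -> ~~ cv l w'.1].
Proof. exact: (climbP (laminar_filter _) (@cover_filter _)). Qed.

(** A heavy edge heads a big part and was not cut, so its own coverage exceeds [q]; no link covers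
    more than two of the witnesses. *)
Lemma size_heavy : size Wh * (q ^ 2 * m) <= 2 * total.
Proof.
have [h1 h2 _ h4] := heavyP.
have sub w : w \in Wh -> w.1 \in fam by move=> /h1[+ _ _]; rewrite mem_filter => /andP[].
apply: (@leq_trans (\sum_(w <- Wh) mass wl [:: w.1])).
  rewrite -sum1_size big_distrl /= big_seq [leqRHS]big_seq; apply: leq_sum => w wW.
  have [+ _ _] := h1 _ wW; rewrite mem_filter mul1n => /andP[/andP[bw nD] wF].
  have [_ _ h] := cutsP lam q wl; have := h _ wF.
  by rewrite (negbTE nD) /cut_edge bw /= => /esym/negbT; rewrite -ltnNge => /ltnW.
rewrite sum_mass1 /total big_distrr /= big_seq [leqRHS]big_seq; apply: leq_sum => p pw.
rewrite mulnC leq_mul2r; apply/orP; right.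
have pl : p.1 \in ls by apply: map_f.
rewrite -size_filter -(size_map fst).
have mem w : w \in [seq w <- Wh | cv p.1 w.1] -> w \in Wh /\ cv p.1 w.1.
  by rewrite mem_filter => /andP[].
apply: (@cover_size _ lam p.1 [::]) => //.
- by move=> _ /mapP[w /mem[wW _] ->]; apply: sub.
- exact: subseq_uniq (map_subseq fst (filter_subseq _ Wh)) h2.
- by move=> _ /mapP[w /mem[_ c] ->].
- move=> _ _ /mapP[w /mem[wW c] ->] /mapP[w' /mem[w'W c'] ->] nE le.
  by have := h4 _ _ _ wW w'W nE le pl c; rewrite c'.
Qed.

Hypothesis ok : violated q fam wl = [::].

Lemma ok_fit B : B \in [seq [:: e] | e <- fam] ++ [seq part fam D e | e <- T] ->
  head [::] (fits q wl B) \in fits q wl B.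
Proof.
move=> BB; have /negP : B \notin violated q fam wl by rewrite ok.
rewrite mem_filter BB andbT; case: (fits q wl B) => //= F s _; exact: mem_head.
Qed.

Lemma mem_lists j (s : seq link) F :
  (F \in lists j s) = (size F <= j) && all (fun l => l \in s) F.
Proof.
elim: j F => [|j IH] [|l F] //=.
rewrite inE /=; apply/flatten_mapP/idP => [[l' l's /mapP[F' + [-> ->]]]|].
  by rewrite IH l's.
rewrite ltnS => /and3P[szF ls' aF]; exists l => //; apply/mapP; exists F => //.
by rewrite IH szF.
Qed.

(** Since [F] is nonempty, the slack [m] is at most [size F * m], and moving it to the left turns
    [q] into [q - 1]. *)
Lemma fits_mass B F e : F \in fits q wl B -> e \in B ->
  [/\ covered F B, {subset F <= ls} & size F * ((q - 1) * m) <= mass wl B].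
Proof.
rewrite mem_filter mem_lists => /andP[/andP[cF szF] /andP[_ /allP sF]] eB; split=> //.
have F0 : 0 < size F.
  by move/allP: cF => /(_ _ eB) /hasP[l lF _]; case: F lF {szF sF}.
have : size F * (q * m) <= mass wl B + m by [].
rewrite !mulnA mulnBr muln1 mulnBl; move: (size F * q * m) => x.
have : m <= size F * m by rewrite -{1}[m]mul1n leq_mul2r F0 orbT.
by move: (mass wl B) (size F * m) => y z; lia.
Qed.

Lemma edge_mass e : e \in fam -> (q - 1) * m <= mass wl [:: e].
Proof.
move=> eF; have /ok_fit : [:: e] \in [seq [:: e] | e <- fam] ++ [seq part fam D e | e <- T].
  by rewrite mem_cat map_f.
move=> /fits_mass/(_ (mem_head _ _)) [cF _]; apply: leq_trans.
rewrite -{1}[_ * m]mul1n leq_mul2r; apply/orP; right.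
by move: cF; rewrite /covered /=; case: head.
Qed.

Lemma top_mass t (F := head [::] (fits q wl (part fam D t))) : t \in T ->
  [/\ covered F (part fam D t), {subset F <= ls} &
      size F * ((q - 1) * m) <= mass wl (part fam D t)].
Proof.
move=> tT; apply: (@fits_mass _ _ t); last exact/(part_self lam cuts_fam)/tops_fam.
by apply: ok_fit; rewrite mem_cat map_f ?orbT.
Qed.

Let Z := size (bundle_cover q fam wl D) + size W + count unmatched W.

(** Each part, witness and unmatched witness pays through the mass on it. Exchanging the sums leaves
    [link_count] for each link, whose second term adds up to the mass on the cut edges. *)
Lemma size_bundle_matching :
  Z * ((q - 1) * m) <= 5 * total + 4 * (size D * (q ^ 2 * m)).
Proof.
have h2 : \sum_(d <- D) mass wl [:: d] <= size D * (q ^ 2 * m).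
  rewrite -sum1_size big_distrl /= big_seq [leqRHS]big_seq; apply: leq_sum => d dD.
  have [_ _ h] := cutsP lam q wl; rewrite mul1n.
  by have := h d (cuts_fam dD); rewrite dD => /esym/andP[].
have e1 : size (bundle_cover q fam wl D) * ((q - 1) * m)
    <= \sum_(t <- T) mass wl (part fam D t).
  rewrite /bundle_cover size_flatten sumnE /shape -map_comp big_map big_distrl /=.
  rewrite big_seq [leqRHS]big_seq; apply: leq_sum => t tT.
  by have [] := top_mass tT.
have e2 : size W * ((q - 1) * m) <= \sum_(a <- W) mass wl [:: wit a].
  rewrite -sum1_size big_distrl /= big_seq [leqRHS]big_seq; apply: leq_sum => a aW.
  by rewrite mul1n edge_mass ?witness_fam.
have e3 : count unmatched W * ((q - 1) * m)
    <= \sum_(a <- [seq a <- W | unmatched a]) mass wl [:: wit a].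
  rewrite -size_filter -sum1_size big_distrl /= big_seq [leqRHS]big_seq.
  apply: leq_sum => a; rewrite mem_filter => /andP[_ aW].
  by rewrite mul1n edge_mass ?witness_fam.
rewrite /Z !mulnDl.
apply: leq_trans (leq_add (leq_add e1 e2) e3) _.
apply: leq_trans (leq_add (leqnn _) (leq_mul (leqnn 4) h2)).
rewrite sum_mass !sum_mass1 /total !big_distrr /= -!big_split /=.
rewrite big_seq [leqRHS]big_seq; apply: leq_sum => p pw.
have pl : p.1 \in ls by apply: map_f.
rewrite -!mulnDr [5 * _]mulnC [4 * _]mulnCA -mulnDr leq_mul2l; apply/orP; right.
have := link_count pl.
rewrite -count_filter; move: (count _ D) (count _ W) (count _ T) => x y z.
rewrite (_ : count _ _ = count (fun a => cv p.1 (wit a)) [seq a <- W | unmatched a]) //.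
by rewrite !count_filter; apply: eq_count => a /=; rewrite andbC.
Qed.


Let Wd := climb [seq e <- fam | e \in D] ls.

Lemma climb_cutsP : [/\ size Wd <= size D, forall w, w \in Wd -> w.2 \in ls &
  forall g, g \in D -> exists2 w, w \in Wd & cv w.2 g].
Proof.
have [h1 h2 h3 _] := climbP (laminar_filter (mem D)) (@cover_filter (mem D)).
split=> [|w /h1[]//|g gD].
  rewrite -(size_map fst); apply: uniq_leq_size => // _ /mapP[w /h1[+ _ _] ->].
  by rewrite mem_filter => /andP[].
have [|w [wW _ c]] := h3 g; last by exists w.
by rewrite mem_filter cuts_fam //; apply/andP.
Qed.

Lemma bundle_cover_sub : {subset bundle_cover q fam wl D <= ls}.
Proof. by move=> l /flatten_mapP[t tT]; have [_ h _] := top_mass tT; apply: h. Qed.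

Lemma bundle_cover_covers t g : t \in T -> g \in part fam D t ->
  has (fun l => cv l g) (bundle_cover q fam wl D).
Proof.
move=> tT gP; have [/allP/(_ _ gP)/hasP[l lF c] _ _] := top_mass tT.
by apply/hasP; exists l => //; apply/flatten_mapP; exists t.
Qed.

Lemma matching_cover_sub : {subset matching_cover q fam wl D <= ls}.
Proof.
have [_ _ h _ _] := matchingP.
move=> l; rewrite mem_cat => /orP[/h //|/mapP[a + ->]].
rewrite mem_filter => /andP[_ /witnessP[_ aC]].
by have [h1 _ _ _] := climb_part a.1; case: (h1 _ aC).
Qed.

Lemma matching_cover_covers t g : t \in T -> g \in part fam D t ->
  has (fun l => cv l g) (matching_cover q fam wl D).
Proof.
move=> tT gP; have [_ _ h _] := climb_part t; have [w [wC wg c]] := h _ gP.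
have aW : (t, w) \in W by apply/witnessP.
have [wM|nM] := boolP (w.1 \in M.1).
  have [_ _ _ hM _] := matchingP; have [a [l [a'W E lM /allP r]]] := hM _ wM.
  apply/hasP; exists l; first by rewrite mem_cat lM.
  have Ea : a = (t, w) by apply: witness_inj.
  by have := r g; rewrite Ea /= gP wg => /(_ isT).
apply/hasP; exists w.2 => //; rewrite mem_cat; apply/orP; right.
by apply/mapP; exists (t, w) => //; rewrite mem_filter nM.
Qed.

Lemma base_sub : {subset base q fam wl D <= ls}.
Proof.
have [_ h _] := climb_cutsP; have [h' _ _ _] := heavyP.
move=> l /mapP[w + ->]; rewrite mem_cat => /orP[/h //|/h'[]//].
Qed.

Lemma solution_covers g : g \in fam -> has (fun l => cv l g) (solution q fam wl).
Proof.
move=> gF; suff /hasP[l lr c] : has (fun l => cv l g) (rounded q fam wl D).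
  apply/hasP; exists l => //; rewrite mem_filter lr /=.
  move: lr; rewrite /rounded; case: ifP => _; rewrite mem_cat => /orP[|/base_sub //].
    exact: bundle_cover_sub.
  exact: matching_cover_sub.
have base_r l : l \in base q fam wl D -> l \in rounded q fam wl D.
  by move=> h; rewrite /rounded; case: ifP => _; rewrite mem_cat h orbT.
have [gD|gH|[t tT gP]] := fam_cases lam cuts_fam q wl gF.
- have [_ _ h] := climb_cutsP; have [w wW c] := h _ gD.
  by apply/hasP; exists w.2 => //; apply: base_r; rewrite map_f // mem_cat wW.
- have [_ _ h _] := heavyP; have [w [wW _ c]] := h _ gH.
  by apply/hasP; exists w.2 => //; apply: base_r; rewrite map_f // mem_cat wW orbT.
- rewrite /rounded; case: ifP => _; rewrite has_cat.
    by rewrite (bundle_cover_covers tT gP).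
  by rewrite (matching_cover_covers tT gP).
Qed.

(** Three times the smaller of two sizes is at most the first plus twice the second. *)
Lemma size_solution : uniq ls ->
  3 * size (solution q fam wl) <= Z + 3 * size D + 3 * size Wh.
Proof.
move=> uls.
have h1 : size (solution q fam wl) <= size (rounded q fam wl D).
  apply: uniq_leq_size; first exact: filter_uniq.
  by move=> l; rewrite mem_filter => /andP[].
have [hD _ _] := climb_cutsP; have hm := size_matching_cover.
have hb : size (base q fam wl D) = size Wd + size Wh by rewrite size_map size_cat.
have h2 : 3 * size (rounded q fam wl D) <= size (bundle_cover q fam wl D) +
    (size (matching_cover q fam wl D)).*2 + 3 * size (base q fam wl D).
  by rewrite /rounded; case: ifP => [|/negbT]; rewrite -?ltnNge size_cat;
     move: (size _) (size _) (size _) => x y z; lia.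
rewrite hm hb in h2; rewrite /Z.
move: h1 h2 hD; move: (size _) (size _) (size _) (size _) (size _) (size D) => a b c d e f.
by move: (count _ _) => x; lia.
Qed.

(** With denominators cleared. The four terms are due to the parts and witnesses, to links over cut
    edges, to the cut edges and to the heavy edges. *)
Lemma solution_ratio : 1 < q -> uniq ls ->
  3 * size (solution q fam wl) * m * ((q - 1) ^ 2 * q ^ 2) <=
  total * (5 * (q - 1) * q ^ 2 + 4 * q ^ 2 + 3 * (q - 1) + 6 * (q - 1) ^ 2).
Proof.
move=> q1 uls; have hS := size_solution uls; have hZ := size_bundle_matching.
have hD := size_cuts; have hH := size_heavy.
case: q q1 hS hZ hD hH => // -[//|p] _; rewrite subSS subn0.
move: (size (solution _ _ _)) => S.
rewrite -/D; move: Z (size D) (size Wh) total m => z d h t k hS hZ hD hH.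
have {}hD : d * (p.+2 ^ 2 * p.+1 * k) <= t.
  have : d * (p.+2 ^ 3 * k) = d * (p.+2 ^ 2 * k) + d * (p.+2 ^ 2 * p.+1 * k) by ring.
  by move=> E; rewrite E [X in _ <= X]addnC leq_add2l in hD.
apply: (@leq_trans ((z + 3 * d + 3 * h) * k * (p.+1 ^ 2 * p.+2 ^ 2))).
  by rewrite leq_mul2r leq_mul2r hS !orbT.
have -> : (z + 3 * d + 3 * h) * k * (p.+1 ^ 2 * p.+2 ^ 2) =
  z * (p.+1 * k) * (p.+1 * p.+2 ^ 2) + 3 * p.+1 * (d * (p.+2 ^ 2 * p.+1 * k)) +
  3 * p.+1 ^ 2 * (h * (p.+2 ^ 2 * k)) by ring.
have h1 := leq_mul hZ (leqnn (p.+1 * p.+2 ^ 2)).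
have h2 := leq_mul (leqnn (3 * p.+1)) hD.
have h3 := leq_mul (leqnn (3 * p.+1 ^ 2)) hH.
have h4 := leq_mul (leqnn (4 * p.+2 ^ 2)) hD.
apply: leq_trans (leq_add (leq_add h1 h2) h3) _.
have -> : (5 * t + 4 * (d * (p.+2 ^ 2 * k))) * (p.+1 * p.+2 ^ 2) =
  5 * t * (p.+1 * p.+2 ^ 2) + 4 * p.+2 ^ 2 * (d * (p.+2 ^ 2 * p.+1 * k)) by ring.
apply: leq_trans (leq_add (leq_add (leq_add (leqnn _) h4) (leqnn _)) (leqnn _)) _.
by apply: eq_leq; ring.
Qed.

End Round.

(** * Convergence of the relaxation method *)

Definition leaves (B : seq edge) : seq edge :=
  [seq g <- B | ~~ has (fun f => (f != g) && sle f g) B].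

Section Relaxation.
Variables (q : nat) (fam : seq edge) (ls : seq link).
Hypotheses (lam : laminar fam) (uls : uniq ls) (q1 : 1 < q).
Hypothesis cover : forall g, g \in fam -> has (fun l => cv l g) ls.
Let m := size ls.

Lemma violated_cases wl (D := cuts q fam wl) (B := head [::] (violated q fam wl)) :
  [seq p.1 | p <- wl] = ls -> violated q fam wl <> [::] ->
  fits q wl B = [::] /\
  ((exists2 e, e \in fam & B = [:: e]) \/
   (exists t, [/\ t \in tops q fam wl D, B = part fam D t &
     forall e, e \in fam -> (q - 1) * m <= mass wl [:: e]])).
Proof.
move=> Els; rewrite {}/B /violated -/D; set s1 := [seq [:: e] | e <- fam].
set s2 := map _ (tops _ _ _ _).
have Em : size wl = m by rewrite /m -Els size_map.
rewrite filter_cat; case E1: [seq B <- s1 | _] => [|B s] /=; last first.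
  have : B \in [seq B <- s1 | nilp (fits q wl B)] by rewrite E1 mem_head.
  rewrite mem_filter => /andP[/nilP nB /mapP[e eF EB]] _; split=> //.
  by left; exists e.
case E2: [seq B <- s2 | _] => [|B s] // _ /=.
have : B \in [seq B <- s2 | nilp (fits q wl B)] by rewrite E2 mem_head.
rewrite mem_filter => /andP[/nilP nB /mapP[t tT EB]]; split=> //.
right; exists t; split=> // e eF; rewrite -Em.
have : [:: e] \in s1 by rewrite map_f.
have : ~~ has (fun B => nilp (fits q wl B)) s1 by rewrite has_filter E1.
move=> /hasPn/[apply]; case E: (fits q wl [:: e]) => [//|F s3] _.
have FE : F \in fits q wl [:: e] by rewrite E mem_head.
have [cF _] := fits_mass FE (mem_head _ _); apply: leq_trans.
rewrite -{1}[_ * _]mul1n leq_mul2r; apply/orP; right.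
by move: cF; rewrite /covered /=; case: (F).
Qed.

(** Leaves are pairwise incomparable, so a link covers at most two. As each has LP coverage at least
    [1 - 1 / q], the bounded coverage of a small part limits their number. *)
Lemma size_leaves wl (D := cuts q fam wl) t : 0 < m -> [seq p.1 | p <- wl] = ls ->
  t \in tops q fam wl D ->
  (forall e, e \in fam -> (q - 1) * m <= mass wl [:: e]) ->
  size (leaves (part fam D t)) <= 4 * q ^ 2.
Proof.
move=> m0 Els tT hm; have Em : size wl = m by rewrite /m -Els size_map.
have [tF] := mem_tops tT; rewrite /big -leqNgt Em => small_t.
set A := leaves _.
have AP f : f \in A -> f \in part fam D t by rewrite mem_filter => /andP[].
have minA f' f : f' \in A -> f \in part fam D t -> f != f' -> ~~ sle f f'.
  by rewrite mem_filter => /andP[/hasPn h _] /h + n; rewrite n.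
have AF : {subset A <= fam} by move=> f /AP; apply: part_fam.
have h1 : size A * ((q - 1) * m) <= \sum_(f <- A) mass wl [:: f].
  rewrite -sum1_size big_distrl /= big_seq [leqRHS]big_seq; apply: leq_sum => f fA.
  by rewrite mul1n hm // AF.
have h2 : \sum_(f <- A) mass wl [:: f] <= 2 * mass wl (part fam D t).
  rewrite (sum_mass1 _ id) massE big_distrr /= [leqRHS]big_mkcond big_seq [leqRHS]big_seq.
  apply: leq_sum => p pw.
  have uA : uniq A by do 2!apply: filter_uniq; apply: lam_uniq lam.
  have : count (cv p.1) A <= 2.
    rewrite -size_filter.
    apply: (@cover_size _ lam p.1 [::]) => //.
    - by move=> f; rewrite mem_filter => /andP[_ /AF].
    - exact: filter_uniq.
    - by move=> f; rewrite mem_filter => /andP[].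
    - move=> f f'; rewrite mem_filter => /andP[_ fA]; rewrite mem_filter => /andP[_ f'A] n le.
      by have := minA _ _ f'A (AP _ fA) n; rewrite le.
  case: ifP => [_ le2|/negbT/hasPn h _]; first by rewrite mulnC leq_mul2r le2 orbT.
  rewrite (@eq_in_count _ _ pred0) ?count_pred0 ?muln0 // => f /AP fP.
  by apply/negbTE/h.
have : size A * ((q - 1) * m) <= 2 * (q ^ 3 * m).
  by apply: leq_trans h1 _; apply: leq_trans h2 _; rewrite leq_mul2l small_t orbT.
rewrite (mulnA (size A)) (mulnA 2) leq_mul2r (gtn_eqF m0) /= => h3.
(* As [q] is at least 2, [q <= 2 * (q - 1)]; this replaces [2 * q ^ 3 / (q - 1)] by [4 * q ^ 2]. *)
have h4 : size A * q <= 2 * (size A * (q - 1)).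
  by rewrite mulnCA leq_mul2l; apply/orP; right; lia.
have h5 : size A * q <= (4 * q ^ 2) * q.
  apply: leq_trans h4 _; apply: (@leq_trans (2 * (2 * q ^ 3))); first by rewrite leq_mul2l h3 orbT.
  by apply: eq_leq; rewrite !expnS expn0; ring.
by rewrite leq_mul2r in h5; move: h5 => /orP[/eqP q0|//]; move: q1; rewrite q0.
Qed.

(** * The squared distance to an LP solution *)

Import GRing.Theory Num.Theory Order.TTheory.
Local Open Scope ring_scope.

Variables (R : realFieldType) (xs : link -> R).
Hypotheses (xs_ge0 : forall l, l \in ls -> 0 <= xs l)
  (xs_cut : forall e, e \in fam -> 1 <= \sum_(l <- ls | cv l e) xs l)
  (xs_part : forall D t n, {subset D <= fam} -> t \in fam ->
     (size (leaves (part fam D t)) <= 4 * q ^ 2)%N ->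
     (forall F, {subset F <= ls} -> covered F (part fam D t) -> (n <= size F)%N) ->
     n%:R <= \sum_(l <- ls | has (cv l) (part fam D t)) xs l).

(* The squared distance to the LP solution [xs], in units of [1 / (q * m)].  Every
   step lowers it by [m], unless the tests of the rounding are all passed by a
   point of near-optimal value. *)
Definition potential (wl : seq (link * nat)) : R :=
  \sum_(p <- wl) (p.2%:R - (q * m)%:R * xs p.1) ^+ 2.

Lemma potential_ge0 wl : 0 <= potential wl.
Proof. by apply: sumr_ge0 => p _; apply: sqr_ge0. Qed.

Lemma sum_links (wl : seq (link * nat)) (P : pred link) :
  [seq p.1 | p <- wl] = ls ->
  \sum_(p <- wl | P p.1) xs p.1 = \sum_(l <- ls | P l) xs l.
Proof. by move=> <-; rewrite big_map. Qed.

Lemma natr_mass wl B : (mass wl B)%:R = \sum_(p <- wl | has (cv p.1) B) p.2%:R :> R.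
Proof. by rewrite massE natr_sum. Qed.

Lemma violated_bound wl (B := head [::] (violated q fam wl)) : (0 < m)%N ->
  [seq p.1 | p <- wl] = ls -> violated q fam wl <> [::] ->
  (mass wl B + m + 1)%:R <= (q * m)%:R * \sum_(l <- ls | has (cv l) B) xs l.
Proof.
move=> m0 Els viol; have Em : size wl = m by rewrite /m -Els size_map.
have qm0 : (0 < q * m)%N by rewrite muln_gt0 m0 andbT; lia.
have nofit F : fits q wl B = [::] -> {subset F <= ls} -> covered F B ->
    (size F <= (q ^ 2).+1)%N -> (mass wl B + m < size F * (q * m))%N.
  move=> nB sF cF szF; rewrite ltnNge; apply/negP => le.
  have : F \in fits q wl B.
    by rewrite mem_filter cF Em le mem_lists szF Els /=; apply/allP.
  by rewrite nB.
have [nB' hB] := violated_cases Els viol; have {nB'}nB : fits q wl B = [::] by [].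
rewrite -/B in hB; case: hB => [[e eF EB]|[t [tT EB hm]]].
- have /hasP[l lls ce] := cover eF.
  have := nofit [:: l]; rewrite EB in nB *.
  move=> /(_ nB _ _ isT); rewrite mul1n => lt.
  have {}lt : (mass wl [:: e] + m < q * m)%N.
    by apply: lt => [x|]; rewrite /covered /= ?ce // inE => /eqP ->.
  apply: (@le_trans _ _ (q * m)%:R); first by rewrite ler_nat addn1.
  rewrite ler_peMr ?ler0n //; have := xs_cut eF.
  by under eq_bigl do rewrite -[cv _ _]orbF.
(* The least [n] such that [n * (q * m)] exceeds [mass wl B + m]. Every cover has at least [n]
   links, for otherwise it would fit. *)
- pose n := ((mass wl B + m) %/ (q * m)).+1.
  apply: (@le_trans _ _ ((q * m)%:R * n%:R)).
    by rewrite -natrM ler_nat addn1 mulnC /n ltn_ceil.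
  rewrite ler_pM2l ?ltr0n // EB; apply: xs_part.
  + exact: cuts_fam.
  + by have [] := mem_tops tT.
  + exact: size_leaves.
  + move=> F sF cF; rewrite -EB in cF.
    have [szF|szF] := leqP (size F) (q ^ 2).+1.
      by rewrite /n ltn_divLR //; apply: nofit.
    (* Covers too long for the search have at least [q ^ 2 + 2] links, and smallness of the part
       gives [n <= q ^ 2 + 2]. *)
    apply: leq_trans _ szF; rewrite /n ltnS.
    have [_ small_t] := mem_tops tT; rewrite /big -leqNgt Em -EB in small_t.
    rewrite -ltnS ltn_divLR //; apply: (@leq_ltn_trans (q ^ 3 * m + m)); first by rewrite leq_add2r.
    have -> : ((q ^ 2).+2 * (q * m) = q ^ 3 * m + (q * m + q * m))%N.
      by rewrite expnS; ring.
    rewrite ltn_add2l; apply: (@leq_trans (q * m + 1)); last by rewrite leq_add2l.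
    by rewrite addn1 ltnS leq_pmull //; lia.
Qed.

(** The change is twice the difference of the masses of [wl] and the scaled [xs] on the constraint,
    plus the number of links raised: at most [- 2 * (m + 1) + m]. *)
Lemma potential_increase wl : (0 < m)%N -> [seq p.1 | p <- wl] = ls ->
  violated q fam wl <> [::] ->
  potential (increase (head [::] (violated q fam wl)) wl) + m%:R <= potential wl.
Proof.
move=> m0 Els viol; have hB := violated_bound m0 Els viol.
set B := head _ _ in hB *.
pose y l := (q * m)%:R * xs l.
have -> : potential (increase B wl) = potential wl +
    \sum_(p <- wl | has (cv p.1) B) (2%:R * (p.2%:R - y p.1) + 1).
  rewrite /potential /increase big_map [X in _ + X]big_mkcond -big_split /=.
  apply: eq_bigr => p _; rewrite -/(y p.1); case: has; last by rewrite addr0.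
  by rewrite -addn1 natrD; ring.
rewrite big_split /= -big_distrr /= sumrB -natr_mass -big_distrr /=.
rewrite (sum_links (fun l => has (cv l) B) Els).
have h1 : \sum_(p <- wl | has (cv p.1) B) 1 <= m%:R :> R.
  rewrite (_ : \sum_(p <- wl | _) 1 = (count (fun p => has (cv p.1) B) wl)%:R).
    by rewrite ler_nat (leq_trans (count_size _ _)) // /m -Els size_map.
  by rewrite -sum1_count natr_sum.
have m0' : 0 < m%:R :> R by rewrite ltr0n.
by move: hB h1; rewrite !natrD; lra.
Qed.

(** The change is at most [m] minus twice the excess of the total weight, which is more than [m]. A
    weight that stays at zero fits this estimate because [xs] is nonnegative. *)
Lemma potential_decrease wl : [seq p.1 | p <- wl] = ls ->
  (q * m)%:R * \sum_(l <- ls) xs l + m%:R < (\sum_(p <- wl) p.2)%:R ->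
  potential (decrease wl) + m%:R <= potential wl.
Proof.
move=> Els hX; pose y l := (q * m)%:R * xs l.
have h : potential (decrease wl) <= potential wl +
    \sum_(p <- wl) (1 - 2%:R * (p.2%:R - y p.1)).
  rewrite /potential /decrease big_map -big_split /= big_seq [leRHS]big_seq.
  apply: ler_sum => -[l x] /= px; rewrite -/(y l).
  have y0 : 0 <= y l.
    by rewrite mulr_ge0 ?ler0n // xs_ge0 // -Els; apply: map_f px.
  case: x px => [|x] px /=; last by rewrite -addn1 natrD; lra.
  by rewrite -[0%N%:R]/(0 : R); lra.
apply: le_trans (lerD h (lexx _)) _.
rewrite sumrB -big_distrr /= sumrB -natr_sum -big_distrr /=.
have -> : \sum_(p <- wl) 1 = m%:R :> R.
  by rewrite /m -Els size_map -sum1_size natr_sum.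
rewrite (sum_links predT Els).
by move: hX; lra.
Qed.

Lemma relaxation : (0 < m)%N -> \sum_(l <- ls) xs l <= m%:R ->
  exists i, [/\ (i < rounds q m)%N,
    violated q fam (iter i (step q fam) ([seq (l, 0%N) | l <- ls], ls)).1 = [::] &
    (\sum_(p <- (iter i (step q fam) ([seq (l, 0%N) | l <- ls], ls)).1) p.2)%:R <=
       (q * m)%:R * \sum_(l <- ls) xs l + m%:R].
Proof.
move=> m0 hs; set s0 := (_, _).
have Els i : [seq p.1 | p <- (iter i (step q fam) s0).1] = ls.
  by rewrite step_links /= -map_comp map_id_in.
apply: contrapT => hn.
have drop i : (i <= rounds q m)%N ->
    potential (iter i (step q fam) s0).1 + (i * m)%:R <= potential s0.1.
  elim: i => [|i IH] lei; first by rewrite mul0n addr0.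
  apply: le_trans (IH (ltnW lei)); rewrite mulSn natrD addrA lerD2r iterS.
  set st := iter i _ _; rewrite /step; case: ifP => [/nilP ok|/nilP nok] /=; last first.
    exact: potential_increase (Els i) nok.
  apply: potential_decrease (Els i) _; rewrite ltNge; apply/negP => le.
  by apply: hn; exists i.
have := drop _ (leqnn _).
(* From zero weights the potential is [(q * m) ^ 2] times the sum of the squares of [xs], which is
   at most the square of its sum. *)
have h0 : potential s0.1 <= (q ^ 2 * (m * (m * m)) * m)%:R.
  rewrite /potential /s0 /= big_map /=.
  under eq_bigr do rewrite sub0r sqrrN exprMn.
  rewrite -big_distrr /=.
  have h1 : \sum_(l <- ls) xs l ^+ 2 <= (\sum_(l <- ls) xs l) ^+ 2.
    rewrite expr2 big_distrl /= big_seq [leRHS]big_seq; apply: ler_sum => l lls.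
    rewrite expr2 ler_wpM2l ?xs_ge0 // (big_rem _ lls) /= lerDl.
    by rewrite big_seq; apply: sumr_ge0 => l' /mem_rem; apply: xs_ge0.
  have s0' : 0 <= \sum_(l <- ls) xs l by rewrite big_seq; apply: sumr_ge0.
  have h2 : (\sum_(l <- ls) xs l) ^+ 2 <= m%:R ^+ 2 by rewrite lerXn2r ?nnegrE ?ler0n.
  apply: le_trans (ler_wpM2l (sqr_ge0 _) (le_trans h1 h2)) _.
  by rewrite -!natrX -natrM ler_nat; apply: eq_leq; ring.
have := potential_ge0 (iter (rounds q m) (step q fam) s0).1.
have : ((q ^ 2 * (m * (m * m)) * m)%N + 1 <= rounds q m * m)%N.
  by rewrite /rounds mulnDl mul1n leq_add2l.
rewrite -(@ler_nat R) natrD; lra.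
Qed.

Let out := (iter (rounds q m) (step q fam) ([seq (l, 0%N) | l <- ls], ls)).2.

Lemma out_feasible :
  [/\ uniq out, {subset out <= ls} & forall g, g \in fam -> has (fun l => cv l g) out].
Proof.
rewrite {}/out; set s0 := (_, _).
have Els i : [seq p.1 | p <- (iter i (step q fam) s0).1] = ls.
  by rewrite step_links /= -map_comp map_id_in.
elim: (rounds q m) => [|i] /=; first by split.
move: (Els i); set st := iter i _ _ => Est [h1 h2 h3].
rewrite /step; case: ifP => [/nilP ok|] //=; case: ifP => _ //; split.
- by apply: filter_uniq; rewrite Est.
- by move=> l; rewrite mem_filter Est => /andP[].
- by apply: (solution_covers lam _ ok); rewrite Est.
Qed.

(** The algorithm cannot recognise the good round that [relaxation] provides. It keeps the best
    solution seen, which is no worse. *)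
Lemma size_out i : (i < rounds q m)%N ->
  violated q fam (iter i (step q fam) ([seq (l, 0%N) | l <- ls], ls)).1 = [::] ->
  (size out <= size (solution q fam (iter i (step q fam) ([seq (l, 0%N) | l <- ls], ls)).1))%N.
Proof.
rewrite {}/out; set s0 := (_, _) => lti ok.
have mono j : (i.+1 <= j)%N -> (size (iter j (step q fam) s0).2
    <= size (iter i.+1 (step q fam) s0).2)%N.
  elim: j => // j IH; rewrite leq_eqVlt => /orP[/eqP <- //|/IH h].
  apply: leq_trans h; rewrite iterS; set st := iter j _ _; rewrite /step.
  by case: ifP => _ //=; case: ltnP => // /ltnW.
apply: leq_trans (mono _ lti) _; rewrite iterS {1}/step ok /=.
by case: ltnP.
Qed.

Lemma out_ratio :
  (3 * (q - 1) * size out)%:R <= (5 * (q - 1) + 40)%:R * \sum_(l <- ls) xs l.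
Proof.
have [_ sub _] := out_feasible.
have szo : (size out <= m)%N by apply: uniq_leq_size => //; case: out_feasible.
have x0 : 0 <= \sum_(l <- ls) xs l by rewrite big_seq; apply: sumr_ge0.
have [m0|m0] := posnP m.
  move: szo; rewrite m0 leqn0 => /eqP ->; rewrite muln0.
  by rewrite mulr_ge0 ?ler0n.
(* [relaxation] assumes an LP value of at most [m]; above that, [size out <= m] suffices. *)
have [hs|hs] := lerP (\sum_(l <- ls) xs l) m%:R; last first.
  apply: (@le_trans _ _ ((5 * (q - 1) + 40)%:R * m%:R)).
    by rewrite -natrM ler_nat leq_mul //; lia.
  by rewrite ler_wpM2l ?ler0n // ltW.
set x := \sum_(l <- ls) xs l in x0 hs *.
(* An LP value below 1 means that the tree has no edge. Then zero weights pass all tests at once and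
   the first solution is empty. *)
have [x1|x1] := lerP 1 x; last first.
  have nf : fam = [::].
    have [//|[e eF]] : fam = [::] \/ exists e, e \in fam.
      by case: (fam) => [|e s]; [left|right; exists e; rewrite mem_head].
    exfalso; have := xs_cut eF.
    suff : \sum_(l <- ls | cv l e) xs l <= x by lra.
    rewrite /x big_mkcond big_seq [leRHS]big_seq; apply: ler_sum => l lls.
    by case: ifP => // _; apply: xs_ge0.
  have ok : violated q fam [seq (l, 0%N) | l <- ls] = [::] by rewrite nf.
  have r0 : (0 < rounds q m)%N by rewrite /rounds addn1.
  have := size_out r0 ok => /= oS.
  have Els : [seq p.1 | p <- [seq (l, 0%N) | l <- ls]] = ls by rewrite -map_comp map_id_in.
  have := solution_ratio lam _ ok q1; rewrite Els => /(_ cover uls).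
  rewrite (_ : \sum_(p <- _) p.2 = 0)%N; last by rewrite big_map big1.
  have k0 : (0 < (q - 1) ^ 2 * q ^ 2)%N by rewrite muln_gt0 !expn_gt0; lia.
  rewrite mul0n leqn0 muln_eq0 (gtn_eqF k0) orbF size_map -/m muln_eq0 (gtn_eqF m0) orbF.
  rewrite muln_eq0 /= => /eqP S0; move: oS; rewrite S0 leqn0 => /eqP ->.
  by rewrite muln0 mulr_ge0 ?ler0n.
have [i [lti ok hX]] := relaxation m0 hs.
have Els : [seq p.1 | p <- (iter i (step q fam) ([seq (l, 0%N) | l <- ls], ls)).1] = ls.
  by rewrite step_links /= -map_comp map_id_in.
have := solution_ratio lam _ ok q1; rewrite Els => /(_ cover uls).
have := size_out lti ok.
have -> : size (iter i (step q fam) ([seq (l, 0%N) | l <- ls], ls)).1 = m.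
  by rewrite -(size_map fst) Els.
move: (size (solution _ _ _)) (size out) hX => S o.
move: (\sum_(p <- _) p.2)%N => U hU oS hS.
(* The additive error [m] of the relaxation is absorbed using [1 <= x]. *)
have {}hU : U%:R <= (m * (q + 1))%:R * x.
  apply: le_trans hU _; rewrite -/x !natrM natrD.
  have : m%:R <= m%:R * x by rewrite ler_peMr ?ler0n.
  by lra.
case: q q1 hU hS => // -[//|p] _; rewrite subSS subn0 => hU hS.
(* Here [10] collects the lower-order terms: [4 q^2 + 3 (q - 1) + 6 (q - 1)^2 <= 10 q^2]. *)
have h2 : (3 * o * m * (p.+1 ^ 2 * p.+2 ^ 2) <= U * (p.+2 ^ 2 * (5 * p.+1 + 10)))%N.
  apply: (@leq_trans (3 * S * m * (p.+1 ^ 2 * p.+2 ^ 2))).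
    by rewrite !leq_mul2r leq_mul2l oS !orbT.
  apply: leq_trans hS _; rewrite leq_mul2l; apply/orP; right.
  nia.
have h3 : (3 * o * m * p.+1 ^ 2 <= U * (5 * p.+1 + 10))%N.
  have : (3 * o * m * p.+1 ^ 2 * p.+2 ^ 2 <= U * (5 * p.+1 + 10) * p.+2 ^ 2)%N.
    by move: h2; rewrite mulnA [(_ ^ 2 * (_ + _))%N]mulnC mulnA.
  by rewrite leq_mul2r expn_eq0.
have {h2}h4 : ((3 * o * p.+1 ^ 2) * m)%:R <= ((p.+3 * (5 * p.+1 + 10)) * m)%:R * x.
  apply: (@le_trans _ _ (U * (5 * p.+1 + 10))%:R).
    by rewrite ler_nat (leq_trans _ h3) // mulnAC.
  rewrite natrM; apply: (@le_trans _ _ ((m * (p.+2 + 1))%:R * x * (5 * p.+1 + 10)%:R)).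
    by rewrite ler_wpM2r ?ler0n.
  rewrite mulrAC -natrM.
  by have -> : (m * (p.+2 + 1) * (5 * p.+1 + 10) = p.+3 * (5 * p.+1 + 10) * m)%N by ring.
have {}h4 : (3 * o * p.+1 ^ 2)%:R <= (p.+3 * (5 * p.+1 + 10))%:R * x.
  have m0' : 0 < m%:R :> R by rewrite ltr0n.
  by rewrite -(ler_pM2r m0') -natrM mulrAC -natrM.
(* Origin of [40]: for [s = q - 1], the factor [(s + 2) (5 s + 10) = 5 s^2 + 20 s + 20] is at most
   [5 s^2 + 40 s], as [s >= 1]. *)
have h5 : (3 * o * p.+1 ^ 2)%:R <= (p.+1 * (5 * p.+1 + 40))%:R * x.
  apply: le_trans h4 _; rewrite ler_wpM2r // ler_nat; nia.
have p0 : 0 < p.+1%:R :> R by rewrite ltr0n.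
rewrite -(ler_pM2l p0) mulrA -!natrM; apply: le_trans h5.
by rewrite ler_nat; apply: eq_leq; ring.
Qed.

End Relaxation.

(** * Cuts of a tree *)

Lemma adj_sym (V : finType) (E : {set {set V}}) : symmetric (adj E).
Proof. by move=> u v; rewrite /adj setUC. Qed.

Lemma connect_adj_sym (V : finType) (E : {set {set V}}) : connect_sym (adj E).
Proof. exact/sym_connect_sym/adj_sym. Qed.

Lemma connect_adj_sub (V : finType) (E E' : {set {set V}}) u v :
  E \subset E' -> connect (adj E) u v -> connect (adj E') u v.
Proof.
move=> /subsetP sub; apply: connect_sub => x y xy.
by apply: connect1; apply: sub.
Qed.

Section Tree.
Variables (V : finType) (E : {set {set V}}) (r : V).
Hypothesis tree : is_tree E.
Implicit Types (e f g t : {set V}) (u v x y : V).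

Definition rside e v : bool := connect (adj (E :\ e)) r v.

Definition bset e : {set V} := [set v | ~~ rside e v].

Lemma edge_ends e : e \in E -> exists a b, a != b /\ e = [set a; b].
Proof.
move=> eE; have [_ card2 _ _] := tree.
by have /eqP/cards2P[a [b [nab Ee]]] := card2 e eE; exists a, b.
Qed.

Lemma tree_connected u v : connect (adj E) u v.
Proof. by case: tree => _ _ /forallP/(_ u)/forallP/(_ v). Qed.

Lemma bridge a b : [set a; b] \in E -> a != b ->
  ~~ connect (adj (E :\ [set a; b])) a b.
Proof.
move=> eE nab; apply/negP => /connectP[p0 pth0 lst0].
have [p [pth up _ lst]] : exists p, [/\ path (adj (E :\ [set a; b])) a p, uniq (a :: p), True & b = last a p].
  by case/shortenP: pth0 lst0 => p pth up _ Eb; exists p; split.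
case: tree => _ _ _ /(_ (a :: p)) acyc.
have sz : 2 < size (a :: p).
  case: p pth up lst {acyc} => [|x [|y p]] //= pth up lst; first by rewrite lst eqxx in nab.
  by move: pth; rewrite -lst /adj !inE eqxx.
have /negP := acyc sz; apply; rewrite /ucycleb up andbT /= rcons_path.
rewrite -lst /adj setUC eE andbT.
by apply: sub_path pth => x y; rewrite /adj inE => /andP[].
Qed.

Lemma connect_end a b w : [set a; b] \in E ->
  connect (adj (E :\ [set a; b])) a w \/ connect (adj (E :\ [set a; b])) b w.
Proof.
move=> eE; have /connectP[p + ->] := tree_connected a w.
elim/last_ind: p => [|p y IH]; first by left; apply: connect0.
rewrite rcons_path last_rcons => /andP[/IH {}IH xy].
have [Exy|nxy] := eqVneq [set last a p; y] [set a; b].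
  have : y \in [set a; b] by rewrite -Exy set22.
  by rewrite !inE => /orP[] /eqP ->; [left|right]; apply: connect0.
have step : connect (adj (E :\ [set a; b])) (last a p) y.
  by apply: connect1; rewrite /adj !inE nxy.
by case: IH => h; [left|right]; apply: connect_trans step.
Qed.

Lemma rside_adj e u v : [set u; v] \in E -> [set u; v] != e -> rside e u = rside e v.
Proof.
move=> uvE nuv; apply: same_connect_r; first exact: connect_adj_sym.
by apply: connect1; rewrite /adj !inE nuv.
Qed.

Lemma rside_ends a b : [set a; b] \in E -> a != b ->
  rside [set a; b] a != rside [set a; b] b.
Proof.
move=> eE nab; have nc := bridge eE nab; rewrite /rside.
have sym := @connect_adj_sym V (E :\ [set a; b]).
case: (connect_end r eE) => h.
  rewrite (sym r a) h; apply/eqP => /esym rb; case/negP: nc.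
  exact: connect_trans h rb.
rewrite (sym r b) h; apply/eqP => ra; case/negP: nc.
by rewrite sym; apply: connect_trans h ra.
Qed.

(** Deleting [e] leaves exactly two components: each vertex stays connected to one of the ends of
    [e], and the ends lie on different sides. *)
Lemma rsideP e u v : e \in E -> (rside e u == rside e v) = connect (adj (E :\ e)) u v.
Proof.
move=> eE; have sym := @connect_adj_sym V (E :\ e).
apply/eqP/idP => [Euv|cuv]; last exact: same_connect_r.
have [a [b [nab Ee]]] := edge_ends eE.
have [ru|nru] := boolP (rside e u).
  by apply: (connect_trans (y := r)); [rewrite sym|move: ru; rewrite Euv].
have nrv : ~~ rside e v by rewrite -Euv.
subst e; have nab2 := rside_ends eE nab.
suff [x hx] : exists x, forall w, ~~ rside [set a; b] w -> connect (adj (E :\ [set a; b])) x w.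
  by apply: connect_trans (hx _ nrv); rewrite sym; apply: hx.
have [ra|nra] := boolP (rside [set a; b] a).
  exists b => w nw; case: (connect_end w eE) => // aw.
  by case/negP: nw; apply: connect_trans ra aw.
exists a => w nw; case: (connect_end w eE) => // bw.
have rb : rside [set a; b] b by move: nab2; rewrite (negbTE nra); case: (rside _ b).
by case/negP: nw; apply: connect_trans rb bw.
Qed.

Lemma mem_pairmap_set u (s : seq V) f x :
  f \in pairmap (fun x y => [set x; y]) u s -> x \in f -> x \in u :: s.
Proof.
elim: s u => //= y s IH u; rewrite inE => /orP[/eqP ->|/IH h xf].
  by rewrite !inE => /orP[]/eqP ->; rewrite eqxx ?orbT.
by rewrite inE h ?orbT.
Qed.

Lemma path_edges_sub u s : path (adj E) u s -> path_edges u s \subset E.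
Proof.
move=> pth; apply/subsetP => e; rewrite inE.
by elim: s u pth => //= y s IH u /andP[uy /IH h]; rewrite inE => /orP[/eqP ->|/h].
Qed.

Lemma mem_path_edges u s v e : is_path E u s v -> e \in E ->
  (e \in path_edges u s) = (rside e u != rside e v).
Proof.
move=> /and3P[pth us /eqP <-] eE; rewrite inE.
elim: s u pth us => [|y s IH] u /=; first by rewrite eqxx.
move=> /andP[uy pth] /andP[nu us]; rewrite inE; have {}IH := IH y pth us.
have nuy : u != y by apply: contraNneq nu => ->; rewrite mem_head.
have [Ee|ne] := eqVneq e [set u; y]; last first.
  by rewrite /= IH (rside_adj uy) // eq_sym.
have : e \notin pairmap (fun x y => [set x; y]) y s.
  by apply: contra nu => /mem_pairmap_set -/(_ u); apply; rewrite Ee set21.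
rewrite IH negbK => /eqP <-; rewrite /= Ee; apply/esym/rside_ends => //.
Qed.

Lemma path_exists u v : exists s, is_path E u s v.
Proof.
have /connectP[p pth ->] := tree_connected u v.
by case/shortenP: pth => s pth us _; exists s; apply/and3P; split.
Qed.

Lemma link_pathE (l : V * V) : link_path E l = [set e in E | rside e l.1 != rside e l.2].
Proof.
apply/setP => e; rewrite !inE; apply/asboolP/andP => [[s [ps es]]|[eE ne]].
  have eE : e \in E.
    by move: es; apply/subsetP/path_edges_sub; case/and3P: ps.
  by rewrite eE -(mem_path_edges ps eE).
by have [s ps] := path_exists l.1 l.2; exists s; rewrite (mem_path_edges ps eE).
Qed.

Lemma lower_end e : e \in E -> exists a b,
  [/\ e = [set a; b], a \notin bset e & b \in bset e].
Proof.
move=> eE; have [a [b [nab Ee]]] := edge_ends eE; subst e.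
have := rside_ends eE nab; case Ea: (rside _ a); case Eb: (rside _ b) => // _.
  by exists a, b; rewrite !inE Ea Eb.
by exists b, a; rewrite !inE Ea Eb setUC.
Qed.

Lemma bset_neighbour e f u v : [set u; v] \in E -> [set u; v] != e ->
  (u \in bset e) = (v \in bset e).
Proof. by move=> uvE ne; rewrite !inE (rside_adj uvE ne). Qed.

Lemma connect_avoid e g x y z : z \in g -> rside e z != rside e x ->
  connect (adj (E :\ e)) x y -> connect (adj (E :\ g)) x y.
Proof.
move=> zg nz /connectP[p + ->].
suff H : path (adj (E :\ e)) x p -> connect (adj (E :\ g)) x (last x p) /\ rside e x = rside e (last x p).
  by move=> /H[].
elim/last_ind: p => [|p w IH]; first by rewrite connect0.
rewrite rcons_path last_rcons => /andP[/IH[h hx] xw].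
move: (xw); rewrite /adj !inE => /andP[ne wE].
have Ew : rside e (last x p) = rside e w by apply: rside_adj.
split; last by rewrite hx.
apply: connect_trans h _; apply: connect1; rewrite /adj !inE wE andbT.
apply: contra nz => /eqP Eg; move: zg; rewrite -Eg !inE => /orP[]/eqP ->.
  by rewrite hx.
by rewrite hx Ew.
Qed.

(** Both ends of [g] are on one side of [e], so the other side of [e] is connected without [g]. If
    this is the lower side, all of it is below [g] with [x]; if it is the root side, nothing in it
    is below [g]. *)
Lemma bset_cross e g x : e \in E -> g \in E -> x \in bset e -> x \in bset g ->
  bset e \subset bset g \/ bset g \subset bset e.
Proof.
move=> eE gE xe xg; have [<-|neg] := eqVneq e g; first by left.
have [a [b [Ee]]] := lower_end eE; have [c [d [Eg _ _]]] := lower_end gE.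
rewrite !inE negbK => ra rb.
have Ecd : rside e c = rside e d by apply: rside_adj; rewrite -Eg 1?eq_sym.
have Eab : rside g a = rside g b by apply: rside_adj; rewrite -Ee.
have cg : c \in g by rewrite Eg set21.
have [rc|nrc] := boolP (rside e c).
  have h v : v \in bset e -> rside g v = rside g b.
    rewrite inE => nv; apply/esym/eqP; rewrite rsideP //.
    apply: (connect_avoid (e := e) cg); first by rewrite rc (negbTE rb).
    by rewrite -rsideP // (negbTE rb) (negbTE nv).
  left; apply/subsetP => v ve; rewrite inE h // -(h x xe).
  by move: xg; rewrite inE.
right; apply/subsetP => v; rewrite !inE; apply: contra => rv.
apply: (connect_avoid (e := e) cg) rv.
by rewrite (negbTE nrc) /rside connect0.
Qed.

Lemma bset_inj : {in E &, injective bset}.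
Proof.
move=> e g eE gE Eb; apply/eqP/idPn => neg.
have [c [d [Eg nc dg]]] := lower_end gE.
have := @bset_neighbour e g c d; rewrite -Eg gE eq_sym neg Eb dg (negbTE nc).
by move=> /(_ isT isT).
Qed.

(** The path runs from the lower end of [g] to the upper end of [t]; an edge lies on it when it
    separates these ends. *)
Lemma chain_path g t : g \in E -> t \in E -> bset g \subset bset t ->
  exists u s v, is_path E u s v /\
    forall h, (h \in path_edges u s) =
      [&& h \in E, bset g \subset bset h & bset h \subset bset t].
Proof.
move=> gE tE gt; have [c [d [Eg nc dg]]] := lower_end gE.
have [a [b [Et na bt]]] := lower_end tE.
have [s ps] := path_exists d a; exists d, s, a; split=> // h.
have [hE|nhE] := boolP (h \in E); last first.
  apply/negbTE; apply: contra nhE; apply/subsetP/path_edges_sub; by case/and3P: ps.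
rewrite (mem_path_edges ps hE) /=.
have dt : d \in bset t by move/subsetP: gt; apply.
have -> : (rside h d != rside h a) = (d \in bset h) && (a \notin bset h) || (d \notin bset h) && (a \in bset h).
  by rewrite !inE; case: (rside h d); case: (rside h a).
have up : a \in bset h -> bset t \subset bset h.
  move=> ah; have nth : h != t by apply: contraNneq na => <-.
  have bh : b \in bset h by rewrite -(@bset_neighbour h t a b) -?Et // eq_sym.
  case: (bset_cross tE hE bt bh) => // /subsetP/(_ _ ah); by rewrite (negbTE na).
apply/orP/andP => [[/andP[dh nah]|/andP[ndh ah]]|[/subsetP gh /subsetP ht]]; last first.
- by left; rewrite gh //=; apply: contra na; apply: ht.
- by move/subsetP: (up ah) => /(_ _ dt); rewrite (negbTE ndh).
split.
  case: (bset_cross gE hE dg dh) => // hg.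
  have [-> //|ngh] := eqVneq g h.
  have ch : c \in bset h by rewrite (@bset_neighbour h g c d) -?Eg.
  by move/subsetP: hg => /(_ _ ch); rewrite (negbTE nc).
case: (bset_cross hE tE dh dt) => // th.
have [<- //|nth] := eqVneq t h.
have bh : b \in bset h by move/subsetP: th; apply.
by move: nah; rewrite (@bset_neighbour h t a b) -?Et // bh.
Qed.

(** Edges form a set, so a link parallel to a tree edge would disappear with it; disjointness makes
    the crossing link survive the deletion. *)
Lemma feasible_cuts (S L : {set V * V}) : S \subset L -> [disjoint link_edges L & E] ->
  feasible E L S = [forall e in E, exists l in S, rside e l.1 != rside e l.2].
Proof.
move=> SL dLE; rewrite /feasible SL /=.
have linkP l : l \in S -> [set l.1; l.2] \in link_edges S by move=> lS; apply/imsetP; exists l.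
have nE l : l \in S -> [set l.1; l.2] \notin E.
  move=> lS; apply: contraTN dLE => lE; apply/pred0Pn; exists [set l.1; l.2].
  by rewrite /= lE andbT; apply/imsetP; exists l => //; apply: (subsetP SL).
apply/andP/forall_inP => [[_ /forall_inP h] e eE|h].
  apply: contraT; rewrite negb_exists_in => /forall_inP nl.
  have /h/forallP/(_ r)/forallP hr : e \in E :|: link_edges S by rewrite inE eE.
  have [a [b [Ee na bb]]] := lower_end eE.
  have /connectP[p + Eb] := hr b.
  suff inv : path (adj ((E :|: link_edges S) :\ e)) r p -> rside e (last r p).
    by move=> /inv; rewrite -Eb; move: bb; rewrite inE => /negbTE ->.
  elim/last_ind: p {Eb} => [|p y IH]; first by rewrite /rside connect0.
  rewrite rcons_path last_rcons => /andP[/IH {}IH].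
  rewrite /adj !inE => /andP[ne /orP[fE|/imsetP[l lS El]]].
    by rewrite -(rside_adj fE).
  have := nl _ lS; rewrite negbK => /eqP El2.
  have El' z : z \in [set l.1; l.2] -> rside e z = rside e l.1.
    by rewrite !inE => /orP[]/eqP ->.
  by rewrite (El' y) -?El ?set22 // -(El' (last r p)) // -El set21.
have sub : E \subset E :|: link_edges S by apply: subsetUl.
split.
  by apply/forallP => u; apply/forallP => v; apply: connect_adj_sub sub (tree_connected u v).
apply/forall_inP => f _; apply/forallP => u; apply/forallP => v.
have [fE|nfE] := boolP (f \in E); last first.
  apply: connect_adj_sub (tree_connected u v); apply/subsetP => x xE.
  by rewrite !inE xE andbT; apply: contraNneq nfE => <-.
set G := _ :\ f.
have subf : E :\ f \subset G by apply: setSD.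
have toroot w : connect (adj G) r w.
  have [rw|nrw] := boolP (rside f w); first exact: connect_adj_sub rw.
  have /exists_inP[l lS nl] := h f fE.
  have lG : connect (adj G) l.1 l.2.
    apply: connect1; rewrite /adj !inE linkP // orbT andbT.
    by apply: contraNneq (nE _ lS) => ->.
  have cw x : ~~ rside f x -> connect (adj G) x w.
    by move=> nx; apply: connect_adj_sub subf _; rewrite -rsideP // (negbTE nx) (negbTE nrw).
  case E1: (rside f l.1) nl => nl.
    apply: connect_trans (connect_adj_sub subf E1) _.
    by apply: connect_trans lG (cw _ _); case: (rside f l.2) nl.
  have E2 : rside f l.2 by case: (rside f l.2) nl.
  apply: connect_trans (connect_adj_sub subf E2) _.
  by rewrite connect_adj_sym in lG; apply: connect_trans lG (cw _ _); rewrite E1.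
by apply: connect_trans (toroot v); rewrite connect_adj_sym.
Qed.

End Tree.

(** * The bundle LP *)

Section UnitLP.
Import GRing.Theory Num.Theory Order.TTheory.
Local Open Scope ring_scope.
Variables (R : realType) (V : finType) (E : {set {set V}}) (L : {set V * V}).
Hypothesis LE : covers E L E.
Local Notation c := (@unit_cost R V).
Implicit Types (F : {set V * V}) (X B : {set {set V}}).

Lemma coversP F X :
  reflect (forall e, e \in X -> exists2 l, l \in F & e \in link_path E l) (covers E F X).
Proof.
apply: (iffP subsetP) => h e /h; first by move=> /bigcupP[l lF el]; exists l.
by move=> [l lF el]; apply/bigcupP; exists l.
Qed.

Lemma unit_costE F : cost c F = #|F|%:R.
Proof. by rewrite /cost /unit_cost -sum1_card natr_sum. Qed.

(** By [LE] the set [L] itself is admissible, so [OPT] is a true minimum and not a default value. *)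
Lemma OPT_spec X : X \subset E -> exists F,
  [/\ F \subset L, covers E F X, OPT E L c X = #|F|%:R &
      forall F', F' \subset L -> covers E F' X -> (#|F| <= #|F'|)%N].
Proof.
move=> /subsetP XE; rewrite /OPT.
have LX : (L \subset L) && covers E L X.
  by rewrite subxx; apply/coversP => e /XE; move/coversP: LE; apply.
case: (@Order.TotalTheory.arg_minP _ _ _ L (fun F => (F \subset L) && covers E F X) (cost c) LX).
move=> F /andP[FL FX] Fmin; exists F; split=> //; first exact: unit_costE.
move=> F' F'L F'X; have := Fmin F'; rewrite F'L F'X => /(_ isT).
by rewrite !unit_costE ler_nat.
Qed.

Lemma bundle_sub gamma B : bundle E gamma B -> B \subset E.
Proof.
move=> [u [v [s [ps ->]]]]; apply/bigcupsP => i _; apply: path_edges_sub.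
by case/and3P: (ps i).
Qed.

Lemma mem_cov X l : (l \in cov E L X) = (l \in L) && [exists e in X, e \in link_path E l].
Proof. by rewrite inE. Qed.

Lemma LP_feasible_cover gamma F : F \subset L -> covers E F E ->
  LP_feasible E L c gamma (fun l => (l \in F)%:R).
Proof.
move=> FL FE.
have sumE X : \sum_(l in cov E L X) (l \in F)%:R = #|F :&: cov E L X|%:R :> R.
  rewrite -sum1_card natr_sum [RHS]big_mkcond [LHS]big_mkcond; apply: eq_bigr => l _.
  by rewrite in_setI andbC; case: (l \in cov E L X); case: (l \in F).
split.
- move=> e eE; rewrite sumE ler1n; apply/card_gt0P.
  have [l lF el] := coversP _ _ FE _ eE; exists l.
  rewrite in_setI lF mem_cov (subsetP FL) //=; apply/exists_inP; exists e => //; exact: set11.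
- by move=> l _; apply: ler0n.
- move=> B /bundle_sub BE; have [F' [_ _ -> Fmin]] := OPT_spec BE.
  under eq_bigr do rewrite mul1r.
  rewrite sumE ler_nat; apply: Fmin; first by rewrite subIset // FL.
  apply/coversP => e eB; have [l lF el] := coversP _ _ FE _ (subsetP BE _ eB).
  exists l => //; rewrite in_setI lF mem_cov (subsetP FL) //=.
  by apply/exists_inP; exists e.
Qed.

Lemma LP_le_OPT gamma : LP_value E L c gamma <= OPT E L c E.
Proof.
have [F [FL FE -> _]] := OPT_spec (subxx E).
apply: ge_inf; first exists 0.
  move=> _ [x [_ x0 _] ->]; apply: sumr_ge0 => l lL.
  by rewrite mul1r x0.
exists (fun l => (l \in F)%:R); first exact: LP_feasible_cover.
rewrite -sum1_card natr_sum [LHS]big_mkcond [RHS]big_mkcond; apply: eq_bigr => l _.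
case: (boolP (l \in F)) => lF; last by rewrite mulr0 if_same.
by rewrite (subsetP FL) // mulr1.
Qed.

Lemma le_LP_value gamma (a k : R) : 0 < k ->
  (forall x, LP_feasible E L c gamma x -> a <= k * \sum_(l in L) x l) ->
  a <= k * LP_value E L c gamma.
Proof.
move=> k0 h; rewrite mulrC -ler_pdivrMr //; apply: lb_le_inf.
  exists (\sum_(l in L) c l * (l \in L)%:R), (fun l => (l \in L)%:R) => //.
  exact: LP_feasible_cover.
move=> _ [x /h hx ->]; rewrite ler_pdivrMr // mulrC.
by under eq_bigr do rewrite mul1r.
Qed.

Lemma OPT_bundle gamma x B n : LP_feasible E L c gamma x -> bundle E gamma B ->
  (forall F, F \subset L -> covers E F B -> (n <= #|F|)%N) ->
  n%:R <= \sum_(l in cov E L B) x l.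
Proof.
move=> [_ _ hx] hB hn; have [F [FL FB EO _]] := OPT_spec (bundle_sub hB).
have := hx B hB; rewrite EO; under eq_bigr do rewrite mul1r.
by apply: le_trans; rewrite ler_nat hn.
Qed.

End UnitLP.

(** A bundle has exactly [gamma] paths; a shorter list is padded with copies of the path of [x0],
    the default of [nth]. *)
Lemma bundle_seq (V : finType) (E : {set {set V}}) (T : eqType) (x0 : T) (s : seq T)
    (P : T -> {set {set V}}) (B : {set {set V}}) gamma :
  x0 \in s -> size s <= gamma ->
  (forall x, x \in s -> exists u p v, is_path E u p v /\ path_edges u p = P x) ->
  (forall e, (e \in B) = has (fun x => e \in P x) s) ->
  bundle E gamma B.
Proof.
move=> x0s szs hP hB.
have ns i : nth x0 s i \in s.
  by have [lti|lei] := ltnP i (size s); [apply: mem_nth|rewrite nth_default].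
have /choice[f hf] : forall i : 'I_gamma, exists w : V * seq V * V,
    is_path E w.1.1 w.1.2 w.2 /\ path_edges w.1.1 w.1.2 = P (nth x0 s i).
  by move=> i; have [u [p [v [h1 h2]]]] := hP _ (ns i); exists (u, p, v).
exists (fun i => (f i).1.1), (fun i => (f i).2), (fun i => (f i).1.2); split.
  by move=> i; case: (hf i).
apply/setP => e; rewrite hB; apply/hasP/bigcupP => [[x xs ex]|[i _]].
  have lti : index x s < gamma by apply: leq_trans szs; rewrite index_mem.
  by exists (Ordinal lti) => //; have [_ ->] := hf (Ordinal lti); rewrite nth_index.
by have [_ ->] := hf i => ei; exists (nth x0 s i).
Qed.

(** * From instances to laminar families *)

Definition nat_link n (l : 'I_n * 'I_n) : link := (val l.1, val l.2).

Definition nat_instance (I : tap_instance) : nat * (seq (nat * nat) * seq (nat * nat)) :=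
  (tap_n I, (map (@nat_link _) (tap_edges I), map (@nat_link _) (tap_links I))).

Lemma enc_nat_links n (s : seq ('I_n * 'I_n)) :
  enc (map (@nat_link n) s) = enc_seq (@enc_pair n) s.
Proof. by elim: s => //= l s <-. Qed.

Lemma enc_nat_instance I : enc (nat_instance I) = enc_instance I.
Proof. by rewrite /enc_instance -!enc_nat_links. Qed.

Lemma nat_link_inj n : injective (@nat_link n).
Proof. by move=> [a b] [c d] [/val_inj -> /val_inj ->]. Qed.

Lemma polyt_runs A B (EA : Enc A) (EB : Enc B) (f : A -> B) : polyt f ->
  exists (alg : cmd) (a k : nat), forall x, exists t,
    runs alg (enc x) (enc (f x)) t /\ t <= a * dsize (enc x) ^ k + a.
Proof.
move=> [p [b [[_ [a [k hb]]] hp _]]]; exists (p 0), (a * 2 ^ k), k => x.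
have [s' [t [ex v _ le]]] := hp x 0 (update (fun=> DNil) 0 (enc x)) erefl.
exists t; split; first by exists s'.
apply: leq_trans le _; apply: leq_trans (hb _) _; apply: leq_trans (leq_addr _ _).
rewrite -mulnA leq_mul2l -expnMn; apply/orP; right.
case: k {hb} => [|k]; rewrite ?expn0 // leq_exp2r // mul2n -addnn -addn1 leq_add2l.
exact: dsize_gt0.
Qed.

(** * The vertex sets below the tree edges of an instance *)

Section Bridge.
Variables (n : nat) (es : seq ('I_n * 'I_n)).
Let E : {set {set 'I_n}} := [set [set e.1; e.2] | e in es].
Hypothesis tree : is_tree E.
Variable r : 'I_n.
Hypothesis r0 : val r = 0.
Let nes := map (@nat_link n) es.

Definition bl (e : {set 'I_n}) : edge := [seq val v | v <- enum (bset E r e)].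

Lemma mem_bl e v : (val v \in bl e) = (v \in bset E r e).
Proof. by rewrite mem_map ?mem_enum //; exact: val_inj. Qed.

Lemma blP e x : reflect (exists2 v, x = val v & v \in bset E r e) (x \in bl e).
Proof.
apply: (iffP mapP) => -[v]; rewrite ?mem_enum => h1 h2; exists v => //.
by rewrite mem_enum.
Qed.

Lemma set2_eq (a b c d : 'I_n) :
  ([set a; b] == [set c; d]) = same_edge (nat_link (a, b)) (nat_link (c, d)).
Proof.
rewrite /same_edge /nat_link /= !val_eqE; apply/eqP/orP => [/setP h|[]/andP[/eqP -> /eqP ->] //].
  have := h a; have := h b; have := h c; have := h d; rewrite !inE !eqxx ?orbT ?orTb.
  rewrite (eq_sym c a) (eq_sym c b) (eq_sym d a) (eq_sym d b).
  case: (a == c); case: (a == d); case: (b == c); case: (b == d); intuition.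
by rewrite setUC.
Qed.

Lemma mem_E a b : reflect (exists2 f, f \in es & [set f.1; f.2] = [set a; b]) ([set a; b] \in E).
Proof. by apply: (iffP imsetP) => -[f h1 h2]; exists f. Qed.

Lemma mem_expand (e : 'I_n * 'I_n) (s : seq nat) (v : 'I_n) :
  (val v \in expand n nes (nat_link e) s) =
  (val v \in s) || [exists u, (val u \in s) && adj (E :\ [set e.1; e.2]) u v].
Proof.
rewrite mem_filter mem_iota /= add0n ltn_ord andbT; congr (_ || _).
rewrite has_map; apply/hasP/existsP => [[f fs /= /andP[nf h]]|[u /andP[us]]].
  have nf' : [set f.1; f.2] != [set e.1; e.2].
    by case: f e nf {fs h} => [a b] [c d]; rewrite set2_eq.
  have fE : [set f.1; f.2] \in E by apply/imsetP; exists f.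
  case/orP: h => /andP[h1 /eqP/val_inj h2]; subst v.
    by exists f.1; rewrite h1 /adj !inE nf' fE.
  by exists f.2; rewrite h1 /adj setUC !inE nf' fE.
rewrite /adj !inE => /andP[ne /mem_E[f fs Ef]]; exists f => //=.
apply/andP; split.
  by rewrite -Ef in ne; case: f e ne {fs Ef} => [a b] [c d]; rewrite set2_eq.
move/eqP: Ef; case: f fs => [a b] _; rewrite set2_eq /same_edge /=.
move=> /orP[]/andP[/eqP -> /eqP ->]; first by rewrite us eqxx.
by rewrite us eqxx orbT.
Qed.

Lemma belowE (e : 'I_n * 'I_n) : below n nes (nat_link e) = bl [set e.1; e.2].
Proof.
set g := [set e.1; e.2]; pose s k := iter k (expand n nes (nat_link e)) [:: 0].
have sub k v : val v \in s k -> rside E r g v.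
  elim: k v => [|k IH] v; rewrite /s.
    by rewrite /= inE -r0 => /eqP/val_inj ->; apply: connect0.
  rewrite iterS mem_expand => /orP[/IH //|/existsP[u /andP[/IH ru uv]]].
  by apply: connect_trans ru (connect1 uv).
have sup p : path (adj (E :\ g)) r p -> val (last r p) \in s (size p).
  elim/last_ind: p => [|p v IH]; first by rewrite /s /= inE r0.
  rewrite rcons_path last_rcons size_rcons => /andP[/IH hp pv].
  rewrite /s iterS mem_expand; apply/orP; right; apply/existsP.
  by exists (last r p); rewrite hp.
have mono k k' (v : 'I_n) : k <= k' -> val v \in s k -> val v \in s k'.
  move=> /subnKC <-; elim: (k' - k) => [|j IH]; first by rewrite addn0.
  by move=> /IH h; rewrite addnS /s iterS mem_expand h.
have main (v : 'I_n) : (val v \in s n) = rside E r g v.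
  apply/idP/idP; first exact: sub.
  move=> /connectP[p0 /shortenP[p pth up _] ->]; apply: mono (sup p pth).
  (* A simple path has fewer than [n] edges, so [n] rounds of expansion reach the whole root
     side. *)
  have := max_card [pred x in r :: p]; rewrite card_ord => szp.
  by apply: leq_trans _ szp; rewrite (card_uniqP up) /=.
rewrite /below -/(s n) /bl -[iota 0 n]val_enum_ord filter_map enumT.
rewrite {1}/enum_mem -enumT; congr map; apply: eq_filter => v.
by rewrite /= main [RHS]inE.
Qed.

Let fam := cut_family n nes.

Lemma mem_cut_family s : reflect (exists2 e, e \in E & s = bl e) (s \in fam).
Proof.
rewrite /fam /cut_family mem_undup; apply: (iffP flatten_mapP) => [[j _]|[e eE ->]].
  rewrite mem_filter => /andP[_ /mapP[_ /mapP[f fs ->] ->]]; exists [set f.1; f.2].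
    by apply/imsetP; exists f.
  by rewrite belowE.
exists (size (bl e)).
  by rewrite mem_iota /= add0n ltnS size_map -cardE -[X in _ <= X](card_ord n) max_card.
rewrite mem_filter eqxx /=; case/imsetP: eE => f fs Ef.
by rewrite Ef -belowE; apply/map_f/map_f.
Qed.

Lemma sle_bl e g : sle (bl e) (bl g) = (bset E r e \subset bset E r g).
Proof.
apply/sleP/subsetP => h v; first by rewrite -!mem_bl; apply: h.
by move=> /blP[x -> xe]; rewrite mem_bl h.
Qed.

Lemma bl_inj : {in E &, injective bl}.
Proof.
move=> e g eE gE Eb; apply: (bset_inj (r := r) tree eE gE).
by apply/eqP; rewrite eqEsubset -!sle_bl Eb sle_refl.
Qed.

Lemma pairwise_by_size (X : seq edge) a k :
  pairwise (fun s t : edge => size s <= size t)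
    (flatten [seq [seq s <- X | size s == j] | j <- iota a k]).
Proof.
elim: k a => //= k IH a; rewrite pairwise_cat IH andbT; apply/andP; split.
  apply/allrelP => s t; rewrite mem_filter => /andP[/eqP -> _] /flatten_mapP[j].
  by rewrite mem_iota mem_filter => /andP[lej _] /andP[/eqP -> _]; apply: ltnW.
elim: X {IH} => //= s X; case: ifP => //= /eqP Es ->; rewrite andbT.
by apply/allP => t; rewrite mem_filter Es => /andP[/eqP ->].
Qed.

Lemma cut_family_laminar : laminar fam.
Proof.
split.
- exact: undup_uniq.
- exact: subseq_pairwise (undup_subseq _) (pairwise_by_size _ _ _).
- move=> s /mem_cut_family[e eE ->]; have [a [b [_ _ be]]] := lower_end r tree eE.
  by exists (val b); rewrite mem_bl.
- move=> s t /mem_cut_family[e eE ->] /mem_cut_family[g gE ->]; rewrite sle_bl => sub ne.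
  rewrite !size_map -!cardE; apply: proper_card; rewrite properE sub /=.
  apply: contra ne => sub'; rewrite /bl (_ : bset E r e = bset E r g) //.
  by apply/eqP; rewrite eqEsubset sub.
- move=> s t x /mem_cut_family[e eE ->] /mem_cut_family[g gE ->] /blP[v -> ve].
  rewrite mem_bl => vg; rewrite !sle_bl.
  exact: (bset_cross tree eE gE ve vg).
Qed.

Lemma cv_bl (l : 'I_n * 'I_n) e :
  cv (nat_link l) (bl e) = (rside E r e l.1 != rside E r e l.2).
Proof.
rewrite /cv !mem_bl !inE.
by case: (rside E r e l.1); case: (rside E r e l.2).
Qed.

Lemma mem_link_path l e : e \in E -> (e \in link_path E l) = cv (nat_link l) (bl e).
Proof. by move=> eE; rewrite (link_pathE r tree) inE eE cv_bl. Qed.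

Lemma leaf_below B g : {subset B <= fam} -> g \in B ->
  exists2 f, f \in leaves B & sle f g.
Proof.
move=> sB; have [k] := ubnP (size g); elim: k g => // k IH g ltk gB.
have [gl|] := boolP (g \in leaves B); first by exists g; rewrite ?sle_refl.
rewrite mem_filter gB andbT negbK => /hasP[f fB /andP[nfg fg]].
have ltfg := lam_size cut_family_laminar (sB _ fB) (sB _ gB) fg nfg.
have [f' f'l f'f] := IH f (leq_trans ltfg ltk) fB.
by exists f' => //; apply: sle_trans fg.
Qed.

(** The part is the union of the chains from its leaves to [t]: no cut edge lies above a leaf within
    the part, so each chain stays inside. *)
Lemma part_bundle D t gamma : {subset D <= fam} -> t \in fam ->
  size (leaves (part fam D t)) <= gamma ->
  bundle E gamma [set e in E | bl e \in part fam D t].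
Proof.
move=> sD tF szl; have tP : t \in part fam D t := part_self cut_family_laminar sD tF.
have sP : {subset part fam D t <= fam} by apply: part_fam.
have [g0 g0l _] := leaf_below sP tP.
apply: (bundle_seq (P := fun g => [set h in E | sle g (bl h) && sle (bl h) t]) g0l szl).
  move=> g; rewrite mem_filter => /andP[_ gP]; have /mem_partP[gF gt _] := gP.
  move: gt; have /mem_cut_family[e eE ->] := gF; have /mem_cut_family[f fE ->] := tF.
  rewrite sle_bl => /(chain_path tree eE fE)[u [s [v [ps hs]]]].
  exists u, s, v; split=> //; apply/setP => h; rewrite hs inE.
  by rewrite !sle_bl.
move=> e; rewrite inE; apply/andP/hasP => [[eE eP]|[g]].
  have [f fl fe] := leaf_below sP eP; exists f => //.
  by rewrite inE eE fe; case/mem_partP: eP.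
rewrite mem_filter inE => /andP[_ /mem_partP[gF gt hg]] /and3P[eE ge et]; split=> //.
apply/mem_partP; split=> //; first by apply/mem_cut_family; exists e.
by move=> d dD dt ed; apply: hg => //; apply: sle_trans ge ed.
Qed.

End Bridge.

(** * The guarantee of the algorithm on an instance *)

Import Order.TTheory GRing.Theory Num.Theory.
Local Open Scope ring_scope.

Lemma map_preimage (S T : eqType) (f : S -> T) (X : seq S) (Y : seq T) :
  {subset Y <= [seq f x | x <- X]} ->
  exists2 s : seq S, Y = [seq f x | x <- s] & {subset s <= X}.
Proof.
elim: Y => [|y Y IH] sub; first by exists [::].
have /mapP[x xX ->] : y \in [seq f x | x <- X] by apply: sub; rewrite mem_head.
have [|s -> sX] := IH; first by move=> z zY; apply: sub; rewrite inE zY orbT.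
by exists (x :: s) => // z; rewrite inE => /orP[/eqP ->|/sX].
Qed.

Lemma tap_alg_spec (R : realType) q (I : tap_instance) :
  (1 < q)%N -> tap_valid I -> feasible (tapE I) (tapL I) (tapL I) ->
  exists S : {set tapV I * tapV I},
    [/\ encodes_links (enc (tap_alg q (nat_instance I))) S,
        feasible (tapE I) (tapL I) S,
        covers (tapE I) (tapL I) (tapE I) &
        forall x : tapV I * tapV I -> R,
          LP_feasible (tapE I) (tapL I) (@unit_cost R (tapV I)) (4 * q ^ 2) x ->
          (3 * (q - 1) * #|S|)%:R <= (5 * (q - 1) + 40)%:R * \sum_(l in tapL I) x l].
Proof.
case: I => n es tl q1 [tree dis] feas.
have n0 : (0 < n)%N by case: (tree) => + _ _ _; rewrite card_ord.
pose r : 'I_n := Ordinal n0; have r0 : val r = 0%N by [].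
set I := TapInstance es tl in tree dis feas *.
set E := tapE I in tree dis feas *; set L := tapL I in dis feas *.
pose lks := undup tl; pose ls := [seq nat_link l | l <- lks].
pose fam := cut_family n [seq nat_link e | e <- es].
have mem_fam s : reflect (exists2 e, e \in E & s = bl es r e) (s \in fam).
  exact: mem_cut_family.
have lam : laminar fam by apply: cut_family_laminar r0.
have uls : uniq ls by rewrite map_inj_uniq ?undup_uniq //; exact: nat_link_inj.
have memL l : (l \in L) = (l \in lks) by rewrite inE mem_undup.
have crossed e : e \in E -> exists2 l, l \in L & rside E r e l.1 != rside E r e l.2.
  move: feas; rewrite (feasible_cuts r tree (subxx L) dis) => /forall_inP/[apply].
  by move/exists_inP.
have cover g : g \in fam -> has (fun l => cv l g) ls.
  move=> /mem_fam[e /crossed[l lL cl] ->]; apply/hasP; exists (nat_link l).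
    by rewrite map_f // -memL.
  by rewrite cv_bl.
have outE : tap_alg q (nat_instance I) =
    (iter (rounds q (size ls)) (step q fam) ([seq (l, 0%N) | l <- ls], ls)).2.
  by rewrite /tap_alg /= undup_map_inj //; exact: nat_link_inj.
have [uo sub ocov] := out_feasible q lam uls cover.
rewrite -outE in uo sub ocov.
have [s Es sX] := map_preimage sub.
have us : uniq s by move: uo; rewrite Es map_inj_uniq //; exact: nat_link_inj.
have SL : [set l in s] \subset L.
  by apply/subsetP => l; rewrite inE memL => /sX.
exists [set l in s]; split.
- by exists s; split=> //; rewrite Es enc_nat_links.
- rewrite (feasible_cuts r tree SL dis); apply/forall_inP => e eE.
  have /ocov/hasP[l' + cl] : bl es r e \in fam by apply/mem_fam; exists e.
  rewrite Es => /mapP[l lS El]; apply/exists_inP; exists l; first by rewrite inE.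
  by move: cl; rewrite El cv_bl.
- apply/coversP => e eE; have [l lL cl] := crossed e eE; exists l => //.
  by rewrite (link_pathE r tree) inE eE.
move=> x [hcut hpos hbun]; rewrite cardsE (card_uniqP us).
have <- : size (tap_alg q (nat_instance I)) = size s by rewrite Es size_map.
(* The algorithm works with pairs of numbers; [x] is transported to them, with value 0 at pairs that
   are no vertices. *)
pose xs (l : link) : R :=
  if insub l.1 is Some a then if insub l.2 is Some b then x (a, b) else 0 else 0.
have xsE l : xs (nat_link l) = x l by case: l => a b; rewrite /xs /= !valK.
have sumE (P : pred link) : \sum_(l <- ls | P l) xs l = \sum_(l in L | P (nat_link l)) x l.
  rewrite big_map big_mkcond big_uniq ?undup_uniq //= [RHS]big_mkcondr.
  by apply: eq_big => [l|l _]; rewrite ?memL // xsE.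
have covE (B : {set {set 'I_n}}) (A : seq edge) : B \subset E -> {subset A <= fam} ->
    (forall e, e \in E -> (bl es r e \in A) = (e \in B)) ->
    \sum_(l <- ls | has (cv l) A) xs l = \sum_(l in cov E L B) x l.
  move=> /subsetP BE AF AB; rewrite sumE; apply: eq_bigl => l; rewrite mem_cov.
  congr (_ && _); apply/hasP/exists_inP => [[s' sA cs]|[e eB el]].
    have /mem_fam[e eE Es'] := AF _ sA; exists e; first by rewrite -AB // -Es'.
    by rewrite (mem_link_path tree r) // -Es'.
  exists (bl es r e); first by rewrite AB // BE.
  by rewrite -(mem_link_path tree) // BE.
have LE : covers E L E.
  apply/coversP => e eE; have [l lL cl] := crossed e eE; exists l => //.
  by rewrite (link_pathE r tree) inE eE.
have -> : \sum_(l in L) x l = \sum_(l <- ls) xs l.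
  by rewrite (sumE predT); apply: eq_bigl => l; rewrite andbT.
rewrite outE; apply: (out_ratio lam uls q1 cover).
- by move=> _ /mapP[l lX ->]; rewrite xsE hpos // memL.
- move=> _ /mem_fam[e eE ->]; have := hcut e eE.
  rewrite -(covE _ [:: bl es r e]) ?sub1set //.
  + by under eq_bigl do rewrite /= orbF.
  + by move=> s'; rewrite inE => /eqP ->; apply/mem_fam; exists e.
  + move=> e' e'E; rewrite !inE; apply/eqP/eqP => [|-> //].
    exact: (bl_inj tree e'E eE).
- move=> D t k sD tF szl hk; set A := part fam D t in szl hk *.
  pose B := [set e in E | bl es r e \in A].
  have AF : {subset A <= fam} by apply: part_fam.
  rewrite (covE B) //; first last.
  + by move=> e eE; rewrite inE eE.
  + by apply/subsetP => e; rewrite inE => /andP[].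
  apply: (OPT_bundle LE (gamma := 4 * q ^ 2)); first by split.
    exact: (part_bundle tree r0 sD tF szl).
  move=> F /subsetP FL FB; have := hk [seq nat_link l | l <- enum F].
  rewrite size_map -cardE; apply.
    move=> _ /mapP[l lF ->]; apply: map_f; rewrite -memL; apply: FL.
    by rewrite mem_enum in lF.
  apply/allP => s' sA; have /mem_fam[e eE Es'] := AF _ sA.
  have [|l lF el] := coversP _ _ _ FB e; first by rewrite inE eE -Es'.
  apply/hasP; exists (nat_link l); first by rewrite map_f ?mem_enum.
  by rewrite Es' -(mem_link_path tree).
Qed.

Theorem theorem2 (R : realType) (eps : R) (eps_gt0 : 0 < eps) :
  exists gamma : nat, (0 < gamma)%N /\
  exists (alg : cmd) (a k : nat),
  forall I : tap_instance, tap_valid I ->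
  exists (out : data) (t : nat),
    [/\ runs alg (enc_instance I) out t,
        (t <= a * dsize (enc_instance I) ^ k + a)%N &
        feasible (tapE I) (tapL I) (tapL I) ->
        exists S : {set tapV I * tapV I},
          [/\ encodes_links out S,
              feasible (tapE I) (tapL I) S,
              #|S|%:R <= (5%:R / 3%:R + eps) * TAP_LP R I gamma,
              TAP_LP R I gamma <= TAP_OPT R I &
              #|S|%:R <= (5%:R / 3%:R + eps) * TAP_OPT R I]].
Proof.
(* The ratio obtained is [5 / 3 + 40 / (3 p)] with [p = q - 1], so [p] has to be at least
   [40 / (3 eps)]. *)
pose p := (Num.truncn (40%:R / (3%:R * eps))).+1; pose q := p.+1.
have hp : 40%:R <= 3%:R * eps * p%:R.
  rewrite -ler_pdivrMl ?mulr_gt0 ?ltr0n // mulrC; apply/ltW; exact: truncnS_gt.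
(* The bound of [size_leaves] on the number of paths that make up a small part. *)
exists (4 * q ^ 2)%N; split; first by rewrite muln_gt0 expn_gt0.
have [alg [a [k halg]]] := polyt_runs (polyt_tap_alg q).
exists alg, a, k => I vI; have [t [ht lt]] := halg (nat_instance I).
rewrite enc_nat_instance in ht lt.
exists (enc (tap_alg q (nat_instance I))), t; split=> // feas.
have [S [eS fS LE hS]] := tap_alg_spec R (isT : 1 < q)%N vI feas.
have K0 : 0 < 5%:R / 3%:R + eps by rewrite addr_gt0 ?divr_gt0 ?ltr0n.
have hLP : #|S|%:R <= (5%:R / 3%:R + eps) * TAP_LP R I (4 * q ^ 2).
  apply: (le_LP_value LE K0) => x hx; have := hS x hx; rewrite subSS subn0 => h.
  have X0 : 0 <= \sum_(l in tapL I) x l.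
    by case: hx => _ x0 _; apply: sumr_ge0 => l; apply: x0.
  have p0 : 0 < 3%:R * p%:R :> R by rewrite mulr_gt0 ?ltr0n.
  rewrite !natrM in h; rewrite -(ler_pM2l p0); apply: le_trans h _.
  rewrite mulrA ler_wpM2r // natrD natrM.
  have -> : 3%:R * p%:R * (5%:R / 3%:R + eps) = 5%:R * p%:R + 3%:R * eps * p%:R :> R.
    by field.
  by rewrite lerD2l.
have hO := LP_le_OPT R LE (4 * q ^ 2).
exists S; split=> //; apply: le_trans hLP _; by rewrite ler_pM2l.
Qed.
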